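(* Let $\mathcal{E}$ be an ellipse of eccentricity $e\in(0,1)$, and let $f_\lambda\colon\mathbb{A}\to f_\lambda(\mathbb{A})\subset\mathrm{int}(\mathbb{A})$ be a dissipative billiard map within $\mathcal{E}$ (the dissipation function $\lambda$ is allowed to be non-constant). Then the $2$-periodic orbits $\{H,f_\lambda(H)\}$ and $\{E,f_\lambda(E)\}$ corresponding to the trajectories along the major and minor axes are hyperbolic, of saddle and sink type respectively, and the attractor $\Lambda^0_\lambda$ and the Birkhoff attractor $\Lambda_\lambda$ satisfy $$\Lambda_\lambda^0=\Lambda_\lambda=\mathcal{W}^u(\mathcal{O}_\lambda(H))\cup\{E,f_\lambda(E)\}=\overline{\mathcal{W}^u(\mathcal{O}_\lambda(H))}.$$ Moreover, for $i=0,1$, $\mathcal{W}^u(f_\lambda^i(H);f_\lambda^2)\setminus\{f_\lambda^i(H)\}$ is the disjoint union of two branches $\mathscr{C}_i^1,\mathscr{C}_i^2$, with $\mathscr{C}_i^j\subset\mathcal{W}^s(f_\lambda^j(E);f_\lambda^2)$ for $j=1,2$.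
   Context: Billiard map: $\mathbb{T}=\mathbb{R}/\mathbb{Z}$, $\mathbb{A}=\mathbb{T}\times[-1,1]$ with coordinates $(s,r)$. Let $\Omega\subset\mathbb{R}^2$ be a strictly convex domain with $C^k$ boundary, $k\ge2$ (here the domain bounded by $\mathcal{E}$), with perimeter normalized to $1$, and let $\Upsilon\colon\mathbb{T}\to\mathbb{R}^2$ be an arclength parametrization of $\partial\Omega$. A pair $(s,r)\in\mathbb{A}$ represents the point $\Upsilon(s)$ together with a unit vector $v$ at $\Upsilon(s)$, pointing inward or tangent to $\partial\Omega$, where $r=\sin\varphi$ and $\varphi\in[-\frac\pi2,\frac\pi2]$ is the oriented angle from $v$ to the inward normal at $\Upsilon(s)$. The conservative billiard map is $f=f_1\colon\mathbb{A}\to\mathbb{A}$, $(s,r)\mapsto(s',r_1')$, where $\Upsilon(s')$ is the next point at which the half-line from $\Upsilon(s)$ in direction $v$ hits $\partial\Omega$ and $r_1'$ is the sine of the reflected angle at $\Upsilon(s')$ for the standard reflection law ($f$ is the identity on $\mathbb{T}\times\{\pm1\}$). Dissipative billiard map: let $\lambda\colon\mathbb{A}\to(0,1)$ be a $C^{k-1}$ function with $0<\partial_r\lambda(s,r)\,r+\lambda(s,r)<1$ for all $(s,r)\in\mathrm{int}(\mathbb{A})$, and let $\mathcal{H}_\lambda(s,r)=(s,\lambda(s,r)r)$. The dissipative billiard map associated to $\lambda$ is $f_\lambda:=\mathcal{H}_\lambda\circ f$. All these maps have the same $2$-periodic points as $f$ (orthogonal bounces, $r=0$). Attractors: $\Lambda^0_\lambda:=\bigcap_{k\ge0}f_\lambda^k(\mathbb{A})$.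 The set $\mathbb{A}\setminus\Lambda_\lambda^0$ is the disjoint union of two connected open sets $U_\lambda\supset\mathbb{T}\times\{-1\}$ and $V_\lambda\supset\mathbb{T}\times\{1\}$; the Birkhoff attractor is $\Lambda_\lambda:=\overline{U_\lambda}\cap\overline{V_\lambda}$. Invariant manifolds: for a $2$-periodic saddle $p$, $\mathcal{W}^{u}(p;f_\lambda^2)=\{x\in\mathbb{A}:\lim_{n\to+\infty}d(f_\lambda^{-2n}(x),p)=0\}$ (points all of whose backward iterates are defined), and $\mathcal{W}^u(\mathcal{O}_\lambda(p))=\mathcal{W}^u(p;f_\lambda^2)\cup\mathcal{W}^u(f_\lambda(p);f_\lambda^2)$. For a $2$-periodic sink $p$, $\mathcal{W}^{s}(p;f_\lambda^2)=\{x\in\mathbb{A}:\lim_{n\to+\infty}d(f_\lambda^{2n}(x),p)=0\}$. A $2$-periodic point is a sink if both eigenvalues of $Df_\lambda^2$ there have modulus $<1$, and a saddle if one has modulus $<1$ and the other modulus $>1$. *)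

(* Defs.v *)
From HB Require Import structures.
From mathcomp Require Import all_boot all_order all_algebra.
From mathcomp Require Import generic_quotient archimedean.
From mathcomp Require Import complex.
From mathcomp Require Import all_classical all_reals all_analysis.

Set Implicit Arguments.
Unset Strict Implicit.
Unset Printing Implicit Defensive.

Import Order.TTheory GRing.Theory Num.Theory.
Import numFieldNormedType.Exports.
Local Open Scope quotient_scope.
Local Open Scope classical_set_scope.
Local Open Scope ring_scope.

(* ** The circle R/Z and the closed annulus *)

Definition congr_int (R : realType) : rel R := fun x y => x - y \is a Num.int.

Lemma congr_int_refl (R : realType) : reflexive (@congr_int R).
Proof. by move=> x; rewrite /congr_int subrr rpred0. Qed.

Lemma congr_int_sym (R : realType) : symmetric (@congr_int R).
Proof. by move=> x y; rewrite /congr_int -rpredN opprB. Qed.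

Lemma congr_int_trans (R : realType) : transitive (@congr_int R).
Proof.
move=> y x z xy yz; rewrite /congr_int.
have -> : x - z = (x - y) + (y - z) by rewrite addrA subrK.
exact: rpredD.
Qed.

Canonical congr_int_equiv (R : realType) :=
  EquivRel (@congr_int R) (@congr_int_refl R) (@congr_int_sym R)
    (@congr_int_trans R).

Definition circle (R : realType) : Type :=
  quotient_topology {eq_quot (congr_int_equiv R)}.

HB.instance Definition _ (R : realType) := Topological.on (circle R).
HB.instance Definition _ (R : realType) := Quotient.on (circle R).

Definition cproj (R : realType) (x : R) : circle R := \pi_(circle R) x.

Lemma cproj_eqP (R : realType) (x y : R) :
  cproj x = cproj y <-> x - y \is a Num.int.
Proof. by split=> /(eqmodP (congr_int_equiv R)). Qed.

(* The annulus T x [-1, 1] and its manifold interior are subsets of the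
   cylinder T x R.  Maps of the annulus are total functions on the cylinder
   of which only the values on the annulus matter. *)
Definition annulus (R : realType) : set (circle R * R) :=
  [set x | `|x.2| <= 1].

Definition int_annulus (R : realType) : set (circle R * R) :=
  [set x | `|x.2| < 1].

(* ** The Euclidean plane

   The norm that the library puts on R * R is the sup norm, hence [enorm]. *)

Definition dot (R : realType) (u v : R * R) : R := u.1 * v.1 + u.2 * v.2.

Definition cross (R : realType) (u v : R * R) : R := u.1 * v.2 - u.2 * v.1.

Definition enorm (R : realType) (u : R * R) : R := Num.sqrt (dot u u).

(* Ellipses in arbitrary position, given by their foci and semi-major axis. *)
Definition ellipse (R : realType) (F1 F2 : R * R) (a : R) : set (R * R) :=
  [set P | enorm (P - F1) + enorm (P - F2) = 2 * a].

Definition ellipse_domain (R : realType) (F1 F2 : R * R) (a : R) :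
    set (R * R) :=
  [set P | enorm (P - F1) + enorm (P - F2) < 2 * a].

Definition eccentricity (R : realType) (F1 F2 : R * R) (a : R) : R :=
  enorm (F2 - F1) / (2 * a).

Definition major_axis_line (R : realType) (F1 F2 : R * R) : set (R * R) :=
  [set P | cross (P - F1) (F2 - F1) = 0].

Definition minor_axis_line (R : realType) (F1 F2 : R * R) : set (R * R) :=
  [set P | enorm (P - F1) = enorm (P - F2)].

(* A C^1 bijection of R/Z onto [Gamma] with unit speed; in particular [Gamma]
   has length 1.  Both orientations are allowed. *)
Definition arclength_param (R : realType) (Gamma : set (R * R))
    (Ups : circle R -> R * R) : Prop :=
  let c : R -> R * R := fun x => Ups (cproj x) in
  [/\ injective Ups, range Ups = Gamma,
      forall x, derivable c x 1,
      continuous (c^`())%classic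
    & forall x, enorm ((c^`())%classic x) = 1].

(* ** Billiard maps *)

Definition tangent (R : realType) (Ups : circle R -> R * R) (s : circle R) :
    R * R :=
  ((fun x : R => Ups (cproj x))^`())%classic (repr s).

Definition inward_normal (R : realType) (Omega : set (R * R))
    (Ups : circle R -> R * R) (s : circle R) (n : R * R) : Prop :=
  [/\ enorm n = 1, dot n (tangent Ups s) = 0
    & \forall t \near 0^'+, Omega (Ups s + t *: n)].

Definition reflect_dir (R : realType) (n v : R * R) : R * R :=
  v - (2 * dot v n) *: n.

(* For unit vectors v and n, [cross v n] is the sine of the oriented angle
   from v to n; this angle lies in [-pi/2, pi/2] iff 0 <= dot v n. *)
Definition billiard_step (R : realType) (Omega : set (R * R))
    (Ups : circle R -> R * R) (x y : circle R * R) : Prop :=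
  exists v n n' : R * R,
    [/\ inward_normal Omega Ups x.1 n, inward_normal Omega Ups y.1 n',
        [/\ enorm v = 1, 0 <= dot v n & cross v n = x.2],
        exists2 t : R, 0 < t & Ups y.1 = Ups x.1 + t *: v
      & y.2 = cross (reflect_dir n' v) n'].

(* When Omega is strictly convex and |r| < 1, the step out of (s, r) exists
   and is unique. *)
Definition billiard_map (R : realType) (Omega : set (R * R))
    (Ups : circle R -> R * R) (x : circle R * R) : circle R * R :=
  if `|x.2| < 1 then xget x [set y | billiard_step Omega Ups x y] else x.

(* Functions of class C^m on the plane: all the iterated partial derivatives
   up to order m exist and are continuous. *)
Fixpoint class_C (R : realType) (m : nat) (g : R * R -> R) : Prop :=
  match m with
  | 0%N => continuous g
  | m'.+1 =>
    [/\ forall x, derivable g x (1, 0), forall x, derivable g x (0, 1),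
        class_C m' (fun x => 'D_(1, 0) g x)
      & class_C m' (fun x => 'D_(0, 1) g x)]
  end.

(* Class C^m up to the boundary of the annulus: the lift to R x [-1, 1]
   extends to a function of class C^m on the plane. *)
Definition class_C_annulus (R : realType) (m : nat)
    (lam : circle R * R -> R) : Prop :=
  exists2 g : R * R -> R, class_C m g
    & forall s r : R, `|r| <= 1 -> lam (cproj s, r) = g (s, r).

Definition dissipation (R : realType) (m : nat)
    (lam : circle R * R -> R) : Prop :=
  [/\ class_C_annulus m lam,
      forall x, annulus x -> 0 < lam x < 1
    & forall (s : circle R) (r : R), int_annulus (s, r) ->
        0 < ((fun u : R => lam (s, u))^`())%classic r * r + lam (s, r) < 1].

Definition dissipative_billiard (R : realType) (Omega : set (R * R))
    (Ups : circle R -> R * R) (lam : circle R * R -> R) (x : circle R * R) :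
    circle R * R :=
  let y := billiard_map Omega Ups x in (y.1, lam y * y.2).

(* ** Attractors *)

Definition attractor (R : realType) (f : circle R * R -> circle R * R) :
    set (circle R * R) :=
  \bigcap_(k in [set: nat]) (iter k f @` annulus (R:=R)).

Definition open_in_annulus (R : realType) (U : set (circle R * R)) : Prop :=
  exists2 O : set (circle R * R), open O & U = annulus (R:=R) `&` O.

Definition complement_split (R : realType)
    (f : circle R * R -> circle R * R) (U V : set (circle R * R)) : Prop :=
  [/\ annulus (R:=R) `\` attractor f = U `|` V,
      U `&` V = set0,
      open_in_annulus U /\ open_in_annulus V,
      connected U /\ connected V
    & (forall s, U (s, -1)) /\ (forall s, V (s, 1))].

(* There is at most one pair (U, V) as above, namely the two connected
   components of the complement of the attractor. *)
Definition birkhoff_attractor (R : realType)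
    (f : circle R * R -> circle R * R) : set (circle R * R) :=
  [set x | exists U V : set (circle R * R),
     complement_split f U V /\ (closure U `&` closure V) x].

(* ** Periodic points and invariant sets *)

Definition two_periodic (R : realType) (f : circle R * R -> circle R * R)
    (p : circle R * R) : Prop :=
  [/\ annulus p, f (f p) = p & f p <> p].

Definition cyl_proj (R : realType) (x : 'rV[R]_2) : circle R * R :=
  (cproj (x 0 0), x 0 1).

(* The derivative of a map of the cylinder, read in the coordinates (s, r)
   through a local lift.  [jacobian] acts on row vectors, so that [M] is the
   transpose of the usual matrix; this does not affect its eigenvalues. *)
Definition cyl_derivative (R : realType)
    (F : circle R * R -> circle R * R) (p : circle R * R) (M : 'M[R]_2) :
    Prop :=
  exists (x : 'rV[R]_2) (G : 'rV[R]_2 -> 'rV[R]_2),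
    [/\ cyl_proj x = p,
        \forall y \near x, cyl_proj (G y) = F (cyl_proj y),
        differentiable G x
      & jacobian G x = M].

Definition complex_eigenvalue (R : realType) (M : 'M[R]_2) (z : R[i]) : bool :=
  eigenvalue (map_mx (real_complex R) M) z.

Definition sink (R : realType) (f : circle R * R -> circle R * R)
    (p : circle R * R) : Prop :=
  two_periodic f p /\
  exists2 M : 'M[R]_2, cyl_derivative (f \o f) p M
    & forall z, complex_eigenvalue M z -> `|z| < 1.

Definition saddle (R : realType) (f : circle R * R -> circle R * R)
    (p : circle R * R) : Prop :=
  two_periodic f p /\
  exists2 M : 'M[R]_2, cyl_derivative (f \o f) p M
    & exists z1 z2, [/\ complex_eigenvalue M z1, complex_eigenvalue M z2,
                        `|z1| < 1 & 1 < `|z2|].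

Definition stable_set2 (R : realType) (f : circle R * R -> circle R * R)
    (p : circle R * R) : set (circle R * R) :=
  [set x | annulus x /\ iter (2 * n) f x @[n --> \oo] --> p].

(* [y n] is the point f^(-2n)(x) of the annulus. *)
Definition unstable_set2 (R : realType) (f : circle R * R -> circle R * R)
    (p : circle R * R) : set (circle R * R) :=
  [set x | annulus x /\
     exists2 y : nat -> circle R * R,
       forall n, annulus (y n) /\ iter (2 * n) f (y n) = x
     & y n @[n --> \oo] --> p].

Definition unstable_set_orbit (R : realType)
    (f : circle R * R -> circle R * R) (p : circle R * R) :
    set (circle R * R) :=
  unstable_set2 f p `|` unstable_set2 f (f p).

(* The unstable set of p is an injectively parametrized curve through p, and
   C1, C2 are the two parts into which p divides it. *)
Definition unstable_branches (R : realType)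
    (f : circle R * R -> circle R * R) (p : circle R * R)
    (C1 C2 : set (circle R * R)) : Prop :=
  exists gam : R -> circle R * R,
    [/\ continuous gam, injective gam, gam 0 = p,
        range gam = unstable_set2 f p
      & C1 = gam @` [set t | t < 0] /\ C2 = gam @` [set t | 0 < t]].

(* Main.v *)
Require Import Defs.
From mathcomp Require Import all_boot all_order all_algebra.
From mathcomp Require Import ring lra.
From mathcomp Require Import generic_quotient.
From mathcomp Require Import complex.
From mathcomp Require Import all_classical all_reals all_analysis.

(** The map is read in affine coordinates in which the ellipse is the unit circle:
    the boundary points are (a X, b Y) with X^2 + Y^2 = 1 in the frame of the foci.
    There the conservative map is an explicit algebraic map ([nextX], [nextY],
    [nextr]).  Joachimsthal's first integral [energy], the product of N^2 and
    1 - r^2 with N the speed of (a cos t, b sin t), is preserved by it, while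
    dissipation decreases |r|.  Hence the energy never decreases along the
    dissipative orbits, and it is stationary for one step only when that step ends
    with r = 0 ([en_le], [en_eq]).  By the invariance principle ([lasalle]) forward
    and backward orbits can only cluster at the points of the two axes: the ends H,
    f(H) of the major axis, of energy b^2, and the ends E, f(E) of the minor axis,
    where the energy reaches its maximum a^2.  A point of the attractor has an
    infinite backward orbit, which has to tend to the major axis unless the point
    is E or f(E); so the attractor is the unstable set together with the sinks
    ([attractor_saddle], [attractorE]).  A chord of energy larger than b^2 passes
    between the foci, so Y changes sign at each bounce ([focal_side]); the sign of
    Y therefore decides which of the two sinks a forward orbit tends to
    ([forward_sink]).

    The complement of f(A) in A consists of two collars, and the forward images of
    a collar form a connected open set; these are the two components of the
    complement of the attractor ([collars], [side_split]).  On each vertical segment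
    the last point outside a given side belongs to the attractor and to the closure
    of that side ([vertical_meets]).  Near H the linear part of the map has an
    invariant cone ([hyperbolic_cone]), which forces two backward orbits staying
    near the major axis to approach each other and determines them by their
    position s ([borbit_pair]).  As backward orbits of attractor points
    close to the vertical of H never leave a neighbourhood of the axis
    ([orbit_trap]), the attractor is there the graph of a function of s
    ([unstable_graph]), so both sides touch all its points.  Pushing the graph
    forward, and passing to the limit for the sinks, one finds every point of the
    attractor in the closure of both sides, which identifies the attractor with the
    Birkhoff attractor ([birkhoffE]).

    The same graph parametrizes the unstable set.  The coordinate q(t) of the
    second preimage of the point W(t) of the graph is a contraction; extended to
    a homeomorphism Q of the line it gives the injective curve
    t -> f^2n (W (Q^n t)), n large ([unstable_curve]).

    Finally the derivative of f^2 at the ends of an axis has determinant l1 l2 and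
    trace P^2 (1 + l1 l2) + (l1 + l2) (P^2 - 1), where l1 and l2 are the
    dissipation factors at the two ends and P is the diagonal entry of the
    conservative derivative.  As P > 1 at the major axis and |P| < 1 at the minor
    axis, this gives a saddle and a sink ([second_iterate_derivative],
    [saddle_at], [sink_at]). *)

Set Implicit Arguments.
Unset Strict Implicit.
Unset Printing Implicit Defensive.

Import Order.TTheory GRing.Theory Num.Theory.
Import numFieldNormedType.Exports.
Local Open Scope classical_set_scope.
Local Open Scope ring_scope.

(** * Cluster points in compact sets *)

(** Otherwise the complement of U would generate with F a proper filter, which
    clusters somewhere in K. *)
Lemma compact_cluster_near (X : topologicalType) (K : set X) (F : set_system X)
    (U : set X) : ProperFilter F -> compact K -> F K ->
  (forall z, K z -> cluster F z -> within K (nbhs z) U) -> F U.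
Proof.
move=> PF cK FK clU; apply: contrapT => nFU.
have PG : ProperFilter (within (~` U) F).
  apply: Build_ProperFilter_ex => B FB; apply: contrapT => nB; apply: nFU.
  have {}FB : F [set y | (~` U) y -> B y] by [].
  apply: (filterS _ FB) => y By.
  by apply: contrapT => Uy; apply: nB; exists y; exact: By.
have sFG B : F B -> within (~` U) F B by move=> FB; apply: (filterS _ FB).
have [|z [Kz clz]] := cK _ PG; first exact: sFG.
have nU : within K (nbhs z) U.
  by apply: clU => // B C FB; apply: clz; exact: sFG.
have KU : within (~` U) F (K `&` ~` U).
  by apply: filterI; [exact: sFG|exact: withinT].
by have [y [[Ky Uy] KUy]] := clz _ _ KU nU; exact/Uy/KUy.
Qed.

Lemma compact_cvg (X : topologicalType) (K : set X) (F : set_system X) (x : X) :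
  ProperFilter F -> compact K -> F K ->
  (forall z, K z -> cluster F z -> z = x) -> F --> x.
Proof.
move=> PF cK FK clx U nU; rewrite nbhs_simpl.
apply: (compact_cluster_near PF cK FK) => z Kz /clx -> //.
by apply: filterS nU.
Qed.

Lemma cluster_image (X Z : topologicalType) (K : set X) (F : set_system X)
    (g : X -> Z) (x : X) (l : Z) :
  hausdorff_space Z -> {within K, continuous g} -> Filter F -> F K -> K x ->
  cluster F x -> g @ F --> l -> g x = l.
Proof.
move=> hZ /subspace_continuousP cg FF FK Kx clx gl.
apply: hZ => B C /(cg _ Kx) nB /gl nC.
have [||y [[Ky Cy] By]] := clx (K `&` g @^-1` C) [set y | K y -> B (g y)].
- exact: filterI.
- exact: nB.
by exists (g y); split => //; exact: By.
Qed.

(** A continuous injection of a compact set has a continuous inverse. *)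
Lemma compact_inj_cvg (X Z : topologicalType) (K : set X) (F : set_system X)
    (g : X -> Z) (x : X) :
  hausdorff_space Z -> {within K, continuous g} -> compact K ->
  (forall y z, K y -> K z -> g y = g z -> y = z) ->
  ProperFilter F -> F K -> K x -> g @ F --> g x -> F --> x.
Proof.
move=> hZ cg cK ig PF FK Kx gx; apply: (compact_cvg PF cK FK) => z Kz clz.
by apply: ig => //; apply: (cluster_image hZ cg _ FK Kz clz gx).
Qed.

Lemma within_continuous_comp (X Y Z : topologicalType) (A : set X) (B : set Y)
    (f : X -> Y) (g : Y -> Z) :
  {within A, continuous f} -> {within B, continuous g} ->
  (forall x, A x -> B (f x)) -> {within A, continuous (g \o f)}.
Proof.
move=> /subspace_continuousP cf /subspace_continuousP cg AB.
apply/subspace_continuousP => x Ax C nC.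
have nB : nbhs x [set y | A y -> B (f y) -> C (g (f y))].
  exact: (cf _ Ax _ (cg _ (AB _ Ax) _ nC)).
suff : nbhs x [set y | A y -> C (g (f y))] by [].
by apply: filterS nB => y h Ay; apply: h => //; exact: AB.
Qed.

Lemma cvg_pair_nbhs (T : Type) (U V : topologicalType) (F : set_system T)
    {FF : Filter F} (g : T -> U) (h : T -> V) (u : U) (v : V) :
  g t @[t --> F] --> u -> h t @[t --> F] --> v -> (g t, h t) @[t --> F] --> (u, v).
Proof. by move=> gu hv; exact: (@cvg_pair _ _ _ F (nbhs u) (nbhs v) _ _ _ g h). Qed.

(** * Attractors of maps that push an annulus into itself *)

Section Collars.
Context (T : topologicalType) (A : set T) (f : T -> T) (D bd : bool -> set T).
Hypothesis hT : hausdorff_space T.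
Hypothesis cA : compact A.
Hypothesis cf : {within A, continuous f}.
Hypothesis fA : forall x, A x -> A (f x).
Hypothesis finj : forall x y, A x -> A y -> f x = f y -> x = y.
Hypothesis DA : forall b, D b `<=` A.
Hypothesis cD : forall b, compact (D b).
Hypothesis connD : forall b, connected (D b).
Hypothesis bdD : forall b, bd b `<=` D b.
Hypothesis bd0 : forall b, bd b !=set0.
Hypothesis coverA : forall x, A x -> (f @` A) x \/ exists b, D b x.
Hypothesis fbdD : forall b x, bd b x -> D b (f x).
Hypothesis DfA : forall b x, D b x -> (f @` A) x -> (f @` bd b) x.
Hypothesis bdfA : forall b x, bd b x -> ~ (f @` A) x.
Hypothesis DD : forall x, D true x -> D false x -> False.

Definition collars (b : bool) : set T :=
  [set x | exists j, (iter j f @` D b) x].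

Lemma iterA k x : A x -> A (iter k f x).
Proof. by move=> Ax; elim: k => //= k; exact: fA. Qed.

Lemma iter_continuous k : {within A, continuous (iter k f)}.
Proof.
elim: k => [|k IH]; first by apply: continuous_subspaceT => x; exact: cvg_id.
exact: (within_continuous_comp IH cf (@iterA k)).
Qed.

Lemma iter_inj k x y : A x -> A y -> iter k f x = iter k f y -> x = y.
Proof. by move=> Ax Ay; elim: k => //= k IH /finj e; apply/IH/e; exact: iterA. Qed.

Lemma collar_neg b x : D b x -> D (~~ b) x -> False.
Proof. by case: b => /= ? ?; apply: (@DD x). Qed.

(** If x were an image of z, its last preimage would lie on the edge of the collar of x; it would
    be z itself or a point of f(A), and the edge contains neither. *)
Let aux n b x z : D b x -> D (~~ b) z -> x <> iter n f z.
Proof.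
case: n => [|n] Dx Dz xz; first by apply: (@collar_neg b x) => //; rewrite xz.
have Az := DA Dz; have Anz := iterA n Az.
have [w bw] : (f @` bd b) x by apply: DfA => //; rewrite xz; exists (iter n f z).
rewrite {}xz /= => /finj -/(_ _ _)/[dup]; have Aw := DA (bdD bw).
move=> /(_ Aw Anz) {}wz _; case: n Anz wz => [|n] Anz wz.
  by apply: (@collar_neg b z) => //; rewrite -[z]wz; exact: bdD.
by apply: (bdfA bw); exists (iter n f z) => //; exact: iterA.
Qed.

Lemma collars_disjoint b x : collars b x -> collars (~~ b) x -> False.
Proof.
have S b' i j y z : D b' y -> D (~~ b') z -> (i <= j)%N ->
    iter i f y <> iter j f z.
  move=> Dy Dz ij; rewrite -(subnKC ij) iterD => e.
  exact: aux Dy Dz (iter_inj (DA Dy) (iterA _ (DA Dz)) e).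
move=> [i [y Dy <-]] [j [z Dz /esym e]]; have [ij|/ltnW ji] := leqP i j.
  exact: (S b i j y z).
by apply: (S (~~ b) j i z y) => //; rewrite negbK.
Qed.

Let Att := \bigcap_(k in [set: nat]) (iter k f @` A).

(** A point outside the attractor has only finitely many iterated preimages, and
    the last one is in a collar. *)
Lemma collars_cover : A `\` Att = collars true `|` collars false.
Proof.
apply/seteqP; split=> x.
  move=> [Ax nx]; suff [b] : exists b, collars b x by case: b; [left|right].
  apply: contrapT => nc; apply: nx => k _; elim: k => [|k [y Ay yx]].
    by exists x.
  have [[z Az zy]|[b Dy]] := coverA Ay.
    by exists z => //; rewrite iterSr zy.
  by case: nc; exists b, k, y.
move=> cx; have {cx} [b [j [y Dy <-]]] : exists b, collars b x.
  by case: cx; [exists true|exists false].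
split; first by apply/iterA/DA/Dy.
move=> /(_ (j + 2) I)[z Az]; rewrite iterD => e.
have /= zy := iter_inj (iterA _ Az) (DA Dy) e.
have fzA : (f @` A) (f z) by exists z.
have [|w bw wy] := DfA Dy; first by exists (f z) => //; exact: fA.
apply: (bdfA bw); rewrite (_ : w = f z) //; apply: finj; last by rewrite zy.
  exact: (DA (bdD bw)).
exact: fA.
Qed.

Let C b := D b `\` (f @` A).
Let Z b k := [set x | A x /\ forall j, (j < k)%N -> ~ (iter j f @` C b) x].

Let collarsC b x : collars b x -> exists j, (iter j f @` C b) x.
Proof.
move=> [j [y Dy <-]]; have [fy|nfy] := pselect ((f @` A) y).
  have [w bw wy] := DfA Dy fy; exists j.+1, w; last by rewrite iterSr wy.
  by split; [exact: bdD|exact: (bdfA bw)].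
by exists j, y.
Qed.

Let ZS b k : Z b k.+1 = (f @` Z b k) `|` D (~~ b).
Proof.
apply/seteqP; split=> x.
  move=> [Ax nx]; have [[y Ay yx]|[b' Dx]] := coverA Ax.
    left; exists y => //; split=> // j jk [z Cz zy].
    by apply: (nx j.+1) => //; exists z => //=; rewrite zy.
  have [b'b|b'b] : b' = ~~ b \/ b' = b.
  - by case: (b) (b') => -[]; [right|left|left|right].
  - by right; rewrite -b'b.
  have [[y Ay yx]|nfx] := pselect ((f @` A) x).
    left; exists y => //; split=> // j jk [z Cz zy].
    by apply: (nx j.+1) => //; exists z => //=; rewrite zy.
  by exfalso; apply: (nx 0) => //; exists x => //; split => //; rewrite -b'b.
case=> [[y [Ay ny] <-]|Dx].
  split; first exact: fA.
  case=> [|j] jk [z Cz zy]; first by case: Cz => _; apply; exists y.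
  apply: (ny j) => //; exists z => //.
  exact: (finj (iterA j (DA (proj1 Cz))) Ay zy).
split; first exact: DA Dx.
move=> j _ [z [Dz _] zx]; apply: (@collars_disjoint b x); last by exists 0, x.
by exists j; exists z.
Qed.

Let closedZ b k : compact (Z b k).
Proof.
elim: k => [|k IH].
  suff -> : Z b 0 = A by [].
  by apply/seteqP; split=> x // [].
rewrite ZS; apply: compactU => //; apply: continuous_compact => //.
by apply: continuous_subspaceW cf => x [].
Qed.

(** The complement in A is the decreasing intersection of the sets Z b k.  They are compact,
    because each is the union of the image of the previous one and of the other collar. *)
Lemma collars_open b : exists2 O, open O & collars b = A `&` O.
Proof.
exists (~` (\bigcap_k Z b k)).
  apply: closed_openC; apply: closed_bigI => k _.
  exact: compact_closed.
apply/seteqP; split=> x.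
  move=> cx; split; first by case: cx => j [y Dy <-]; exact/iterA/DA/Dy.
  by have [j Cj] := collarsC cx; move=> /(_ j.+1 I)[_ /(_ j (ltnSn _))]; apply.
move=> [Ax nx]; apply: contrapT => ncx; apply: nx => k _; split=> // j _.
by move=> [y [Dy _] yx]; apply: ncx; exists j, y.
Qed.

(** Consecutive images of the collar meet: the image of the edge lies in the collar
    and in its image. *)
Lemma collars_connected b : connected (collars b).
Proof.
have -> : collars b = \bigcup_k \bigcup_(j in [set j | (j <= k)%N]) (iter j f @` D b).
  apply/seteqP; split=> x; last by move=> [k _ [j _ ?]]; exists j.
  by move=> [j jx]; exists j => //; exists j => //=.
have itc j : connected (iter j f @` D b).
  apply: connected_continuous_connected => //.
  exact: (continuous_subspaceW (@DA b) (@iter_continuous j)).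
have [x bx] := bd0 b.
apply: bigcup_connected.
  by exists x => k _; exists 0 => //; exists x => //; exact: bdD.
move=> k _; elim: k => [|k IH].
  suff -> : \bigcup_(j in [set j | (j <= 0)%N]) (iter j f @` D b) = D b by [].
  apply/seteqP; split=> y; last by exists 0 => //; exists y.
  by move=> [j /=]; rewrite leqn0 => /eqP-> [z Dz <-].
have -> : \bigcup_(j in [set j | (j <= k.+1)%N]) (iter j f @` D b) =
   (\bigcup_(j in [set j | (j <= k)%N]) (iter j f @` D b)) `|` (iter k.+1 f @` D b).
  apply/seteqP; split=> y.
    move=> [j /= +]; rewrite leq_eqVlt => /orP[/eqP-> ?|jk jy]; first by right.
    by left; exists j.
  by case=> [[j /= jk jy]|ky]; [exists j => //=; exact: leqW|exists k.+1 => /=].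
apply: connectedU => //; exists (iter k.+1 f x); split.
  exists k => //=; exists (f x) => //; first exact: fbdD.
  by rewrite -iterSr.
by exists x => //; exact: bdD.
Qed.

Lemma collars_forward b x : collars b x -> collars b (f x).
Proof. by move=> [j [y Dy <-]]; exists j.+1, y. Qed.

Lemma attractor_compact : compact Att.
Proof.
apply: (subclosed_compact _ cA); last by move=> x /(_ 0 I) [y Ay <-].
apply: closed_bigI => k _; apply: compact_closed => //.
elim: k => [|k IH]; first by rewrite (_ : iter 0 f @` A = A) //; exact: image_id.
have -> : iter k.+1 f @` A = f @` (iter k f @` A) by rewrite -image_comp.
apply: continuous_compact => //; apply: continuous_subspaceW cf.
by move=> _ [x Ax <-]; exact: iterA.
Qed.

End Collars.

(** * The billiard map of an ellipse in affine coordinates *)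

Section EllipseBilliard.
Context (R : realType) (a b : R).

(** The cosine of the angle of incidence, whose sine is r. *)
Definition cosr (r : R) : R := Num.sqrt (1 - r ^+ 2).
Definition sqspeed (X Y : R) : R := a ^+ 2 * Y ^+ 2 + b ^+ 2 * X ^+ 2.
Definition speed (X Y : R) : R := Num.sqrt (sqspeed X Y).
(** The vector ([dir1], [dir2]) points, in the affine coordinates, to the middle of an arc cut off
    by the chord issued from (X, Y), so that the second end of the chord is the reflection of
    (X, Y) in the line of this vector; [refl] is the coefficient of the reflection. *)
Definition dir1 (X Y r : R) : R := a * b * r * X - a ^+ 2 * cosr r * Y.
Definition dir2 (X Y r : R) : R := a * b * r * Y + b ^+ 2 * cosr r * X.
Definition refl (X Y r : R) : R :=
  2 * (dir1 X Y r * X + dir2 X Y r * Y) / (dir1 X Y r ^+ 2 + dir2 X Y r ^+ 2).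
Definition nextX (X Y r : R) : R := refl X Y r * dir1 X Y r - X.
Definition nextY (X Y r : R) : R := refl X Y r * dir2 X Y r - Y.
Definition nextr (X Y r : R) : R :=
  (b ^+ 2 * dir1 X Y r * nextX X Y r + a ^+ 2 * dir2 X Y r * nextY X Y r) /
  (a * b * speed X Y * speed (nextX X Y r) (nextY X Y r)).
(** Joachimsthal's first integral of the billiard in an ellipse. *)
Definition energy (X Y r : R) : R := sqspeed X Y * (1 - r ^+ 2).

Hypothesis (b0 : 0 < b) (ba : b < a).

Let a0 : 0 < a. Proof. exact: lt_trans ba. Qed.
Let c2gt0 : 0 < a ^+ 2 - b ^+ 2. Proof. by rewrite subr_gt0 ltr_sqr// nnegrE ltW. Qed.

Lemma cosr_ge0 r : 0 <= cosr r. Proof. exact: sqrtr_ge0. Qed.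

Lemma sqr_cosr r : `|r| <= 1 -> cosr r ^+ 2 = 1 - r ^+ 2.
Proof.
by move=> r1; rewrite sqr_sqrtr// subr_ge0 -real_normK ?num_real// expr_le1.
Qed.

Lemma cosr_gt0 r : `|r| < 1 -> 0 < cosr r.
Proof.
by move=> r1; rewrite sqrtr_gt0 subr_gt0 -real_normK ?num_real// expr_lt1.
Qed.

Lemma sqspeedE X Y : X ^+ 2 + Y ^+ 2 = 1 ->
  sqspeed X Y = b ^+ 2 + (a ^+ 2 - b ^+ 2) * Y ^+ 2.
Proof. move=> h; have X2 : X ^+ 2 = 1 - Y ^+ 2 by lra.
by rewrite /sqspeed X2; ring. Qed.

Lemma sqspeed_ge X Y : X ^+ 2 + Y ^+ 2 = 1 -> b ^+ 2 <= sqspeed X Y.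
Proof.
by move=> h; rewrite sqspeedE// lerDl mulr_ge0 ?sqr_ge0// ltW.
Qed.

Lemma sqspeed_le X Y : X ^+ 2 + Y ^+ 2 = 1 -> sqspeed X Y <= a ^+ 2.
Proof.
move=> h; rewrite sqspeedE//.
suff : (a ^+ 2 - b ^+ 2) * Y ^+ 2 <= (a ^+ 2 - b ^+ 2) * 1 by lra.
by rewrite ler_pM2l// -h lerDr sqr_ge0.
Qed.

Lemma sqspeed_gt0 X Y : X ^+ 2 + Y ^+ 2 = 1 -> 0 < sqspeed X Y.
Proof. by move=> /sqspeed_ge; apply: lt_le_trans; rewrite exprn_gt0. Qed.

Lemma speed_gt0 X Y : X ^+ 2 + Y ^+ 2 = 1 -> 0 < speed X Y.
Proof. by move=> h; rewrite sqrtr_gt0 sqspeed_gt0. Qed.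

Lemma sqr_speed X Y : X ^+ 2 + Y ^+ 2 = 1 -> speed X Y ^+ 2 = sqspeed X Y.
Proof. by move=> h; rewrite sqr_sqrtr// ltW// sqspeed_gt0. Qed.

Section Step.
Variables X Y r : R.
Hypothesis XY1 : X ^+ 2 + Y ^+ 2 = 1.
Hypothesis r1 : `|r| <= 1.

Let m := cosr r.
Let N := speed X Y.
Let p1 := dir1 X Y r.
Let p2 := dir2 X Y r.
Let k := refl X Y r.
Let X' := nextX X Y r.
Let Y' := nextY X Y r.
Let N' := speed X' Y'.
Let r' := nextr X Y r.

Let m2 : m ^+ 2 = 1 - r ^+ 2. Proof. exact: sqr_cosr. Qed.
Let N2 : N ^+ 2 = a ^+ 2 * Y ^+ 2 + b ^+ 2 * X ^+ 2. Proof. exact: sqr_speed. Qed.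
Let N0 : 0 < N. Proof. exact: speed_gt0. Qed.

Let cross_dir : p2 * X - p1 * Y = m * N ^+ 2.
Proof. by rewrite N2 /p1 /p2 /dir1 /dir2 -/m; ring. Qed.

Let dot_dir : p1 * X + p2 * Y = a * b * r - (a ^+ 2 - b ^+ 2) * m * (X * Y).
Proof.
by rewrite /p1 /p2 /dir1 /dir2 -/m -[in RHS](mulr1 (a * b * r)) -XY1; ring.
Qed.

Let dot_cross : p1 ^+ 2 + p2 ^+ 2 = (p1 * X + p2 * Y) ^+ 2 + (p2 * X - p1 * Y) ^+ 2.
Proof. by rewrite -[LHS]mulr1 -XY1; ring. Qed.

Lemma dir_gt0 : 0 < p1 ^+ 2 + p2 ^+ 2.
Proof.
rewrite lt_neqAle addr_ge0 ?sqr_ge0// andbT eq_sym dot_cross.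
rewrite paddr_eq0 ?sqr_ge0// !sqrf_eq0 cross_dir mulf_eq0 sqrf_eq0 (gt_eqF N0) orbF.
rewrite dot_dir; apply/negP => /andP[/eqP d /eqP m0]; move: d m2.
rewrite m0 mulr0 mul0r subr0 => /eqP; rewrite !mulf_eq0 (gt_eqF a0) (gt_eqF b0) /=.
by move=> /eqP ->; rewrite !expr0n/= subr0 => /esym/eqP; rewrite oner_eq0.
Qed.

Let kE : k * (p1 ^+ 2 + p2 ^+ 2) = 2 * (p1 * X + p2 * Y).
Proof. by rewrite /k /refl -/p1 -/p2 divfK// gt_eqF// dir_gt0. Qed.

Lemma next_unit : X' ^+ 2 + Y' ^+ 2 = 1.
Proof.
have -> : X' ^+ 2 + Y' ^+ 2 =
    k * (k * (p1 ^+ 2 + p2 ^+ 2) - 2 * (p1 * X + p2 * Y)) + (X ^+ 2 + Y ^+ 2).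
  by rewrite /X' /Y' /nextX /nextY -/p1 -/p2 -/k; ring.
by rewrite kE subrr mulr0 add0r.
Qed.

Let N'0 : 0 < N'. Proof. exact: speed_gt0 next_unit. Qed.
Let N'2 : N' ^+ 2 = a ^+ 2 * Y' ^+ 2 + b ^+ 2 * X' ^+ 2.
Proof. exact: sqr_speed next_unit. Qed.

Let cross_dir' : p2 * X' - p1 * Y' = - (m * N ^+ 2).
Proof.
by rewrite -cross_dir /X' /Y' /nextX /nextY -/p1 -/p2 -/k; ring.
Qed.

Let dot_dir' : p1 * X' + p2 * Y' = p1 * X + p2 * Y.
Proof.
have -> : p1 * X' + p2 * Y' = k * (p1 ^+ 2 + p2 ^+ 2) - (p1 * X + p2 * Y).
  by rewrite /X' /Y' /nextX /nextY -/p1 -/p2 -/k; ring.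
by rewrite kE; ring.
Qed.

Let dir_norm : a ^+ 2 * p2 ^+ 2 + b ^+ 2 * p1 ^+ 2 = (a * b * N) ^+ 2.
Proof.
rewrite exprMn N2 /p1 /p2 /dir1 /dir2 -/m.
have -> : (a ^+ 2 * Y ^+ 2 + b ^+ 2 * X ^+ 2) =
  (r ^+ 2 + m ^+ 2) * (a ^+ 2 * Y ^+ 2 + b ^+ 2 * X ^+ 2).
  by rewrite m2; ring.
ring.
Qed.

Let rE : r' * (a * b * N * N') = b ^+ 2 * p1 * X' + a ^+ 2 * p2 * Y'.
Proof.
by rewrite /r' /nextr divfK// !mulf_neq0 ?gt_eqF.
Qed.

Lemma nextr_cosr : 1 - r' ^+ 2 = (m * N / N') ^+ 2.
Proof.
have h0 : a * b * N * N' != 0 by rewrite !mulf_neq0 ?gt_eqF.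
have h2 : (a * b * N * N') ^+ 2 != 0 by rewrite sqrf_eq0.
apply: (mulIf h2); rewrite mulrBl mul1r -exprMn rE.
have -> : (a * b * N * N') ^+ 2 = (a * b * N) ^+ 2 * N' ^+ 2 by ring.
rewrite -[in LHS]dir_norm [in LHS]N'2.
have -> : (m * N / N') ^+ 2 * ((a * b * N) ^+ 2 * N' ^+ 2) =
   (a * b) ^+ 2 * (- (m * N ^+ 2)) ^+ 2.
  by field; rewrite gt_eqF.
rewrite -cross_dir'; ring.
Qed.

Lemma nextr_le1 : `|r'| <= 1.
Proof.
rewrite -(@expr_le1 _ 2)// real_normK ?num_real// -subr_ge0 nextr_cosr.
exact: sqr_ge0.
Qed.

Lemma cosr_nextr : cosr r' = m * N / N'.
Proof.
rewrite /cosr nextr_cosr sqrtr_sqr ger0_norm// divr_ge0 ?mulr_ge0 ?cosr_ge0//; exact: ltW.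
Qed.

(** The product m N of the cosine and the speed is the same at both ends of a chord. *)
Lemma energy_next : energy X' Y' r' = energy X Y r.
Proof.
rewrite /energy nextr_cosr -m2 -!sqr_speed//; last exact: next_unit.
by rewrite -/N -/N'; field; rewrite gt_eqF.
Qed.

Let rev1 : dir1 X' Y' (- r') = - (N' / N) * p1.
Proof.
rewrite /dir1 (_ : cosr (- r') = m * N / N'); last by rewrite -cosr_nextr /cosr sqrrN.
apply: (@mulIf _ (N * N')); first by rewrite mulf_neq0 ?gt_eqF.
have -> : - (N' / N) * p1 * (N * N') = - p1 * N' ^+ 2 by field; rewrite gt_eqF.
have -> : (a * b * - r' * X' - a ^+ 2 * (m * N / N') * Y') * (N * N') =
  - (r' * (a * b * N * N')) * X' + a ^+ 2 * (- (m * N ^+ 2)) * Y' by field; rewrite gt_eqF.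
rewrite rE -cross_dir' N'2; ring.
Qed.

Let rev2 : dir2 X' Y' (- r') = - (N' / N) * p2.
Proof.
rewrite /dir2 (_ : cosr (- r') = m * N / N'); last by rewrite -cosr_nextr /cosr sqrrN.
apply: (@mulIf _ (N * N')); first by rewrite mulf_neq0 ?gt_eqF.
have -> : - (N' / N) * p2 * (N * N') = - p2 * N' ^+ 2 by field; rewrite gt_eqF.
have -> : (a * b * - r' * Y' + b ^+ 2 * (m * N / N') * X') * (N * N') =
  - (r' * (a * b * N * N')) * Y' - b ^+ 2 * (- (m * N ^+ 2)) * X' by field; rewrite gt_eqF.
rewrite rE -cross_dir' N'2; ring.
Qed.

Let revk : refl X' Y' (- r') = - (N / N') * k.
Proof.
have pp := dir_gt0; rewrite /refl rev1 rev2 /k /refl -/p1 -/p2 -dot_dir'.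
have -> : (- (N' / N) * p1) ^+ 2 + (- (N' / N) * p2) ^+ 2 =
  (N' / N) ^+ 2 * (p1 ^+ 2 + p2 ^+ 2) by ring.
set S := _ ^+ 2 + _ in pp *; field; by rewrite !gt_eqF.
Qed.

(** Time reversal: the reflected direction is followed by changing the sign of r. *)
Lemma revX : nextX X' Y' (- r') = X.
Proof.
rewrite /nextX revk rev1 /X' /nextX -/k -/p1.
by field; rewrite !gt_eqF.
Qed.

Lemma revY : nextY X' Y' (- r') = Y.
Proof.
rewrite /nextY revk rev2 /Y' /nextY -/k -/p2.
by field; rewrite !gt_eqF.
Qed.

Lemma revr : nextr X' Y' (- r') = - r.
Proof.
rewrite /nextr revX revY rev1 rev2 -/N -/N'.
have h : b ^+ 2 * p1 * X + a ^+ 2 * p2 * Y = a * b * r * N ^+ 2.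
  by rewrite N2 /p1 /p2 /dir1 /dir2 -/m; ring.
have -> : b ^+ 2 * (- (N' / N) * p1) * X + a ^+ 2 * (- (N' / N) * p2) * Y =
  - (N' / N) * (b ^+ 2 * p1 * X + a ^+ 2 * p2 * Y) by ring.
by rewrite h; field; rewrite !gt_eqF.
Qed.

(** Up to a positive factor, Y Y' is the opposite of the sum of a square and of a positive multiple of
    energy - b^2: the chord crosses the major axis between the foci. *)
Lemma focal_side : b ^+ 2 < energy X Y r -> Y * Y' < 0.
Proof.
move=> E; have pp := dir_gt0.
rewrite -(pmulr_llt0 _ pp).
have -> : (Y * Y') * (p1 ^+ 2 + p2 ^+ 2) = p2 ^+ 2 - (p2 * X - p1 * Y) ^+ 2.
  transitivity ((k * (p1 ^+ 2 + p2 ^+ 2)) * p2 * Y - Y ^+ 2 * (p1 ^+ 2 + p2 ^+ 2)).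
    by rewrite /Y' /nextY -/k -/p2; ring.
  have e2 : p2 ^+ 2 = p2 ^+ 2 * (X ^+ 2 + Y ^+ 2) by rewrite XY1 mulr1.
  by rewrite kE [p2 ^+ 2 in RHS]e2; ring.
rewrite cross_dir -(pmulr_rlt0 _ (exprn_gt0 2 a0)) mulrBr.
have -> : a ^+ 2 * p2 ^+ 2 = (a * b * N) ^+ 2 - b ^+ 2 * p1 ^+ 2 by rewrite -dir_norm; ring.
have e : (m * N ^+ 2) ^+ 2 = energy X Y r * N ^+ 2.
  by rewrite /energy -sqr_speed// -m2 -/N; ring.
rewrite e.
have h1 : a ^+ 2 * b ^+ 2 * N ^+ 2 < a ^+ 2 * (energy X Y r * N ^+ 2).
  by rewrite -mulrA ltr_pM2l ?exprn_gt0// ltr_pM2r ?exprn_gt0.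
have h2 : 0 <= b ^+ 2 * p1 ^+ 2 by rewrite mulr_ge0 ?sqr_ge0.
by rewrite !exprMn; lra.
Qed.

(** A chord normal to the ellipse at both ends is a diameter, and the normal at (a X, b Y) points to the
    centre only if X Y = 0. *)
Lemma normal_both : r = 0 -> r' = 0 -> X * Y = 0.
Proof.
move=> r0 r'0; have m1 : m = 1 by rewrite /m /cosr r0 expr0n/= subr0 sqrtr1.
have p1E : p1 = - (a ^+ 2) * Y by rewrite /p1 /dir1 -/m m1 r0; ring.
have p2E : p2 = b ^+ 2 * X by rewrite /p2 /dir2 -/m m1 r0; ring.
have /eqP := rE; rewrite r'0 mul0r p1E p2E.
have -> : b ^+ 2 * (- a ^+ 2 * Y) * X' + a ^+ 2 * (b ^+ 2 * X) * Y' =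
   a ^+ 2 * b ^+ 2 * (X * Y' - Y * X') by ring.
have ab0 : a ^+ 2 * b ^+ 2 != 0 by rewrite mulf_neq0// expf_neq0// gt_eqF.
rewrite eq_sym mulf_eq0 (negbTE ab0)/= subr_eq0 => /eqP c0.
(* the sum k p of the two ends of the chord is parallel to (X, Y), while p is not *)
have k0 : k * (p2 * X - p1 * Y) = 0.
  have -> : k * (p2 * X - p1 * Y) = X * Y' - Y * X'.
    by rewrite /X' /Y' /nextX /nextY -/p1 -/p2 -/k; ring.
  by rewrite c0 subrr.
move/eqP: k0; rewrite cross_dir m1 mul1r mulf_eq0 sqrf_eq0 (gt_eqF N0) orbF => /eqP k0.
move/eqP: kE; rewrite k0 mul0r eq_sym mulf_eq0 pnatr_eq0 /= dot_dir r0 mulr0 sub0r.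
by rewrite m1 mulr1 oppr_eq0 mulf_eq0 (gt_eqF c2gt0)/= => /eqP.
Qed.

Lemma next_axis : r = 0 -> X * Y = 0 -> [/\ X' = - X, Y' = - Y & r' = 0].
Proof.
move=> r0 XY0.
have k0 : k = 0 by rewrite /k /refl -/p1 -/p2 dot_dir r0 XY0 !mulr0 subr0 mulr0 mul0r.
have e1 : X' = - X by rewrite /X' /nextX -/k k0 mul0r sub0r.
have e2 : Y' = - Y by rewrite /Y' /nextY -/k k0 mul0r sub0r.
split => //; rewrite /r' /nextr -/X' -/Y' -/p1 -/p2 e1 e2.
rewrite /p1 /p2 /dir1 /dir2 -/m r0.
set D := _ * _ * _ * _; suff -> : b ^+ 2 * (a * b * 0 * X - a ^+ 2 * m * Y) * - X +
  a ^+ 2 * (a * b * 0 * Y + b ^+ 2 * m * X) * - Y = 0 by rewrite mul0r.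
ring.
Qed.

(** Grazing directions are fixed, which agrees with the convention that the billiard
    map is the identity on the boundary of the annulus. *)
Lemma next_boundary : `|r| = 1 -> [/\ X' = X, Y' = Y & r' = r].
Proof.
move=> r1'; have m0 : m = 0.
  by rewrite /m /cosr -real_normK ?num_real// r1' expr1n subrr sqrtr0.
have rn0 : r != 0 by rewrite -normr_eq0 r1' oner_eq0.
have r21 : r ^+ 2 = 1 by rewrite -real_normK ?num_real// r1' expr1n.
have p1E : p1 = a * b * r * X by rewrite /p1 /dir1 -/m m0; ring.
have p2E : p2 = a * b * r * Y by rewrite /p2 /dir2 -/m m0; ring.
have h0 : a * b * r != 0 by rewrite !mulf_neq0// gt_eqF.
have kp : k * (a * b * r) = 2.
  apply: (mulIf h0); move: kE; rewrite p1E p2E => e.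
  transitivity (k * ((a * b * r * X) ^+ 2 + (a * b * r * Y) ^+ 2)).
    by rewrite -[LHS]mulr1 -XY1; ring.
  by rewrite e -[RHS]mulr1 -XY1; ring.
have e1 : X' = X by rewrite /X' /nextX -/k -/p1 p1E mulrA kp; ring.
have e2 : Y' = Y by rewrite /Y' /nextY -/k -/p2 p2E mulrA kp; ring.
split => //; rewrite /r' /nextr -/X' -/Y' -/p1 -/p2 e1 e2 -/N p1E p2E.
have -> : b ^+ 2 * (a * b * r * X) * X + a ^+ 2 * (a * b * r * Y) * Y =
  a * b * r * N ^+ 2 by rewrite N2; ring.
by field; rewrite !gt_eqF.
Qed.

(** The half angle atan of this number is the deviation of the chord from the one
    which joins two opposite points of the unit circle. *)
Definition slope (X Y r : R) : R :=
  (a * b * (r / cosr r) - (a ^+ 2 - b ^+ 2) * (X * Y)) / sqspeed X Y.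

Section Angle.
Hypothesis rlt1 : `|r| < 1.
Let K := slope X Y r.

Let m0 : 0 < m. Proof. exact: cosr_gt0. Qed.

Let KE : p1 * X + p2 * Y = m * N ^+ 2 * K.
Proof.
rewrite dot_dir /K /slope -sqr_speed// -/N -/m.
by field; rewrite !gt_eqF.
Qed.

Let p1K : p1 = m * N ^+ 2 * (K * X - Y).
Proof.
rewrite mulrBr [m * N ^+ 2 * (K * X)]mulrA -KE -cross_dir.
by rewrite -[LHS]mulr1 -XY1; ring.
Qed.

Let p2K : p2 = m * N ^+ 2 * (K * Y + X).
Proof.
rewrite mulrDr [m * N ^+ 2 * (K * Y)]mulrA -KE -cross_dir.
by rewrite -[LHS]mulr1 -XY1; ring.
Qed.

Let K1 : 0 < 1 + K ^+ 2. Proof. by rewrite ltr_pwDl// sqr_ge0. Qed.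

Let kK : k * (m * N ^+ 2) = 2 * K / (1 + K ^+ 2).
Proof.
have e : p1 ^+ 2 + p2 ^+ 2 = (m * N ^+ 2) ^+ 2 * (1 + K ^+ 2).
  rewrite dot_cross KE cross_dir; ring.
rewrite /k /refl -/p1 -/p2 e KE.
by field; rewrite !gt_eqF.
Qed.

Lemma nextXK : X' = ((K ^+ 2 - 1) * X - 2 * K * Y) / (1 + K ^+ 2).
Proof.
rewrite /X' /nextX -/k -/p1 p1K mulrA kK.
by field; rewrite gt_eqF.
Qed.

Lemma nextYK : Y' = ((K ^+ 2 - 1) * Y + 2 * K * X) / (1 + K ^+ 2).
Proof.
rewrite /Y' /nextY -/k -/p2 p2K mulrA kK.
by field; rewrite gt_eqF.
Qed.

Lemma nextrK :
  r' = m * N / (a * b * N') * (sqspeed X' Y' * K - (a ^+ 2 - b ^+ 2) * (X' * Y')).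
Proof.
have e1 : p1 = m * N ^+ 2 * (K * X' + Y').
  rewrite mulrDr [m * N ^+ 2 * (K * X')]mulrA -KE -dot_dir'.
  have -> : m * N ^+ 2 = - (p2 * X' - p1 * Y') by rewrite cross_dir' opprK.
  by rewrite -[LHS]mulr1 -next_unit; ring.
have e2 : p2 = m * N ^+ 2 * (K * Y' - X').
  rewrite mulrBr [m * N ^+ 2 * (K * Y')]mulrA -KE -dot_dir'.
  have -> : m * N ^+ 2 = - (p2 * X' - p1 * Y') by rewrite cross_dir' opprK.
  by rewrite -[LHS]mulr1 -next_unit; ring.
rewrite /r' /nextr -/X' -/Y' -/p1 -/p2 -/N -/N' e1 e2 /sqspeed.
by field; rewrite !gt_eqF.
Qed.

Lemma nextXY_angle th : X = cos th -> Y = sin th ->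
  X' = cos (th + (pi - 2 * atan K)) /\ Y' = sin (th + (pi - 2 * atan K)).
Proof.
move=> Xc Ys.
have c0 : cos (atan K) != 0 by rewrite gt_eqF// cos_gt0_pihalf// atan_gtNpi2 atan_ltpi2.
have cK : cos (atan K) ^+ 2 = (1 + K ^+ 2)^-1.
  by apply: invr_inj; rewrite invrK cos2_tan2// atanK.
have sK : sin (atan K) = K * cos (atan K).
  by rewrite -{2}(atanK K) /tan divfK.
have c2 : cos (2 * atan K) = (1 - K ^+ 2) / (1 + K ^+ 2).
  rewrite mulr2n mulrDl mul1r cosD sK.
  have -> : cos (atan K) * cos (atan K) - K * cos (atan K) * (K * cos (atan K)) =
    (1 - K ^+ 2) * cos (atan K) ^+ 2 by ring.
  by rewrite cK.
have s2 : sin (2 * atan K) = 2 * K / (1 + K ^+ 2).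
  rewrite mulr2n mulrDl mul1r sinD sK.
  have -> : K * cos (atan K) * cos (atan K) + cos (atan K) * (K * cos (atan K)) =
    2 * K * cos (atan K) ^+ 2 by ring.
  by rewrite cK mulr2n.
rewrite (cosD th) (sinD th) (cosB pi) (sinB pi) cospi sinpi c2 s2 nextXK nextYK -Xc -Ys.
by split; field; rewrite gt_eqF.
Qed.

End Angle.
End Step.
End EllipseBilliard.

(** * Strict derivatives *)

Section Strict.
Context (R : realType).
Implicit Types (g h k : R * R -> R) (p : R * R) (phi : R -> R).

(** The increment is compared between any two points close to x, not only between x and
    another point.  Two orbits near a fixed point are compared through this estimate. *)
Definition strict1 phi (x d : R) := forall e, 0 < e -> \forall z \near (x, x),
  `|phi z.1 - phi z.2 - d * (z.1 - z.2)| <= e * `|z.1 - z.2|.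

Definition strict g p (A B : R) := forall e, 0 < e -> \forall z \near (p, p),
  `|g z.1 - g z.2 - (A * (z.1.1 - z.2.1) + B * (z.1.2 - z.2.2))| <=
    e * `|z.1 - z.2|.

Definition lipnear g p := exists2 C, 0 < C & \forall z \near (p, p),
  `|g z.1 - g z.2| <= C * `|z.1 - z.2|.

Lemma near_fst (T U : topologicalType) (x : T) (y : U) (P : T -> Prop) :
  (\forall u \near x, P u) -> \forall z \near (x, y), P z.1.
Proof.
move=> nP; exists (P, setT) => /=; first by split=> //; exact: filterT.
by move=> z [].
Qed.

Lemma near_snd (T U : topologicalType) (x : T) (y : U) (P : U -> Prop) :
  (\forall u \near y, P u) -> \forall z \near (x, y), P z.2.
Proof.
move=> nP; exists (setT, P) => /=; first by split=> //; exact: filterT.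
by move=> z [].
Qed.

(** By the mean value theorem, a strict derivative is what continuity of the
    derivative provides. *)
Lemma C1_strict1 phi (dphi : R -> R) (x : R) :
  (\forall y \near x, is_derive (y : R) 1 phi (dphi y)) ->
  dphi y @[y --> x] --> dphi x -> strict1 phi x (dphi x).
Proof.
move=> /nbhs_ballP[d1 d10 D] C e e0.
have /nbhs_ballP[d2 d20 C'] : \forall y \near x, `|dphi x - dphi y| <= e.
  by move/cvgrPdist_le : C; apply.
pose d := Num.min d1 d2; have d0 : 0 < d by rewrite lt_min d10.
have H u v : ball x d u -> ball x d v -> u <= v ->
    `|phi v - phi u - dphi x * (v - u)| <= e * `|v - u|.
  move=> bu bv uv.
  have B w : u <= w <= v -> ball x d w.
    move: bu bv; rewrite /ball/= !ltr_distlC => /andP[? ?] /andP[? ?] /andP[? ?].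
    by apply/andP; split; lra.
  have Dw w : w \in `[u, v] -> is_derive w 1 phi (dphi w).
    rewrite in_itv/= => uwv; apply: D; apply: le_ball (B w uwv).
    by rewrite ge_min lexx.
  have cphi : {within `[u, v], continuous phi}.
    by apply: derivable_within_continuous => w /Dw[].
  have Dw' w : w \in `]u, v[ -> is_derive w 1 phi (dphi w).
    by move=> /subset_itv_oo_cc wI; exact: Dw.
  have [w wI eqw] := @MVT_segment _ phi dphi u v uv Dw' cphi.
  rewrite eqw.
  rewrite -mulrBl normrM ler_wpM2r// distrC; apply: C'.
  apply: le_ball (B w _); first by rewrite ge_min lexx orbT.
  by move: wI; rewrite in_itv.
apply: filterS (filterI (near_fst x (nbhsx_ballx x d d0)) (near_snd x (nbhsx_ballx x d d0))).
move=> [u v] /= [bu bv]; have [uv|/ltW vu] := leP v u; first exact: H.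
rewrite -[X in X <= _]normrN [`|u - v|]distrC.
by have -> : - (phi u - phi v - dphi x * (u - v)) = phi v - phi u - dphi x * (v - u);
  [ring|exact: H].
Qed.

Lemma normfst (u : R * R) : `|u.1| <= `|u|.
Proof. by rewrite prod_normE le_max lexx. Qed.

Lemma normsnd (u : R * R) : `|u.2| <= `|u|.
Proof. by rewrite prod_normE le_max lexx orbT. Qed.

Lemma norm_lin (A B : R) (u : R * R) : `|A * u.1 + B * u.2| <= (`|A| + `|B|) * `|u|.
Proof.
apply: (le_trans (ler_normD _ _)); rewrite !normrM mulrDl.
by apply: lerD; apply: ler_wpM2l => //; [exact: normfst|exact: normsnd].
Qed.

Lemma strict_lip g p A B : strict g p A B -> lipnear g p.
Proof.
move=> /(_ 1 ltr01) H; exists (1 + (`|A| + `|B|)).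
  by rewrite ltr_pwDl// addr_ge0.
apply: filterS H => z H.
have -> : g z.1 - g z.2 = (g z.1 - g z.2 - (A * (z.1.1 - z.2.1) + B * (z.1.2 - z.2.2))) +
  (A * (z.1.1 - z.2.1) + B * (z.1.2 - z.2.2)) by ring.
apply: (le_trans (ler_normD _ _)); rewrite mulrDl; apply: lerD => //.
exact: (norm_lin A B (z.1 - z.2)).
Qed.

Lemma lip_cvg g p : lipnear g p -> g x @[x --> p] --> g p.
Proof.
move=> [C C0] [[P Q]/= [nP nQ] H]; apply/cvgrPdist_le => e e0.
have pQ : Q p by exact: nbhs_singleton.
have nb : \forall x \near p, `|p - x| < e / C.
  by apply: (@cvgr_dist_lt _ _ _ (nbhs p) _ id) => //; rewrite divr_gt0.
apply: filterS2 nP nb => x Px xe.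
have := H (x, p) (conj Px pQ); rewrite /= distrC => /le_trans; apply.
by rewrite distrC -ler_pdivlMl// mulrC ltW.
Qed.

Lemma lip_near2 g p (P : R -> R -> Prop) : lipnear g p ->
  (\forall z \near (g p, g p), P z.1 z.2) -> \forall z \near (p, p), P (g z.1) (g z.2).
Proof.
move=> /lip_cvg gp [[P1 P2] [/= n1 n2] H].
have h1 := near_fst p (gp _ n1); have h2 := near_snd p (gp _ n2).
by apply: filterS2 h1 h2 => z z1 z2; exact: (H (g z.1, g z.2)).
Qed.

Lemma strict_cst (c : R) p : strict (fun=> c) p 0 0.
Proof.
by move=> e e0; apply: filterE => z; rewrite subrr !mul0r addr0 subr0 normr0 mulr_ge0// ltW.
Qed.

Lemma strict_fst p : strict fst p 1 0.
Proof.
by move=> e e0; apply: filterE => z; rewrite mul1r mul0r addr0 subrr normr0 mulr_ge0// ltW.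
Qed.

Lemma strict_snd p : strict snd p 0 1.
Proof.
by move=> e e0; apply: filterE => z; rewrite mul1r mul0r add0r subrr normr0 mulr_ge0// ltW.
Qed.

Lemma strictD g h p A B A' B' : strict g p A B -> strict h p A' B' ->
  strict (fun x => g x + h x) p (A + A') (B + B').
Proof.
move=> Hg Hh e e0; have e2 : 0 < e / 2 by rewrite divr_gt0.
apply: filterS2 (Hg _ e2) (Hh _ e2) => z hg hh.
rewrite [leRHS](_ : _ = e / 2 * `|z.1 - z.2| + e / 2 * `|z.1 - z.2|); last by rewrite -mulrDl -splitr.
apply: (le_trans _ (lerD hg hh)).
apply: (le_trans _ (ler_normD _ _)); rewrite le_eqVlt; apply/orP; left.
by apply/eqP; congr (`| _ |); ring.
Qed.

Lemma strict_scale (c : R) g p A B : strict g p A B ->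
  strict (fun x => c * g x) p (c * A) (c * B).
Proof.
move=> Hg e e0; have c1 : 0 < `|c| + 1 by rewrite ltr_pwDr.
have ec : 0 < e / (`|c| + 1) by rewrite divr_gt0.
apply: filterS (Hg _ ec) => z hg.
have -> : c * g z.1 - c * g z.2 - (c * A * (z.1.1 - z.2.1) + c * B * (z.1.2 - z.2.2)) =
  c * (g z.1 - g z.2 - (A * (z.1.1 - z.2.1) + B * (z.1.2 - z.2.2))) by ring.
rewrite normrM; apply: le_trans (ler_wpM2l (normr_ge0 c) hg) _.
rewrite mulrA ler_wpM2r// mulrCA ger_pMr// ler_pdivrMr// mul1r lerDl//.
Qed.

Lemma lip_cst (c : R) p : lipnear (fun=> c) p.
Proof. exact: strict_lip (strict_cst c p). Qed.

Lemma lipM g h p : lipnear g p -> lipnear h p -> lipnear (fun x => g x * h x) p.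
Proof.
move=> Lg Lh; have cg := lip_cvg Lg; have ch := lip_cvg Lh.
have [C C0 HC] := Lg; have [D D0 HD] := Lh.
have bnd (f : R * R -> R) : f x @[x --> p] --> f p -> \forall x \near p, `|f x| <= `|f p| + 1.
  move=> /cvgrPdist_le/(_ 1 ltr01); apply: filterS => x.
  move=> /(le_trans (ler_dist_dist _ _)); rewrite ler_distlC => /andP[_].
  by rewrite addrC.
have b1 := near_fst p (bnd _ cg); have b2 := near_snd p (bnd _ ch).
exists ((`|g p| + 1) * D + (`|h p| + 1) * C).
  by rewrite addr_gt0// mulr_gt0// ltr_wpDl.
near=> z.
have -> : g z.1 * h z.1 - g z.2 * h z.2 =
  g z.1 * (h z.1 - h z.2) + h z.2 * (g z.1 - g z.2) by ring.
apply: (le_trans (ler_normD _ _)); rewrite !normrM mulrDl -!mulrA.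
apply: lerD; apply: ler_pM => //.
- by near: z.
- by near: z.
- by near: z.
- by near: z.
Unshelve. all: by end_near. Qed.

Lemma lipD g h p : lipnear g p -> lipnear h p -> lipnear (fun x => g x + h x) p.
Proof.
move=> [C C0 HC] [D D0 HD]; exists (C + D); first exact: addr_gt0.
apply: filterS2 HC HD => z hC hD; rewrite mulrDl; apply: (le_trans _ (lerD hC hD)).
by apply: (le_trans _ (ler_normD _ _)); rewrite opprD addrACA.
Qed.

Lemma strict1_lip phi x d : strict1 phi x d -> exists2 C, 0 < C & \forall z \near (x, x),
  `|phi z.1 - phi z.2| <= C * `|z.1 - z.2|.
Proof.
move=> /(_ 1 ltr01) H; exists (1 + `|d|); first by rewrite ltr_pwDl.
apply: filterS H => z H.
have -> : phi z.1 - phi z.2 = (phi z.1 - phi z.2 - d * (z.1 - z.2)) +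
  d * (z.1 - z.2) by ring.
by apply: (le_trans (ler_normD _ _)); rewrite mulrDl mul1r lerD// ?normrM// -[leRHS]mul1r.
Qed.

Lemma lip_comp1 phi g p d : lipnear g p -> strict1 phi (g p) d ->
  lipnear (fun x => phi (g x)) p.
Proof.
move=> Lg /strict1_lip[D D0 HD]; have [C C0 HC] := Lg.
exists (D * C); first exact: mulr_gt0.
have HD' := @lip_near2 g p (fun u v => `|phi u - phi v| <= D * `|u - v|) Lg HD.
apply: filterS2 HC HD' => z hC /le_trans; apply.
by rewrite -mulrA ler_pM2l.
Qed.

Lemma strict_comp1 phi g p A B d : strict g p A B -> strict1 phi (g p) d ->
  strict (fun x => phi (g x)) p (d * A) (d * B).
Proof.
move=> Sg Sphi e e0; have Lg := strict_lip Sg; have [C C0 HC] := Lg.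
have e1 : 0 < e / 2 / C by rewrite !divr_gt0.
have H1 := @lip_near2 g p
  (fun u v => `|phi u - phi v - d * (u - v)| <= e / 2 / C * `|u - v|) Lg (Sphi _ e1).
have d1 : 0 < `|d| + 1 by rewrite ltr_wpDl.
have e2 : 0 < e / 2 / (`|d| + 1) by rewrite !divr_gt0.
apply: filterS3 HC H1 (Sg _ e2) => z hC h1 h2.
have -> : phi (g z.1) - phi (g z.2) - (d * A * (z.1.1 - z.2.1) + d * B * (z.1.2 - z.2.2)) =
  (phi (g z.1) - phi (g z.2) - d * (g z.1 - g z.2)) +
  d * (g z.1 - g z.2 - (A * (z.1.1 - z.2.1) + B * (z.1.2 - z.2.2))) by ring.
apply: (le_trans (ler_normD _ _)).
rewrite [leRHS](_ : _ = e / 2 * `|z.1 - z.2| + e / 2 * `|z.1 - z.2|);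
  last by rewrite -mulrDl -splitr.
apply: lerD.
  apply: (le_trans h1); apply: le_trans (ler_wpM2l (ltW e1) hC) _.
  by rewrite mulrA divfK ?gt_eqF.
rewrite normrM; apply: le_trans (ler_wpM2l (normr_ge0 d) h2) _.
by rewrite mulrA ler_wpM2r// mulrCA ger_pMr ?divr_gt0// ler_pdivrMr// mul1r lerDl.
Qed.

(** Where g vanishes, a Lipschitz bound on the other factor is enough and its derivative does not
    contribute.  The dissipation factor enters the derivatives in this way. *)
Lemma strict0M g h p A B : lipnear h p -> strict g p A B -> g p = 0 ->
  strict (fun x => h x * g x) p (h p * A) (h p * B).
Proof.
move=> Lh Sg g0 e e0; have Lg := strict_lip Sg; have [C C0 HC] := Lg.
have [D D0 HD] := Lh.
have e3 : 0 < e / 3 by rewrite divr_gt0.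
have c1 : \forall x \near p, `|h x - h p| <= e / 3 / C.
  move/cvgrPdist_le : (lip_cvg Lh) => /(_ (e / 3 / C)); rewrite divr_gt0// => /(_ isT).
  by apply: filterS => x; rewrite distrC.
have c2 : \forall x \near p, `|g x| <= e / 3 / D.
  move/cvgrPdist_le : (lip_cvg Lg) => /(_ (e / 3 / D)); rewrite divr_gt0// => /(_ isT).
  by apply: filterS => x; rewrite g0 sub0r normrN.
have n1 := near_fst p c1; have n2 := near_snd p c2.
have d1 : 0 < `|h p| + 1 by rewrite ltr_wpDl.
have e4 : 0 < e / 3 / (`|h p| + 1) by rewrite divr_gt0.
have S4 := Sg _ e4.
near=> z.
have -> : h z.1 * g z.1 - h z.2 * g z.2 -
    (h p * A * (z.1.1 - z.2.1) + h p * B * (z.1.2 - z.2.2)) =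
  (h z.1 - h p) * (g z.1 - g z.2) +
  h p * (g z.1 - g z.2 - (A * (z.1.1 - z.2.1) + B * (z.1.2 - z.2.2))) +
  (h z.1 - h z.2) * g z.2 by ring.
have -> : e * `|z.1 - z.2| = e / 3 / C * (C * `|z.1 - z.2|) +
  (`|h p| + 1) * (e / 3 / (`|h p| + 1) * `|z.1 - z.2|) +
  (D * `|z.1 - z.2|) * (e / 3 / D).
  by field; rewrite !gt_eqF.
apply: (le_trans (ler_normD _ _)); apply: lerD; last first.
  by rewrite normrM; apply: ler_pM => //; near: z.
apply: (le_trans (ler_normD _ _)); apply: lerD; rewrite normrM.
  by apply: ler_pM => //; near: z.
apply: ler_pM => //; first by rewrite lerDl.
by near: z.
Unshelve. all: by end_near. Qed.

Lemma lip_near_pair (F1 F2 : R * R -> R) p (P : R * R -> R * R -> Prop) :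
  lipnear F1 p -> lipnear F2 p ->
  (\forall z \near ((F1 p, F2 p), (F1 p, F2 p)), P z.1 z.2) ->
  \forall z \near (p, p), P (F1 z.1, F2 z.1) (F1 z.2, F2 z.2).
Proof.
move=> /lip_cvg c1 /lip_cvg c2 [[P1 P2] [/= n1 n2] H].
have cp : (F1 x, F2 x) @[x --> p] --> (F1 p, F2 p).
  exact: (@cvg_pair _ _ _ (nbhs p) (nbhs (F1 p)) (nbhs (F2 p)) _ _ _ F1 F2 c1 c2).
have h1 := near_fst p (cp _ n1); have h2 := near_snd p (cp _ n2).
by apply: filterS2 h1 h2 => z z1 z2; exact: (H ((F1 z.1, F2 z.1), (F1 z.2, F2 z.2))).
Qed.

Let pair_dist (F1 F2 : R * R -> R) C D (z : (R * R) * (R * R)) : 0 < C -> 0 < D ->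
  `|F1 z.1 - F1 z.2| <= C * `|z.1 - z.2| -> `|F2 z.1 - F2 z.2| <= D * `|z.1 - z.2| ->
  `|(F1 z.1, F2 z.1) - (F1 z.2, F2 z.2)| <= (C + D) * `|z.1 - z.2|.
Proof.
move=> C0 D0 h1 h2; rewrite prod_normE/= ge_max.
by rewrite (le_trans h1) ?(le_trans h2)// ler_wpM2r// ?lerDl ?lerDr ltW.
Qed.

Lemma lip_comp2 g (F1 F2 : R * R -> R) p : lipnear F1 p -> lipnear F2 p ->
  lipnear g (F1 p, F2 p) -> lipnear (fun x => g (F1 x, F2 x)) p.
Proof.
move=> L1 L2 [E E0 HE]; have [C C0 HC] := L1; have [D D0 HD] := L2.
exists (E * (C + D)); first by rewrite mulr_gt0// addr_gt0.
have HE' := lip_near_pair (P := fun u v => `|g u - g v| <= E * `|u - v|) L1 L2 HE.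
apply: filterS3 HC HD HE' => z h1 h2 /le_trans; apply.
by rewrite -mulrA ler_pM2l// (@pair_dist F1 F2).
Qed.

Lemma strict_comp2 g (F1 F2 : R * R -> R) p A B A1 B1 A2 B2 :
  strict F1 p A1 B1 -> strict F2 p A2 B2 -> strict g (F1 p, F2 p) A B ->
  strict (fun x => g (F1 x, F2 x)) p (A * A1 + B * A2) (A * B1 + B * B2).
Proof.
move=> S1 S2 Sg e e0; have L1 := strict_lip S1; have L2 := strict_lip S2.
have [C C0 HC] := L1; have [D D0 HD] := L2.
have e1 : 0 < e / 3 / (C + D) by rewrite !divr_gt0// addr_gt0.
have A0 : 0 < `|A| + 1 by rewrite ltr_wpDl.
have B0 : 0 < `|B| + 1 by rewrite ltr_wpDl.
have e2 : 0 < e / 3 / (`|A| + 1) by rewrite !divr_gt0.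
have e3 : 0 < e / 3 / (`|B| + 1) by rewrite !divr_gt0.
have H1 := lip_near_pair (P := fun u v => `|g u - g v - (A * (u.1 - v.1) + B * (u.2 - v.2))|
  <= e / 3 / (C + D) * `|u - v|) L1 L2 (Sg _ e1).
have H2 := S1 _ e2; have H3 := S2 _ e3.
near=> z.
have -> : g (F1 z.1, F2 z.1) - g (F1 z.2, F2 z.2) -
  ((A * A1 + B * A2) * (z.1.1 - z.2.1) + (A * B1 + B * B2) * (z.1.2 - z.2.2)) =
  (g (F1 z.1, F2 z.1) - g (F1 z.2, F2 z.2) - (A * (F1 z.1 - F1 z.2) + B * (F2 z.1 - F2 z.2)))
  + A * (F1 z.1 - F1 z.2 - (A1 * (z.1.1 - z.2.1) + B1 * (z.1.2 - z.2.2)))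
  + B * (F2 z.1 - F2 z.2 - (A2 * (z.1.1 - z.2.1) + B2 * (z.1.2 - z.2.2))) by ring.
have -> : e * `|z.1 - z.2| = e / 3 / (C + D) * ((C + D) * `|z.1 - z.2|) +
  (`|A| + 1) * (e / 3 / (`|A| + 1) * `|z.1 - z.2|) +
  (`|B| + 1) * (e / 3 / (`|B| + 1) * `|z.1 - z.2|).
  by field; rewrite !gt_eqF// addr_gt0.
apply: (le_trans (ler_normD _ _)); apply: lerD.
  apply: (le_trans (ler_normD _ _)); apply: lerD.
    apply: (@le_trans _ _ (e / 3 / (C + D) * `|(F1 z.1, F2 z.1) - (F1 z.2, F2 z.2)|)).
      by near: z.
    by rewrite ler_pM2l// (@pair_dist F1 F2)//; near: z.
  by rewrite normrM; apply: ler_pM => //; [rewrite lerDl|near: z].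
by rewrite normrM; apply: ler_pM => //; [rewrite lerDl|near: z].
Unshelve. all: by end_near. Qed.

Lemma strict_ext g h p A B : (\forall x \near p, g x = h x) -> strict g p A B -> strict h p A B.
Proof.
move=> gh Sg e e0; apply: filterS3 (near_fst p gh) (near_snd p gh) (Sg e e0).
by move=> z <- <-.
Qed.

End Strict.

(** * The lifted billiard map at the axes *)

Section StrictFunctions.
Context (R : realType).

Lemma strict1_sin (x : R) : strict1 sin x (cos x).
Proof.
by apply: C1_strict1; [apply: filterE => y; exact: is_derive_sin|exact: continuous_cos].
Qed.

Lemma strict1_cos (x : R) : strict1 cos x (- sin x).
Proof.
by apply: (C1_strict1 (dphi := fun y => - sin y));
  [apply: filterE => y; exact: is_derive_cos|apply: cvgN; exact: continuous_sin].
Qed.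

Lemma strict1_atan (x : R) : strict1 atan x (1 + x ^+ 2)^-1.
Proof.
apply: (C1_strict1 (dphi := fun y => (1 + y ^+ 2)^-1)).
  by apply: filterE => y; exact: is_derive1_atan.
apply: cvgV; first by rewrite gt_eqF// ltr_pwDl// sqr_ge0.
by apply: cvgD; [exact: cvg_cst|apply: exprn_continuous].
Qed.

Lemma strict1_sqrt (x : R) : 0 < x -> strict1 Num.sqrt x (2 * Num.sqrt x)^-1.
Proof.
move=> x0; apply: (C1_strict1 (dphi := fun y => (2 * Num.sqrt y)^-1)).
  by near=> y; apply: is_derive1_sqrt; near: y; exact: lt_nbhsr.
apply: cvgV; first by rewrite mulf_neq0// gt_eqF// sqrtr_gt0.
by apply: cvgM; [exact: cvg_cst|exact: sqrt_continuous].
Unshelve. all: by end_near. Qed.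

Lemma strict1_inv (x : R) : 0 < x -> strict1 (fun y => y^-1) x (- x ^- 2).
Proof.
move=> x0; apply: (C1_strict1 (dphi := fun y => - y ^- 2)).
  near=> y; have y0 : y != 0 by rewrite gt_eqF//; near: y; exact: lt_nbhsr.
  by have := @is_deriveV R id y 1 1 y0 _; rewrite scaler1; apply.
apply: cvgN; apply: cvgV; first by rewrite expf_neq0// gt_eqF.
exact: exprn_continuous.
Unshelve. all: by end_near. Qed.

Lemma strictM (g h : R * R -> R) (p : R * R) A B A' B' :
  strict g p A B -> strict h p A' B' ->
  strict (fun x => g x * h x) p (g p * A' + h p * A) (g p * B' + h p * B).
Proof.
move=> Sg Sh.
have S1 := strictD Sh (strict_cst (- h p) p).
have := strict0M (strict_lip Sg) S1 (subrr _).
move=> /strictD /(_ (strict_scale (h p) Sg)); rewrite !addr0.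
apply: strict_ext; apply: filterE => x; ring.
Qed.

Lemma strict_eq (g h : R * R -> R) (p : R * R) A B A' B' :
  g =1 h -> A = A' -> B = B' -> strict g p A B -> strict h p A' B'.
Proof. by move=> gh <- <-; apply: strict_ext; exact: filterE. Qed.

End StrictFunctions.

Section Lift.
Context (R : realType) (a b : R).
Hypothesis (b0 : 0 < b) (ba : b < a).

Let a0 : 0 < a. Proof. exact: lt_trans ba. Qed.
Let c2 := a ^+ 2 - b ^+ 2.

Definition slope_lift (p : R * R) : R := slope a b (cos p.1) (sin p.1) p.2.
(** The next angle is t + pi - 2 atan (slope); this lift of the circle map avoids any
    choice of a determination. *)
Definition angle_lift (p : R * R) : R := p.1 + (pi - 2 * atan (slope_lift p)).
Definition sin_lift (p : R * R) : R :=
  let th := angle_lift p in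
  cosr p.2 * speed a b (cos p.1) (sin p.1) / (a * b * speed a b (cos th) (sin th)) *
    (sqspeed a b (cos th) (sin th) * slope_lift p - c2 * (cos th * sin th)).

Let cs1 (t : R) : cos t ^+ 2 + sin t ^+ 2 = 1. Proof. exact: cos2Dsin2. Qed.

Lemma lip_sqspeed (t : R) r : lipnear (fun p => sqspeed a b (cos p.1) (sin p.1)) (t, r).
Proof.
have Ls := lip_comp1 (strict_lip (strict_fst (t, r))) (strict1_sin t).
have Lc := lip_comp1 (strict_lip (strict_fst (t, r))) (strict1_cos t).
rewrite /sqspeed; under eq_fun do rewrite !expr2.
by apply: lipD; apply: lipM; [exact: lip_cst|exact: lipM|exact: lip_cst|exact: lipM].
Qed.

Lemma lip_speed (t : R) r : lipnear (fun p => speed a b (cos p.1) (sin p.1)) (t, r).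
Proof.
apply: (lip_comp1 (phi := Num.sqrt) (lip_sqspeed t r)); apply: strict1_sqrt.
exact: sqspeed_gt0.
Qed.

Lemma lip_cosr (t : R) : lipnear (fun p => cosr p.2) (t, 0).
Proof.
have L2 := strict_lip (strict_snd (t, 0 : R)).
have := lipD (lip_cst 1 (t, 0)) (lipM (lip_cst (-1) (t, 0)) (lipM L2 L2)).
move=> /lip_comp1 /(_ (strict1_sqrt _)) /=.
rewrite mulr0 mulr0 addr0 => /(_ ltr01).
rewrite /cosr; under eq_fun do rewrite mulN1r -expr2.
by [].
Qed.

Lemma cosr0 : cosr (0 : R) = 1. Proof. by rewrite /cosr expr0n subr0 sqrtr1. Qed.

Section Base.
Variable t0 : R.
Hypothesis t0axis : cos t0 * sin t0 = 0.
Let w := sqspeed a b (cos t0) (sin t0).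
Let sg := cos t0 ^+ 2 - sin t0 ^+ 2.
Let p0 : R * R := (t0, 0).
Let w0 : 0 < w. Proof. exact: sqspeed_gt0. Qed.

Lemma slope_lift0 : slope_lift p0 = 0.
Proof. by rewrite /slope_lift /slope /= mul0r mulr0 t0axis mulr0 subrr mul0r. Qed.

Lemma angle_lift0 : angle_lift p0 = t0 + pi.
Proof. by rewrite /angle_lift slope_lift0 atan0 mulr0 subr0. Qed.

Let strict_cs (t r : R) : cos t ^+ 2 - sin t ^+ 2 = sg ->
  strict (fun p => cos p.1 * sin p.1) (t, r) sg 0.
Proof.
move=> <-.
have Ss := strict_comp1 (strict_fst (t, r)) (strict1_sin t).
have Sc := strict_comp1 (strict_fst (t, r)) (strict1_cos t).
by apply: strict_eq (strictM Sc Ss) => //=; ring.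
Qed.

Lemma strict_slope : strict slope_lift p0 (- c2 * sg / w) (a * b / w).
Proof.
have L1 : lipnear (fun p => a * b * (cosr p.2)^-1) p0.
  apply: lipM; first exact: lip_cst.
  apply: (lip_comp1 (phi := fun y => y^-1) (lip_cosr t0)).
  by apply: strict1_inv; rewrite /= cosr0.
have S1 := strict0M L1 (strict_snd p0) erefl.
have S2 := strictD S1 (strict_scale (- c2) (strict_cs 0 erefl)).
have L2 : lipnear (fun p => (sqspeed a b (cos p.1) (sin p.1))^-1) p0.
  by apply: (lip_comp1 (phi := fun y => y^-1) (lip_sqspeed t0 0)); exact: strict1_inv.
have := strict0M L2 S2.
rewrite /= t0axis !mulr0 addr0 => /(_ erefl); rewrite cosr0 invr1 -/w !mulr1.
apply: strict_eq => [p|| ]; rewrite /slope_lift /slope -/c2 -/w; ring.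
Qed.

Lemma strict_angle : strict angle_lift p0 (1 + 2 * c2 * sg / w) (- (2 * (a * b) / w)).
Proof.
have := strict_comp1 strict_slope (strict1_atan (slope_lift p0)).
rewrite slope_lift0 expr0n/= addr0 invr1 !mul1r => S.
have := strictD (strict_fst p0) (strictD (strict_cst pi p0) (strict_scale (-2) S)).
by apply: strict_eq => [p|| ]; rewrite /angle_lift; ring.
Qed.

Let ctpi : cos (t0 + pi) = - cos t0. Proof. by rewrite cosD cospi sinpi; ring. Qed.
Let stpi : sin (t0 + pi) = - sin t0. Proof. by rewrite sinD cospi sinpi; ring. Qed.

Let wE : w ^+ 2 + c2 * sg * w = (a * b) ^+ 2.
Proof.
have := cs1 t0; move/eqP: t0axis; rewrite mulf_eq0 /w /c2 /sg /sqspeed.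
by case/orP => /eqP -> ; rewrite ?expr0n/= ?addr0 ?add0r => ->; ring.
Qed.

Lemma sin_lift0 : sin_lift p0 = 0.
Proof.
rewrite /sin_lift slope_lift0 angle_lift0 ctpi stpi mulrNN t0axis !mulr0 subr0.
by rewrite mulr0.
Qed.

Lemma strict_sin : strict sin_lift p0
  (- (2 * c2 * sg * (a * b) / w ^+ 2)) (1 + 2 * c2 * sg / w).
Proof.
have La := strict_lip strict_angle.
pose s2 (p : R * R) := 0 : R.
have L0 : lipnear s2 p0 by exact: lip_cst.
have LN : lipnear (fun p => speed a b (cos (angle_lift p)) (sin (angle_lift p))) p0.
  apply: (lip_comp2 (g := fun p => speed a b (cos p.1) (sin p.1)) La L0).
  exact: lip_speed.
have LN2 : lipnear (fun p => sqspeed a b (cos (angle_lift p)) (sin (angle_lift p))) p0.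
  apply: (lip_comp2 (g := fun p => sqspeed a b (cos p.1) (sin p.1)) La L0).
  exact: lip_sqspeed.
have sw : sqspeed a b (cos (angle_lift p0)) (sin (angle_lift p0)) = w.
  by rewrite angle_lift0 ctpi stpi /w /sqspeed !sqrrN.
have sw' : speed a b (cos (angle_lift p0)) (sin (angle_lift p0)) = Num.sqrt w.
  by rewrite /speed sw.
have S1 := strict0M LN2 strict_slope slope_lift0.
have S2 : strict (fun p => cos (angle_lift p) * sin (angle_lift p)) p0
   (sg * (1 + 2 * c2 * sg / w)) (sg * - (2 * (a * b) / w)).
  have := @strict_comp2 _ (fun p => cos p.1 * sin p.1) _ _ p0 sg 0 _ _ _ _ strict_angle
    (strict_cst 0 p0).
  rewrite !mul0r !addr0 /=; apply; apply: strict_cs.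
  by rewrite angle_lift0 ctpi stpi !sqrrN.
have S3 := strictD S1 (strict_scale (- c2) S2).
have L1 : lipnear (fun p : R * R => cosr p.2 * speed a b (cos p.1) (sin p.1) /
   (a * b * speed a b (cos (angle_lift p)) (sin (angle_lift p)))) p0.
  apply: lipM; first by apply: lipM; [exact: lip_cosr|exact: lip_speed].
  apply: (lip_comp1 (phi := fun y => y^-1) (lipM (lip_cst (a * b) p0) LN)).
  by apply: strict1_inv; rewrite /= sw' !mulr_gt0// sqrtr_gt0.
have := strict0M L1 S3; rewrite slope_lift0 angle_lift0 ctpi stpi mulrNN t0axis.
rewrite !mulr0 addr0 => /(_ erefl).
have e : cosr p0.2 * speed a b (cos p0.1) (sin p0.1) /
   (a * b * speed a b (- cos t0) (- sin t0)) = (a * b)^-1.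
  have -> : speed a b (- cos t0) (- sin t0) = Num.sqrt w by rewrite -ctpi -stpi -angle_lift0.
  rewrite cosr0 /speed -/w.
  by field; rewrite !gt_eqF// sqrtr_gt0.
rewrite e -ctpi -stpi -angle_lift0 sw.
have c2E : c2 * sg = (a * b) ^+ 2 / w - w.
  by rewrite -wE; field; rewrite gt_eqF.
apply: strict_eq => [p||]; first by rewrite /sin_lift; ring.
  transitivity (- (c2 * sg) * (1 + (1 + 2 * (c2 * sg) / w)) / (a * b)).
    by field; rewrite !gt_eqF.
  transitivity (- (2 * (c2 * sg) * (a * b) / w ^+ 2)); last by ring.
  rewrite c2E; by field; rewrite !gt_eqF.
by field; rewrite !gt_eqF.
Qed.

End Base.
End Lift.

(** * Antiderivatives of continuous functions *)

Section Antiderivative.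
Context (R : realType).

Lemma is_derive_near (f g : R -> R) (x d : R) :
  (\forall y \near x, f y = g y) -> is_derive x 1 f d -> is_derive x 1 g d.
Proof. by move=> fg; apply: near_eq_is_derive => //; rewrite oner_eq0. Qed.

Lemma is_derive_ext (f g : R -> R) (x d : R) :
  f =1 g -> is_derive x 1 f d -> is_derive x 1 g d.
Proof. by move=> /funext ->. Qed.

(** Integration has to start below x, at some -n; normalized at 0, the antiderivatives obtained for different
    n agree where they are both defined. *)
Lemma antiderivative (f : R -> R) : continuous f ->
  exists F : R -> R, forall x : R, is_derive x 1 F (f x).
Proof.
move=> cf; pose mu := @lebesgue_measure R.
pose G (n : nat) (x : R) : R := (\int[mu]_(t in `[- n%:R, x]) (f t))%R.
have dG n (x : R) : - n%:R < x -> is_derive x 1 (G n) (f x).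
  move=> nx; have xu : x < x + 1 by rewrite ltrDl.
  have [|d e] := @continuous_FTC1_closed R f (- n%:R) x (x + 1) xu _ nx (cf x).
    apply: continuous_compact_integrable; first exact: segment_compact.
    exact: continuous_subspaceT.
  by apply: DeriveDef; [exact: d|rewrite -derive1E; exact: e].
pose F n (x : R) : R := G n x - G n 0.
have dF n (x : R) : - n%:R < x -> is_derive x 1 (F n) (f x).
  by move=> /dG D; rewrite -[f x]subr0; apply: is_deriveB.
have FE n k x : `|x| < n%:R -> `|x| < k%:R -> F n x = F k x.
  wlog nk : n k / (n <= k)%N.
    by move=> H xn xk; have [/H|/ltnW/H] := leqP n k; [exact|move=> ->].
  move=> xn _; apply/eqP; rewrite -subr_eq0; apply/eqP.
  pose D (y : R) : R := F n y - F k y.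
  have dD (y : R) : - n%:R < y -> is_derive y 1 D 0.
    move=> ny; rewrite -(subrr (f y)); apply: is_deriveB; apply: dF => //.
    by apply: le_lt_trans ny; rewrite lerN2 ler_nat.
  have D0 : D 0 = 0 by rewrite /D /F !subrr.
  move: xn; rewrite ltr_norml => /andP[nx xn].
  have n0 : - n%:R < 0 :> R by lra.
  have cD u v : - n%:R < u -> {within `[u, v], continuous D}.
    move=> nu; apply: derivable_within_continuous => y; rewrite in_itv/= => /andP[uy _].
    by have [] := dD y (lt_le_trans nu uy).
  have [x0|x0] := leP x 0.
    have [|z _] := @MVT_segment R D (cst 0) x 0 x0 _ (cD _ _ nx).
      by move=> y; rewrite in_itv/= => /andP[xy _]; apply/dD/(lt_trans nx).
    by rewrite mul0r D0 sub0r => /eqP; rewrite oppr_eq0 => /eqP.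
  have [|z _] := @MVT_segment R D (cst 0) 0 x (ltW x0) _ (cD _ _ n0).
    by move=> y; rewrite in_itv/= => /andP[xy _]; apply/dD/(lt_trans n0).
  by rewrite mul0r D0 subr0.
pose n (x : R) : nat := (Num.truncn `|x|).+1.
have nP (x : R) : `|x| < (n x)%:R by exact: truncnS_gt.
exists (fun x => F (n x) x) => x.
apply: (@is_derive_near (F (n x).+1)); last first.
  by apply: dF; have := nP x; rewrite ltr_norml => /andP[+ _];
    apply: le_lt_trans; rewrite lerN2 ler_nat.
have : \forall y \near x, `|x - y| < 1 by exact: (nbhsx_ballx x 1 ltr01).
apply: filterS => y xy; apply: FE => //; rewrite -natr1.
have -> : y = x + - (x - y) by ring.
by apply: (le_lt_trans (ler_normD _ _)); rewrite normrN ltrD.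
Qed.

Lemma is_derive_fst (c : R -> R * R) (x : R) : derivable c x 1 ->
  is_derive x 1 (fun y => (c y).1) ('D_1 c x).1.
Proof.
move=> dc; have dc' : h^-1 *: ((c \o shift x) (h *: 1) - c x) @[h --> 0^'] --> 'D_1 c x.
  exact: dc.
have H : (h^-1 *: ((c \o shift x) (h *: 1) - c x)).1 @[h --> 0^'] --> ('D_1 c x).1.
  move=> B /= nB; apply: (dc' (fst @^-1` B)).
  by have := near_fst ('D_1 c x).2 nB; rewrite -surjective_pairing.
apply: DeriveDef; first by apply/cvg_ex; exists ('D_1 c x).1; exact: H.
by apply/cvg_lim => //; exact: H.
Qed.

Lemma is_derive_snd (c : R -> R * R) (x : R) : derivable c x 1 ->
  is_derive x 1 (fun y => (c y).2) ('D_1 c x).2.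
Proof.
move=> dc; have dc' : h^-1 *: ((c \o shift x) (h *: 1) - c x) @[h --> 0^'] --> 'D_1 c x.
  exact: dc.
have H : (h^-1 *: ((c \o shift x) (h *: 1) - c x)).2 @[h --> 0^'] --> ('D_1 c x).2.
  move=> B /= nB; apply: (dc' (snd @^-1` B)).
  by have := near_snd ('D_1 c x).1 nB; rewrite -surjective_pairing.
apply: DeriveDef; first by apply/cvg_ex; exists ('D_1 c x).2; exact: H.
by apply/cvg_lim => //; exact: H.
Qed.

End Antiderivative.

(** * Ellipses in the frame of their foci *)

Section Coordinates.
Context (R : realType) (F1 F2 : R * R) (a e : R).
Hypothesis a0 : 0 < a.
Hypothesis ecc : eccentricity F1 F2 a = e.
Hypothesis e01 : 0 < e < 1.

Definition focal : R := enorm (F2 - F1) / 2.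
Definition semiminor : R := Num.sqrt (a ^+ 2 - focal ^+ 2).
(** Coordinates along the focal axis and across it; the first one is the abscissa counted
    from the first focus. *)
Definition frame1 (w : R * R) : R :=
  (w.1 * (F2.1 - F1.1) + w.2 * (F2.2 - F1.2)) / (2 * focal).
Definition frame2 (w : R * R) : R :=
  (w.2 * (F2.1 - F1.1) - w.1 * (F2.2 - F1.2)) / (2 * focal).
Definition coord1 (P : R * R) : R := (frame1 (P - F1) - focal) / a.
Definition coord2 (P : R * R) : R := frame2 (P - F1) / semiminor.

Local Notation c := focal.
Local Notation b := semiminor.

Lemma focalE : c = a * e.
Proof.
rewrite -ecc /eccentricity /c; field; by rewrite gt_eqF.
Qed.

Lemma focal_gt0 : 0 < c.
Proof. by rewrite focalE; case/andP: e01 => ? _; rewrite mulr_gt0. Qed.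

Lemma focal_lt : c < a.
Proof. by rewrite focalE; case/andP: e01 => _ ?; rewrite gtr_pMr. Qed.

Lemma sqr_semiminor : b ^+ 2 = a ^+ 2 - c ^+ 2.
Proof.
rewrite sqr_sqrtr// subr_ge0 ler_sqr ?nnegrE; first exact: ltW focal_lt.
  exact: ltW focal_gt0.
exact: ltW.
Qed.

Lemma semiminor_gt0 : 0 < b.
Proof.
rewrite sqrtr_gt0 subr_gt0 ltr_sqr ?nnegrE; first exact: focal_lt.
  exact: ltW focal_gt0.
exact: ltW.
Qed.

Lemma semiminor_lt : b < a.
Proof.
rewrite -ltr_sqr ?nnegrE; last exact: ltW.
  by rewrite sqr_semiminor gtrBl exprn_gt0// focal_gt0.
exact/ltW/semiminor_gt0.
Qed.

Let c0 := focal_gt0.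
Let b0 := semiminor_gt0.
Let c20 : 2 * c != 0. Proof. by rewrite gt_eqF// mulr_gt0. Qed.

Lemma focal_sqr : (F2.1 - F1.1) ^+ 2 + (F2.2 - F1.2) ^+ 2 = (2 * c) ^+ 2.
Proof.
rewrite /c mulrC divfK ?pnatr_eq0// /enorm /dot sqr_sqrtr -?expr2//.
by rewrite addr_ge0 ?sqr_ge0.
Qed.

Lemma frame_norm w z : w.1 * z.1 + w.2 * z.2 = frame1 w * frame1 z + frame2 w * frame2 z.
Proof.
rewrite /frame1 /frame2.
transitivity ((w.1 * z.1 + w.2 * z.2) * ((F2.1 - F1.1) ^+ 2 + (F2.2 - F1.2) ^+ 2) / (2 * c) ^+ 2).
  by rewrite focal_sqr mulfK// expf_neq0// mulf_neq0// gt_eqF.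
by field; rewrite gt_eqF.
Qed.

Lemma frame_cross w z : w.1 * z.2 - w.2 * z.1 = frame1 w * frame2 z - frame2 w * frame1 z.
Proof.
rewrite /frame1 /frame2.
transitivity ((w.1 * z.2 - w.2 * z.1) * ((F2.1 - F1.1) ^+ 2 + (F2.2 - F1.2) ^+ 2) / (2 * c) ^+ 2).
  by rewrite focal_sqr mulfK// expf_neq0// mulf_neq0// gt_eqF.
by field; rewrite gt_eqF.
Qed.

Definition unframe (x y : R) : R * R :=
  ((x * (F2.1 - F1.1) - y * (F2.2 - F1.2)) / (2 * c),
   (x * (F2.2 - F1.2) + y * (F2.1 - F1.1)) / (2 * c)).

Lemma unframe1 x y : frame1 (unframe x y) = x.
Proof.
rewrite /frame1 /=; transitivity (x * ((F2.1 - F1.1) ^+ 2 + (F2.2 - F1.2) ^+ 2) / (2 * c) ^+ 2).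
  by field; rewrite gt_eqF.
by rewrite focal_sqr mulfK// expf_neq0// mulf_neq0// gt_eqF.
Qed.

Lemma unframe2 x y : frame2 (unframe x y) = y.
Proof.
rewrite /frame2 /=; transitivity (y * ((F2.1 - F1.1) ^+ 2 + (F2.2 - F1.2) ^+ 2) / (2 * c) ^+ 2).
  by field; rewrite gt_eqF.
by rewrite focal_sqr mulfK// expf_neq0// mulf_neq0// gt_eqF.
Qed.

Lemma frame_inj w z : frame1 w = frame1 z -> frame2 w = frame2 z -> w = z.
Proof.
move=> h1 h2; have d1 : frame1 (w - z) = 0.
  by rewrite -(subrr (frame1 z)) -{1}h1 /frame1 /=; ring.
have d2 : frame2 (w - z) = 0.
  by rewrite -(subrr (frame2 z)) -{1}h2 /frame2 /=; ring.
have := frame_norm (w - z) (w - z); rewrite d1 d2 mulr0 addr0 -!expr2 => /eqP.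
rewrite paddr_eq0 ?sqr_ge0// !sqrf_eq0 /= !subr_eq0 => /andP[/eqP e1 /eqP e2].
by rewrite [w]surjective_pairing [z]surjective_pairing e1 e2.
Qed.

Lemma coord_inj P Q : coord1 P = coord1 Q -> coord2 P = coord2 Q -> P = Q.
Proof.
move=> /mulIf; rewrite invr_eq0 gt_eqF// => /(_ isT) /addIr h1.
move=> /mulIf; rewrite invr_eq0 gt_eqF// => /(_ isT) h2.
by apply: (@addIr _ (- F1)); exact: frame_inj.
Qed.

Lemma enorm_focus1 P : enorm (P - F1) ^+ 2 = (a * coord1 P + c) ^+ 2 + (b * coord2 P) ^+ 2.
Proof.
rewrite /enorm /dot sqr_sqrtr; last by rewrite -!expr2 addr_ge0 ?sqr_ge0.
rewrite frame_norm -!expr2 /coord1 /coord2.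
by congr (_ ^+ 2 + _ ^+ 2); field; rewrite gt_eqF.
Qed.

Lemma enorm_focus2 P : enorm (P - F2) ^+ 2 = (a * coord1 P - c) ^+ 2 + (b * coord2 P) ^+ 2.
Proof.
rewrite /enorm /dot sqr_sqrtr; last by rewrite -!expr2 addr_ge0 ?sqr_ge0.
have f1 : frame1 (P - F2) = frame1 (P - F1) - 2 * c.
  apply: (@mulIf _ (2 * c)) => //.
  have -> : (frame1 (P - F1) - 2 * c) * (2 * c) = frame1 (P - F1) * (2 * c) - (2 * c) ^+ 2.
    by ring.
  by rewrite -focal_sqr /frame1 !divfK//=; ring.
have f2 : frame2 (P - F2) = frame2 (P - F1) by rewrite /frame2 /=; ring.
rewrite frame_norm -!expr2 f1 f2 /coord1 /coord2.
by congr (_ ^+ 2 + _ ^+ 2); field; rewrite gt_eqF.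
Qed.

(** Both focal distances enter only through their squares, which are polynomials in the coordinates.  The second
    factor on the left is positive, so the first one has the sign of 1 - X^2 - Y^2. *)
Let key P : (4 * a ^+ 2 - (enorm (P - F1) + enorm (P - F2)) ^+ 2) *
  (4 * a ^+ 2 - (enorm (P - F1) - enorm (P - F2)) ^+ 2) =
  16 * a ^+ 2 * b ^+ 2 * (1 - (coord1 P ^+ 2 + coord2 P ^+ 2)).
Proof.
set d1 := enorm _; set d2 := enorm (P - F2).
have -> : (4 * a ^+ 2 - (d1 + d2) ^+ 2) * (4 * a ^+ 2 - (d1 - d2) ^+ 2) =
  16 * a ^+ 4 - 8 * a ^+ 2 * (d1 ^+ 2 + d2 ^+ 2) + (d1 ^+ 2 - d2 ^+ 2) ^+ 2 by ring.
rewrite enorm_focus1 enorm_focus2 exprMn !exprMn !sqr_semiminor.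
have c2 : c ^+ 2 = a ^+ 2 - b ^+ 2 by rewrite sqr_semiminor; ring.
rewrite /coord1; ring.
Qed.

Let dist_lt P : 0 < 4 * a ^+ 2 - (enorm (P - F1) - enorm (P - F2)) ^+ 2.
Proof.
set d1 := enorm _; set d2 := enorm (P - F2).
have d10 : 0 <= d1 by exact: sqrtr_ge0.
have d20 : 0 <= d2 by exact: sqrtr_ge0.
pose u := a * coord1 P; pose v := b * coord2 P.
have E1 : d1 ^+ 2 = (u + c) ^+ 2 + v ^+ 2 := enorm_focus1 P.
have E2 : d2 ^+ 2 = (u - c) ^+ 2 + v ^+ 2 := enorm_focus2 P.
have h : u ^+ 2 + v ^+ 2 - c ^+ 2 <= d1 * d2.
  have [n|/ltW n] := leP 0 (u ^+ 2 + v ^+ 2 - c ^+ 2); last first.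
    by apply: (le_trans n); exact: mulr_ge0.
  rewrite -ler_sqr ?nnegrE ?mulr_ge0// [(d1 * d2) ^+ 2]exprMn E1 E2 -subr_ge0.
  have -> : ((u + c) ^+ 2 + v ^+ 2) * ((u - c) ^+ 2 + v ^+ 2) -
    (u ^+ 2 + v ^+ 2 - c ^+ 2) ^+ 2 = (2 * c * v) ^+ 2 by ring.
  exact: sqr_ge0.
have -> : (d1 - d2) ^+ 2 = d1 ^+ 2 + d2 ^+ 2 - 2 * (d1 * d2) by ring.
rewrite E1 E2.
have ca : c ^+ 2 < a ^+ 2 by rewrite ltr_sqr ?nnegrE ?focal_lt// ltW.
have -> : (u + c) ^+ 2 + v ^+ 2 + ((u - c) ^+ 2 + v ^+ 2) =
  2 * (u ^+ 2 + v ^+ 2 - c ^+ 2) + 4 * c ^+ 2 by ring.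
lra.
Qed.

Lemma ellipseP P : ellipse F1 F2 a P <-> coord1 P ^+ 2 + coord2 P ^+ 2 = 1.
Proof.
have K := key P; have D := dist_lt P; rewrite /ellipse /=.
set s := enorm (P - F1) + _ in K *.
split=> [sE|Q].
  have n0 : 16 * a ^+ 2 * b ^+ 2 != 0 by rewrite gt_eqF// !mulr_gt0 ?exprn_gt0.
  move: K; rewrite sE (_ : 4 * a ^+ 2 - (2 * a) ^+ 2 = 0); last by ring.
  rewrite mul0r => /esym/eqP; rewrite mulf_eq0 (negbTE n0)/= subr_eq0.
  by move=> /eqP ->.
move: K; rewrite Q subrr mulr0 => /eqP; rewrite mulf_eq0 (gt_eqF D) orbF subr_eq0.
have -> : 4 * a ^+ 2 = (2 * a) ^+ 2 by ring.
have s0 : 0 <= s by rewrite addr_ge0// sqrtr_ge0.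
rewrite eqf_sqr => /orP[/eqP//|/eqP h].
have : 0 < 2 * a by rewrite mulr_gt0.
by rewrite h oppr_gt0 ltNge s0.
Qed.

Lemma ellipse_domainP P : ellipse_domain F1 F2 a P <-> coord1 P ^+ 2 + coord2 P ^+ 2 < 1.
Proof.
have K := key P; have D := dist_lt P; rewrite /ellipse_domain /=.
have ab : 0 < 16 * a ^+ 2 * b ^+ 2 by rewrite !mulr_gt0 ?exprn_gt0.
set s := enorm (P - F1) + _ in K *.
have s0 : 0 <= s by rewrite addr_ge0// sqrtr_ge0.
have E : (s < 2 * a) = (0 < 4 * a ^+ 2 - s ^+ 2).
  rewrite subr_gt0 (_ : 4 * a ^+ 2 = (2 * a) ^+ 2); last by ring.
  by rewrite ltr_sqr ?nnegrE// mulr_ge0// ltW.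
by rewrite E -(pmulr_lgt0 _ D) K (pmulr_rgt0 _ ab) subr_gt0; split.
Qed.

End Coordinates.

(** * Arclength parametrizations of an ellipse *)

Lemma unit_angle (R : realType) (x y : R) : x ^+ 2 + y ^+ 2 = 1 ->
  exists t, x = cos t /\ y = sin t.
Proof.
move=> h; have x1 : -1 <= x <= 1.
  rewrite -ler_norml -(@expr_le1 _ 2)// real_normK ?num_real//.
  by rewrite -h lerDl sqr_ge0.
have y2 : 1 - x ^+ 2 = y ^+ 2 by rewrite -h; ring.
have c : cos (acos x) = x by rewrite acosK.
have s : sin (acos x) = `|y| by rewrite sin_acos// y2 sqrtr_sqr.
have [y0|y0] := leP 0 y.
  by exists (acos x); rewrite c s ger0_norm.
by exists (- acos x); rewrite cosN sinN c s ltr0_norm// opprK.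
Qed.

Section Param.
Context (R : realType) (F1 F2 : R * R) (a e : R) (Ups : circle R -> R * R).
Hypothesis a0 : 0 < a.
Hypothesis ecc : eccentricity F1 F2 a = e.
Hypothesis e01 : 0 < e < 1.
Hypothesis hUps : arclength_param (ellipse F1 F2 a) Ups.

Local Notation b := (semiminor F1 F2 a).
Local Notation fc := (focal F1 F2).
Let b0 : 0 < b := semiminor_gt0 a0 ecc e01.
Let ba : b < a := semiminor_lt a0 ecc e01.

Definition cX (s : circle R) : R := coord1 F1 F2 a (Ups s).
Definition cY (s : circle R) : R := coord2 F1 F2 a (Ups s).

Lemma cXY1 s : cX s ^+ 2 + cY s ^+ 2 = 1.
Proof.
apply/(ellipseP a0 ecc e01); case: hUps => _ <- _ _ _; by exists s.
Qed.

Lemma cXY_inj s s' : cX s = cX s' -> cY s = cY s' -> s = s'.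
Proof. by move=> h1 h2; case: hUps => + _ _ _ _; apply; exact: (coord_inj a0 ecc e01 h1 h2). Qed.

Lemma cXY_surj x y : x ^+ 2 + y ^+ 2 = 1 -> exists s, cX s = x /\ cY s = y.
Proof.
move=> h; pose w := unframe F1 F2 (a * x + fc) (b * y).
pose P := w + F1.
have X1 : coord1 F1 F2 a P = x.
  by rewrite /coord1 /P addrK (unframe1 a0 ecc e01) addrK mulrAC divff ?mul1r// gt_eqF.
have Y1 : coord2 F1 F2 a P = y.
  by rewrite /coord2 /P addrK (unframe2 a0 ecc e01) mulrAC divff ?mul1r// gt_eqF.
have : ellipse F1 F2 a P by apply/(ellipseP a0 ecc e01); rewrite X1 Y1.
case: hUps => _ <- _ _ _ [s _ sP]; exists s.
by rewrite /cX /cY sP.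
Qed.

Let c (t : R) : R * R := Ups (cproj t).
Definition lX (t : R) : R := cX (cproj t).
Definition lY (t : R) : R := cY (cproj t).
Definition dX (t : R) : R := frame1 F1 F2 ('D_1 c t) / a.
Definition dY (t : R) : R := frame2 F1 F2 ('D_1 c t) / b.

Let dc (t : R) : derivable c t 1. Proof. by case: hUps. Qed.

Let is_derive_lin (A B K : R) (t : R) :
  is_derive t 1 (fun t => A * (c t).1 + (B * (c t).2 + K)) (A * ('D_1 c t).1 + (B * ('D_1 c t).2 + 0)).
Proof.
have D1 := @is_deriveZ _ _ _ (fun y => (c y).1) A t 1 _ (is_derive_fst (@dc t)).
have D2 := @is_deriveZ _ _ _ (fun y => (c y).2) B t 1 _ (is_derive_snd (@dc t)).
exact: (is_deriveD D1 (is_deriveD D2 (is_derive_cst K t 1))).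
Qed.

Let fc0 : 0 < fc := focal_gt0 a0 ecc e01.

Lemma is_derive_lX (t : R) : is_derive t 1 lX (dX t).
Proof.
have := is_derive_lin ((F2.1 - F1.1) / (2 * fc) / a) ((F2.2 - F1.2) / (2 * fc) / a)
  (coord1 F1 F2 a (0, 0)) t.
move=> H; have -> : dX t = (F2.1 - F1.1) / (2 * fc) / a * ('D_1 c t).1 +
  ((F2.2 - F1.2) / (2 * fc) / a * ('D_1 c t).2 + 0).
  by rewrite /dX /frame1; ring.
apply: is_derive_ext H => y.
by rewrite /lX /cX /coord1 /frame1 -/(c y) /=; ring.
Qed.

Lemma is_derive_lY (t : R) : is_derive t 1 lY (dY t).
Proof.
have := is_derive_lin (- (F2.2 - F1.2) / (2 * fc) / b) ((F2.1 - F1.1) / (2 * fc) / b)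
  (coord2 F1 F2 a (0, 0)) t.
move=> H; have -> : dY t = - (F2.2 - F1.2) / (2 * fc) / b * ('D_1 c t).1 +
  ((F2.1 - F1.1) / (2 * fc) / b * ('D_1 c t).2 + 0).
  by rewrite /dY /frame2; ring.
apply: is_derive_ext H => y.
by rewrite /lY /cY /coord2 /frame2 -/(c y) /=; ring.
Qed.

Lemma lX_continuous : continuous lX.
Proof. by move=> t; apply/differentiable_continuous/derivable1_diffP; have [] := is_derive_lX t. Qed.

Lemma lY_continuous : continuous lY.
Proof. by move=> t; apply/differentiable_continuous/derivable1_diffP; have [] := is_derive_lY t. Qed.

Lemma cX_continuous : continuous cX.
Proof. by apply/quotient_continuous; exact: lX_continuous. Qed.

Lemma cY_continuous : continuous cY.
Proof. by apply/quotient_continuous; exact: lY_continuous. Qed.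

Let cD : continuous (fun t => 'D_1 c t).
Proof.
have -> : (fun t => 'D_1 c t) = (c^`())%classic by apply/funext => t; rewrite derive1E.
by case: hUps.
Qed.

Let cD1 : continuous (fun t => ('D_1 c t).1).
Proof.
move=> t B nB; have := near_fst ('D_1 c t).2 nB.
by rewrite -surjective_pairing; exact: (@cD t).
Qed.

Let cD2 : continuous (fun t => ('D_1 c t).2).
Proof.
move=> t B nB; have := near_snd ('D_1 c t).1 nB.
by rewrite -surjective_pairing; exact: (@cD t).
Qed.

Let cD_lin (A B : R) : continuous (fun t => A * ('D_1 c t).1 + B * ('D_1 c t).2).
Proof.
move=> t.
have h1 : A * ('D_1 c u).1 @[u --> t] --> A * ('D_1 c t).1.
  by apply: cvgM; [exact: cvg_cst|exact: cD1].
have h2 : B * ('D_1 c u).2 @[u --> t] --> B * ('D_1 c t).2.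
  by apply: cvgM; [exact: cvg_cst|exact: cD2].
by apply: cvgD; [exact: h1|exact: h2].
Qed.

Let dX_continuous : continuous dX.
Proof.
have -> : dX = fun t => (F2.1 - F1.1) / (2 * fc) / a * ('D_1 c t).1 +
  (F2.2 - F1.2) / (2 * fc) / a * ('D_1 c t).2.
  by apply/funext => t; rewrite /dX /frame1; ring.
exact: cD_lin.
Qed.

Let dY_continuous : continuous dY.
Proof.
have -> : dY = fun t => - (F2.2 - F1.2) / (2 * fc) / b * ('D_1 c t).1 +
  (F2.1 - F1.1) / (2 * fc) / b * ('D_1 c t).2.
  by apply/funext => t; rewrite /dY /frame2; ring.
exact: cD_lin.
Qed.

Lemma tangent_unit (t : R) : (a * dX t) ^+ 2 + (b * dY t) ^+ 2 = 1.
Proof.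
have -> : a * dX t = frame1 F1 F2 ('D_1 c t) by rewrite /dX mulrC divfK// gt_eqF.
have -> : b * dY t = frame2 F1 F2 ('D_1 c t) by rewrite /dY mulrC divfK// gt_eqF.
rewrite !expr2 -(frame_norm a0 ecc e01); case: hUps => _ _ _ _ /(_ t).
rewrite derive1E /enorm /dot => h; rewrite -[LHS]sqr_sqrtr ?h ?expr1n//.
by rewrite -!expr2 addr_ge0 ?sqr_ge0.
Qed.

Lemma lXY_dXY (t : R) : lX t * dX t + lY t * dY t = 0.
Proof.
have H := is_deriveD (is_deriveM (is_derive_lX t) (is_derive_lX t))
  (is_deriveM (is_derive_lY t) (is_derive_lY t)).
have C : is_derive t 1 (lX * lX + lY * lY) 0.
  have C0 : is_derive t 1 (cst 1 : R -> R) (0 : R) by exact: is_derive_cst.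
  apply: (is_derive_ext _ C0) => u.
  by rewrite /= -[LHS](cXY1 (cproj u)) !expr2.
have := @derive_val _ _ _ _ _ _ _ H; rewrite (@derive_val _ _ _ _ _ _ _ C) => /esym h.
have {}h : lX t * dX t + lX t * dX t + (lY t * dY t + lY t * dY t) = 0 by exact: h.
lra.
Qed.

(** The angular velocity of the point (X, Y) of the unit circle. *)
Definition omega (t : R) : R := lX t * dY t - lY t * dX t.

Let lXY1 t : lX t ^+ 2 + lY t ^+ 2 = 1. Proof. exact: cXY1. Qed.

Lemma dX_omega (t : R) : dX t = - omega t * lY t.
Proof.
rewrite -[LHS]mulr1 -(lXY1 t) /omega -[LHS]addr0 -[X in _ + X](mul0r (lX t)) -oppr0 -(lXY_dXY t).
ring.
Qed.

Lemma dY_omega (t : R) : dY t = omega t * lX t.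
Proof.
rewrite -[LHS]mulr1 -(lXY1 t) /omega -[LHS]addr0 -[X in _ + X](mul0r (lY t)) -oppr0 -(lXY_dXY t).
ring.
Qed.

Lemma omega_speed (t : R) : omega t ^+ 2 * sqspeed a b (lX t) (lY t) = 1.
Proof.
by rewrite -(tangent_unit t) dX_omega dY_omega /sqspeed; ring.
Qed.

Lemma omega_continuous : continuous omega.
Proof.
move=> t; apply: cvgB; apply: cvgM; [exact: lX_continuous|exact: dY_continuous|
  exact: lY_continuous|exact: dX_continuous].
Qed.

Lemma omega_neq0 t : omega t != 0.
Proof.
by apply/eqP => h; have /eqP := omega_speed t; rewrite h expr0n mul0r eq_sym oner_eq0.
Qed.

(** The angular velocity never vanishes, since its product with the speed is 1 up to sign;
    by the intermediate value theorem this sign is constant. *)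
Lemma omega_sign : exists2 sg : R, sg ^+ 2 = 1 &
  forall t, sg * omega t * speed a b (lX t) (lY t) = 1.
Proof.
have om0 := omega_neq0.
pose sg : R := if 0 < omega 0 then 1 else -1.
have sg2 : sg ^+ 2 = 1 by rewrite /sg; case: ifP => _; rewrite ?sqrrN expr1n.
have sg0 : 0 < sg * omega 0.
  rewrite /sg; case: ifPn; first by rewrite mul1r.
  by rewrite -leNgt mulN1r oppr_gt0 lt_neqAle om0.
have sgom t : 0 < sg * omega t.
  rewrite ltNge; apply/negP => sgt.
  pose h u := sg * omega u.
  have ch : continuous h.
    by move=> u; apply: cvgM; [exact: cvg_cst|exact: omega_continuous].
  have hz c0 : h c0 = 0 -> False.
    by move=> /eqP; rewrite mulf_eq0 (negbTE (om0 _)) orbF => /eqP s0; move: sg2;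
      rewrite s0 expr0n/= => /esym/eqP; rewrite oner_eq0.
  have [t0'|/ltW t0'] := leP 0 t.
    have m1 : Num.min (h 0) (h t) <= 0 <= Num.max (h 0) (h t).
      rewrite ge_min le_max; apply/andP; split; apply/orP; [right|left].
        exact: sgt.
      exact: (ltW sg0).
    have [u _ hu] := @IVT R h 0 t 0 t0' (continuous_subspaceT ch) m1.
    exact: (hz u hu).
  have m1 : Num.min (h t) (h 0) <= 0 <= Num.max (h t) (h 0).
    rewrite ge_min le_max; apply/andP; split; apply/orP; [left|right].
      exact: sgt.
    exact: (ltW sg0).
  have [u _ hu] := @IVT R h t 0 0 t0' (continuous_subspaceT ch) m1.
  exact: (hz u hu).
exists sg => // t.
have sp0 := speed_gt0 b0 ba (lXY1 t).
have /eqP : (sg * omega t * speed a b (lX t) (lY t)) ^+ 2 = 1.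
  by rewrite !exprMn sg2 mul1r sqr_speed// omega_speed.
rewrite sqrf_eq1 => /orP[/eqP//|/eqP h].
have := mulr_gt0 (sgom t) sp0; rewrite h oppr_gt0 ltNge ler01 //.
Qed.

(** The angle is an antiderivative of the angular velocity.  It differs from the true
    position on the circle by a rotation of constant angle, zero at the origin, because
    the scalar product of the two unit vectors has derivative zero. *)
Lemma lift_exists : exists (sg : R) (S Th : R -> R),
  [/\ sg ^+ 2 = 1, cancel S Th, cancel Th S,
      forall t, lX t = cos (Th t) /\ lY t = sin (Th t)
    & forall t : R, is_derive t 1 S (sg * speed a b (cos t) (sin t)) /\
        is_derive (S t) 1 Th (sg * speed a b (cos t) (sin t))^-1].
Proof.
have [t0 [Xt0 Yt0]] := unit_angle (lXY1 0).
have [F dF] := antiderivative omega_continuous.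
pose Th (t : R) : R := F t + (t0 - F 0).
have dTh (t : R) : is_derive t 1 Th (omega t).
  have := is_deriveD (dF t) (is_derive_cst (t0 - F 0) t 1).
  by rewrite addr0; apply: is_derive_ext.
have Th0 : Th 0 = t0 by rewrite /Th; ring.
pose g := lX * (cos \o Th) + lY * (sin \o Th).
have dg (t : R) : is_derive t 1 g 0.
  have dc' := is_derive1_comp (is_derive_cos (Th t)) (dTh t).
  have ds' := is_derive1_comp (is_derive_sin (Th t)) (dTh t).
  have := is_deriveD (is_deriveM (is_derive_lX t) dc') (is_deriveM (is_derive_lY t) ds').
  congr (is_derive _ _ _ _).
  transitivity (lX t * (- sin (Th t) * omega t) + cos (Th t) * dX t +
    (lY t * (cos (Th t) * omega t) + sin (Th t) * dY t)); first by [].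
  by rewrite dX_omega dY_omega; ring.
have g1 t : lX t * cos (Th t) + lY t * sin (Th t) = 1.
  transitivity (g t); first by [].
  rewrite (is_derive_0_is_cst t 0 dg); transitivity (lX 0 * cos (Th 0) + lY 0 * sin (Th 0)).
    by [].
  by rewrite Th0 Xt0 Yt0 -!expr2 cos2Dsin2.
have cs t : lX t = cos (Th t) /\ lY t = sin (Th t).
  have /eqP : (lX t - cos (Th t)) ^+ 2 + (lY t - sin (Th t)) ^+ 2 = 0.
    transitivity ((lX t ^+ 2 + lY t ^+ 2) + (cos (Th t) ^+ 2 + sin (Th t) ^+ 2) -
      2 * (lX t * cos (Th t) + lY t * sin (Th t))); first by ring.
    by rewrite g1 cos2Dsin2 lXY1; ring.
  rewrite paddr_eq0 ?sqr_ge0// !sqrf_eq0 !subr_eq0.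
  by move=> /andP[/eqP -> /eqP ->].
have [sg sg2 spd] := omega_sign.
have grow u v : u <= v -> (v - u) / a <= sg * Th v - sg * Th u.
  move=> uv; have cT : {within `[u, v], continuous Th}.
    by apply: derivable_within_continuous => w _; have [] := dTh w.
  have [w _ eqw] := @MVT_segment R Th omega u v uv (fun w _ => dTh w) cT.
  rewrite -mulrBr eqw mulrA [leRHS]mulrC ler_wpM2l ?subr_ge0//.
  have sp0 := speed_gt0 b0 ba (lXY1 w).
  have -> : sg * omega w = (speed a b (lX w) (lY w))^-1.
    by apply: (mulIf (lt0r_neq0 sp0)); rewrite spd mulVf ?gt_eqF.
  rewrite lef_pV2 ?posrE// -ler_sqr ?nnegrE; [|exact: ltW..].
  by rewrite sqr_speed//; exact: (sqspeed_le b0 ba (lXY1 w)).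
have Thc : continuous Th.
  by move=> t; apply/differentiable_continuous/derivable1_diffP; have [] := dTh t.
have inj u v : Th u = Th v -> u = v.
  wlog uv : u v / u <= v.
    by move=> H uv; have [/H|/ltW/H] := leP u v; [exact|move=> h; exact/esym/h].
  move=> e0; have := grow u v uv; rewrite e0 subrr pmulr_lle0 ?invr_gt0// subr_le0 => vu.
  by apply/eqP; rewrite eq_le uv.
have surj y : exists t, Th t = y.
  pose u := - (a * `|sg * (y - Th 0)|); pose v := a * `|sg * (y - Th 0)|.
  have v0 : 0 <= v by rewrite mulr_ge0 // ltW.
  have u0 : u <= 0 by rewrite oppr_le0.
  have gu := grow _ _ u0; have gv := grow _ _ v0.
  have avE : v / a = `|sg * (y - Th 0)| by rewrite /v mulrAC divff ?mul1r// gt_eqF.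
  move: gu gv; rewrite /u -/v sub0r opprK subr0 avE => gu gv.
  have [||t _ eqt] := @IVT R (fun t => sg * Th t) (- v) v (sg * y) (le_trans u0 v0).
  - by apply: continuous_subspaceT => t; apply: cvgM; [exact: cvg_cst|exact: Thc].
  - have /andP[h1 h2] : - `|sg * (y - Th 0)| <= sg * (y - Th 0) <= `|sg * (y - Th 0)|.
      by rewrite -ler_norml.
    move: gu gv h1 h2; move: `|sg * (y - Th 0)| => n gu gv h1 h2.
    apply/andP; split.
      by rewrite ge_min; apply/orP; left; lra.
    by rewrite le_max; apply/orP; right; lra.
  exists t; have s0 : sg != 0 by apply/eqP => h; move: sg2; rewrite h expr0n/= => /esym/eqP;
    rewrite oner_eq0.
  exact: (mulfI s0 eqt).
have [S STh] := choice surj.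
have ThS : cancel Th S by move=> t; apply: inj; rewrite STh.
have om0 := omega_neq0; exists sg, S, Th; split => // t.
have := @is_derive_inverse R Th S (omega (S t)) (S t) _ _ (dTh (S t)) (om0 _).
rewrite STh => H.
have -> : sg * speed a b (cos t) (sin t) = (omega (S t))^-1.
  have [<- <-] : lX (S t) = cos t /\ lY (S t) = sin t by rewrite -[X in cos X]STh -[X in sin X]STh; exact: cs.
  apply: (mulfI (om0 (S t))); rewrite divff// -[RHS](spd (S t)); ring.
by split; [apply: H; apply: filterE => // u; exact: Thc|rewrite invrK; exact: dTh].
Qed.

End Param.

(** * The billiard step *)

Section Step.
Context (R : realType) (F1 F2 : R * R) (a e : R) (Ups : circle R -> R * R).
Hypothesis a0 : 0 < a.
Hypothesis ecc : eccentricity F1 F2 a = e.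
Hypothesis e01 : 0 < e < 1.
Hypothesis hUps : arclength_param (ellipse F1 F2 a) Ups.

Local Notation b := (semiminor F1 F2 a).
Local Notation X := (cX F1 F2 a Ups).
Local Notation Y := (cY F1 F2 a Ups).
Local Notation Omega := (ellipse_domain F1 F2 a).
Local Notation fr1 := (frame1 F1 F2).
Local Notation fr2 := (frame2 F1 F2).
Let b0 : 0 < b := semiminor_gt0 a0 ecc e01.
Let ba : b < a := semiminor_lt a0 ecc e01.
Let XY1 s : X s ^+ 2 + Y s ^+ 2 = 1 := cXY1 a0 ecc e01 hUps s.

Let dotE w z : dot w z = fr1 w * fr1 z + fr2 w * fr2 z.
Proof. exact: frame_norm a0 ecc e01 w z. Qed.

Let crossE w z : cross w z = fr1 w * fr2 z - fr2 w * fr1 z.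
Proof. exact: frame_cross a0 ecc e01 w z. Qed.

Let fr1Z (t : R) w : fr1 (t *: w) = t * fr1 w.
Proof.
by rewrite /frame1 -[(t *: w).1]/(t * w.1) -[(t *: w).2]/(t * w.2); ring.
Qed.
Let fr2Z (t : R) w : fr2 (t *: w) = t * fr2 w.
Proof.
by rewrite /frame2 -[(t *: w).1]/(t * w.1) -[(t *: w).2]/(t * w.2); ring.
Qed.

Let enorm1 w : enorm w = 1 <-> fr1 w ^+ 2 + fr2 w ^+ 2 = 1.
Proof.
rewrite /enorm dotE -!expr2; split=> h; last by rewrite h sqrtr1.
by rewrite -[LHS]sqr_sqrtr ?h ?expr1n// addr_ge0 ?sqr_ge0.
Qed.

Let coord1D P w : coord1 F1 F2 a (P + w) = coord1 F1 F2 a P + fr1 w / a.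
Proof. by rewrite /coord1 /frame1 /=; ring. Qed.

Let coord2D P w : coord2 F1 F2 a (P + w) = coord2 F1 F2 a P + fr2 w / b.
Proof. by rewrite /coord2 /frame2 /=; ring. Qed.

Let N (s : circle R) := speed a b (X s) (Y s).
Let N0 s : 0 < N s. Proof. exact: speed_gt0. Qed.
Let N2 s : N s ^+ 2 = a ^+ 2 * Y s ^+ 2 + b ^+ 2 * X s ^+ 2.
Proof. exact: sqr_speed. Qed.

(** The interior is the sublevel set of X^2 + Y^2, so the inward side of a normal is read from a
    quadratic polynomial in t. *)
Lemma inward_normalP s n : inward_normal Omega Ups s n <->
  fr1 n = - (b * X s / N s) /\ fr2 n = - (a * Y s / N s).
Proof.
have sE : cproj (repr s) = s by rewrite /cproj reprK.
have tanE : tangent Ups s = 'D_1 (fun x : R => Ups (cproj x)) (repr s).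
  by rewrite /tangent derive1E.
pose om := omega F1 F2 a Ups (repr s).
have om0 : om != 0 by exact: (omega_neq0 a0 ecc e01 hUps).
have t1 : fr1 (tangent Ups s) = - (a * om * Y s).
  have := dX_omega a0 ecc e01 hUps (repr s); rewrite /dX /lY sE -tanE -/om => h.
  have -> : fr1 (tangent Ups s) = (fr1 (tangent Ups s) / a) * a by rewrite divfK// gt_eqF.
  by rewrite h; ring.
have t2 : fr2 (tangent Ups s) = b * om * X s.
  have := dY_omega a0 ecc e01 hUps (repr s); rewrite /dY /lX sE -tanE -/om => h.
  have -> : fr2 (tangent Ups s) = (fr2 (tangent Ups s) / b) * b by rewrite divfK// gt_eqF.
  by rewrite h; ring.
have perp : dot n (tangent Ups s) = om * (b * X s * fr2 n - a * Y s * fr1 n).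
  by rewrite dotE t1 t2; ring.
have Qt t : coord1 F1 F2 a (Ups s + t *: n) ^+ 2 + coord2 F1 F2 a (Ups s + t *: n) ^+ 2 =
  1 + 2 * t * (X s * fr1 n / a + Y s * fr2 n / b) + t ^+ 2 * ((fr1 n / a) ^+ 2 + (fr2 n / b) ^+ 2).
  rewrite coord1D coord2D fr1Z fr2Z -[coord1 _ _ _ _]/(X s) -[coord2 _ _ _ _]/(Y s).
  transitivity ((X s ^+ 2 + Y s ^+ 2) + 2 * t * (X s * fr1 n / a + Y s * fr2 n / b) +
    t ^+ 2 * ((fr1 n / a) ^+ 2 + (fr2 n / b) ^+ 2)); first by ring.
  by rewrite XY1.
have Nn0 : N s != 0 by rewrite gt_eqF.
split.
  move=> [/enorm1 n1 /eqP nt near0]; move: nt; rewrite perp mulf_eq0 (negbTE om0)/= => /eqP nt.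
  pose k := (b * X s * fr1 n + a * Y s * fr2 n) / N s.
  have f1 : fr1 n = k * (b * X s / N s).
    have -> : k * (b * X s / N s) = ((b * X s) * (b * X s * fr1 n + a * Y s * fr2 n)) / N s ^+ 2.
      by rewrite /k; field.
    apply: (@mulIf _ (N s ^+ 2)); first by rewrite expf_neq0.
    rewrite divfK ?expf_neq0// N2.
    have : a * Y s * fr1 n = b * X s * fr2 n by lra.
    move=> h; have : a * Y s * (a * Y s * fr1 n) = a * Y s * (b * X s * fr2 n) by rewrite h.
    lra.
  have f2 : fr2 n = k * (a * Y s / N s).
    have -> : k * (a * Y s / N s) = ((a * Y s) * (b * X s * fr1 n + a * Y s * fr2 n)) / N s ^+ 2.
      by rewrite /k; field.
    apply: (@mulIf _ (N s ^+ 2)); first by rewrite expf_neq0.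
    rewrite divfK ?expf_neq0// N2.
    have : a * Y s * fr1 n = b * X s * fr2 n by lra.
    move=> h; have : b * X s * (a * Y s * fr1 n) = b * X s * (b * X s * fr2 n) by rewrite h.
    lra.
  have k2 : k ^+ 2 = 1.
    rewrite -n1 f1 f2.
    have -> : (k * (b * X s / N s)) ^+ 2 + (k * (a * Y s / N s)) ^+ 2 =
      k ^+ 2 * (a ^+ 2 * Y s ^+ 2 + b ^+ 2 * X s ^+ 2) / N s ^+ 2 by field.
    by rewrite -N2 mulfK// expf_neq0.
  have k1 : k = -1.
    move/eqP: k2; rewrite sqrf_eq1 => /orP[/eqP k1|/eqP//]; exfalso.
    have [t [t0 /(ellipse_domainP a0 ecc e01)]] : exists t, 0 < t /\ Omega (Ups s + t *: n).
      have [t Ht] := filter_ex (filterI near0 (nbhs_right_gt (0 : R))).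
      by exists t; case: Ht.
    rewrite Qt f1 f2 k1 !mul1r; apply/negP; rewrite -leNgt -addrA lerDl addr_ge0//.
      rewrite mulr_ge0//; first by rewrite mulr_ge0// ltW.
      have -> : X s * (b * X s / N s) / a + Y s * (a * Y s / N s) / b =
         (a ^+ 2 * Y s ^+ 2 + b ^+ 2 * X s ^+ 2) / (a * b * N s).
        by field; rewrite Nn0 !gt_eqF.
      by rewrite -N2 divr_ge0 ?sqr_ge0// !mulr_ge0// ltW.
    by rewrite mulr_ge0 ?addr_ge0 ?sqr_ge0.
  by rewrite f1 f2 k1 !mulN1r.
move=> [f1 f2]; split.
- apply/enorm1; rewrite f1 f2.
  have -> : (- (b * X s / N s)) ^+ 2 + (- (a * Y s / N s)) ^+ 2 =
      (a ^+ 2 * Y s ^+ 2 + b ^+ 2 * X s ^+ 2) / N s ^+ 2 by field.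
  by rewrite -N2 divff// expf_neq0.
- by rewrite perp f1 f2; field.
- have e1 : X s * fr1 n / a + Y s * fr2 n / b = - (N s / (a * b)).
    rewrite f1 f2.
    have -> : X s * - (b * X s / N s) / a + Y s * - (a * Y s / N s) / b =
         - ((a ^+ 2 * Y s ^+ 2 + b ^+ 2 * X s ^+ 2) / (a * b * N s)).
      by field; rewrite Nn0 !gt_eqF.
    by rewrite -N2; field; rewrite Nn0 !gt_eqF.
  set d := (fr1 n / a) ^+ 2 + (fr2 n / b) ^+ 2.
  have d0 : 0 <= d by rewrite addr_ge0 ?sqr_ge0.
  have Nab : 0 < N s / (a * b) by rewrite divr_gt0// mulr_gt0.
  have td : 0 < N s / (a * b) / (d + 1) by rewrite divr_gt0// ltr_wpDl.
  near=> t.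
  have t0 : 0 < t by near: t; exact: nbhs_right_gt.
  have tlt : t < N s / (a * b) / (d + 1) by near: t; exact: nbhs_right_lt.
  apply/(ellipse_domainP a0 ecc e01); rewrite Qt e1 -/d.
  have : t * (d + 1) < N s / (a * b) by rewrite -ltr_pdivlMr// ltr_wpDl.
  move=> tdN; have : t * (t * (d + 1)) < t * (N s / (a * b)) by rewrite ltr_pM2l.
  have : 0 < t * (N s / (a * b)) by rewrite mulr_gt0.
  have : 0 < t * t by rewrite mulr_gt0.
  move: (N s / (a * b)) => u; lra.
Unshelve. all: by end_near. Qed.

Section One.
Variables (s : circle R) (r : R).
Hypothesis r1 : `|r| < 1.
Let r1' : `|r| <= 1 := ltW r1.
Let p1 := dir1 a b (X s) (Y s) r.
Let p2 := dir2 a b (X s) (Y s) r.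
Let m := cosr r.
Let m0 : 0 < m. Proof. exact: cosr_gt0. Qed.
Let m2 : m ^+ 2 = 1 - r ^+ 2. Proof. exact: sqr_cosr. Qed.

Let crossp : p2 * X s - p1 * Y s = m * N s ^+ 2.
Proof. by rewrite N2 /p1 /p2 /dir1 /dir2 -/m; ring. Qed.

Let pr : b ^+ 2 * p1 * X s + a ^+ 2 * p2 * Y s = a * b * r * N s ^+ 2.
Proof. by rewrite N2 /p1 /p2 /dir1 /dir2 -/m; ring. Qed.

Let pnorm : a ^+ 2 * p2 ^+ 2 + b ^+ 2 * p1 ^+ 2 = (a * b * N s) ^+ 2.
Proof.
rewrite exprMn N2 /p1 /p2 /dir1 /dir2 -/m.
have -> : (a ^+ 2 * Y s ^+ 2 + b ^+ 2 * X s ^+ 2) =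
  (r ^+ 2 + m ^+ 2) * (a ^+ 2 * Y s ^+ 2 + b ^+ 2 * X s ^+ 2) by rewrite m2; ring.
ring.
Qed.

(** The only unit vector that makes the angle prescribed by r with the inward normal. *)
Let vdir := unframe F1 F2 (- (a * p2 / (a * b * N s))) (b * p1 / (a * b * N s)).
Let vd1 : fr1 vdir = - (a * p2 / (a * b * N s)). Proof. exact: unframe1 a0 ecc e01 _ _. Qed.
Let vd2 : fr2 vdir = b * p1 / (a * b * N s). Proof. exact: unframe2 a0 ecc e01 _ _. Qed.
Let abN : a * b * N s != 0. Proof. by rewrite !mulf_neq0// gt_eqF. Qed.

Let vdir_norm : enorm vdir = 1.
Proof.
apply/enorm1; rewrite vd1 vd2.
have -> : (- (a * p2 / (a * b * N s))) ^+ 2 + (b * p1 / (a * b * N s)) ^+ 2 =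
  (a ^+ 2 * p2 ^+ 2 + b ^+ 2 * p1 ^+ 2) / (a * b * N s) ^+ 2.
  by field; rewrite ?abN !gt_eqF.
by rewrite pnorm divff// expf_neq0.
Qed.

Let vdir_dot n : inward_normal Omega Ups s n -> dot vdir n = m.
Proof.
move=> /inward_normalP[n1 n2]; rewrite dotE vd1 vd2 n1 n2.
transitivity ((p2 * X s - p1 * Y s) / N s ^+ 2).
  by field; rewrite !gt_eqF.
by rewrite crossp mulfK// expf_neq0// gt_eqF.
Qed.

Let vdir_cross n : inward_normal Omega Ups s n -> cross vdir n = r.
Proof.
move=> /inward_normalP[n1 n2]; rewrite crossE vd1 vd2 n1 n2.
transitivity ((b ^+ 2 * p1 * X s + a ^+ 2 * p2 * Y s) / (a * b * N s ^+ 2)).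
  by field; rewrite !gt_eqF.
by rewrite pr; field; rewrite !gt_eqF.
Qed.

Let vdir_unique v n : inward_normal Omega Ups s n -> enorm v = 1 -> 0 <= dot v n ->
  cross v n = r -> v = vdir.
Proof.
move=> nn /enorm1 v1 dv cv; have dvd := vdir_dot nn; have cvd := vdir_cross nn.
have [n1 _ _] := nn; move/enorm1 : n1 => n1.
have dm : dot v n = m.
  apply/eqP; rewrite -(@eqrXn2 _ 2)// ?(ltW m0)//; apply/eqP.
  rewrite m2 -cv; rewrite dotE crossE.
  have -> : 1 - (fr1 v * fr2 n - fr2 v * fr1 n) ^+ 2 =
    (fr1 v ^+ 2 + fr2 v ^+ 2) * (fr1 n ^+ 2 + fr2 n ^+ 2) - (fr1 v * fr2 n - fr2 v * fr1 n) ^+ 2.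
    by rewrite v1 n1 mulr1.
  ring.
have S1 w : fr1 w = dot w n * fr1 n + cross w n * fr2 n.
  rewrite dotE crossE -[LHS]mulr1 -n1; ring.
have S2 w : fr2 w = dot w n * fr2 n - cross w n * fr1 n.
  rewrite dotE crossE -[LHS]mulr1 -n1; ring.
apply: (frame_inj a0 ecc e01).
  by rewrite S1 [RHS]S1 dm dvd cv cvd.
by rewrite S2 [RHS]S2 dm dvd cv cvd.
Qed.

Lemma billiard_step_exists : exists y : circle R * R,
  [/\ billiard_step Omega Ups (s, r) y, X y.1 = nextX a b (X s) (Y s) r,
      Y y.1 = nextY a b (X s) (Y s) r & y.2 = nextr a b (X s) (Y s) r].
Proof.
have [s' [Xs' Ys']] := cXY_surj a0 ecc e01 hUps (next_unit b0 ba (XY1 s) r1').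
exists (s', nextr a b (X s) (Y s) r); split => //=.
have nmE q : inward_normal Omega Ups q
    (unframe F1 F2 (- (b * X q / N q)) (- (a * Y q / N q))).
  by apply/inward_normalP; rewrite (unframe1 a0 ecc e01) (unframe2 a0 ecc e01).
exists vdir, (unframe F1 F2 (- (b * X s / N s)) (- (a * Y s / N s))),
   (unframe F1 F2 (- (b * X s' / N s')) (- (a * Y s' / N s'))); split => //=.
- by split => //; rewrite ?vdir_dot ?vdir_cross// ltW.
- have pp := dir_gt0 b0 ba (XY1 s) r1'; rewrite -/p1 -/p2 in pp.
  pose mu := 2 * (p2 * X s - p1 * Y s) / (p1 ^+ 2 + p2 ^+ 2) * (a * b * N s).
  exists mu.
    rewrite /mu crossp; apply: mulr_gt0; last by rewrite !mulr_gt0.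
    by rewrite divr_gt0// mulr_gt0// mulr_gt0// exprn_gt0.
  set S := p1 ^+ 2 + p2 ^+ 2 in pp mu *.
  have SE : S * 1 = (p1 ^+ 2 + p2 ^+ 2) * (X s ^+ 2 + Y s ^+ 2) by rewrite XY1.
  apply: (coord_inj a0 ecc e01).
    rewrite coord1D fr1Z vd1 -[coord1 _ _ _ _]/(X s') -[coord1 _ _ _ _]/(X s) Xs'.
    rewrite /nextX /refl -/p1 -/p2 -/S /mu.
    apply: (@mulIf _ S); first by rewrite gt_eqF.
    transitivity (2 * (p1 * X s + p2 * Y s) * p1 - X s * S); first by field; rewrite gt_eqF.
    transitivity (X s * S - 2 * (p2 * X s - p1 * Y s) * p2); last by field; rewrite !gt_eqF.
    rewrite /S; ring.
  rewrite coord2D fr2Z vd2 -[coord2 _ _ _ _]/(Y s') -[coord2 _ _ _ _]/(Y s) Ys'.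
  rewrite /nextY /refl -/p1 -/p2 -/S /mu.
  apply: (@mulIf _ S); first by rewrite gt_eqF.
  transitivity (2 * (p1 * X s + p2 * Y s) * p2 - Y s * S); first by field; rewrite gt_eqF.
  transitivity (Y s * S + 2 * (p2 * X s - p1 * Y s) * p1); last by field; rewrite !gt_eqF.
  rewrite /S; ring.
- have /inward_normalP[n1 n2] := nmE s'; set n := unframe _ _ _ _ in n1 n2 *.
  rewrite /cross /reflect_dir; set d := 2 * _.
  transitivity (cross vdir n); last first.
    rewrite /cross -[(vdir - d *: n).1]/(vdir.1 - d * n.1).
    by rewrite -[(vdir - d *: n).2]/(vdir.2 - d * n.2); ring.
  rewrite crossE vd1 vd2 n1 n2 /nextr -/p1 -/p2 -Xs' -Ys' -/(N s) -/(N s').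
  by field; rewrite !gt_eqF.
Qed.

(** The parameter of the second intersection of a line with the ellipse is the nonzero root of
    a quadratic equation. *)
Lemma billiard_step_unique y z :
  billiard_step Omega Ups (s, r) y -> billiard_step Omega Ups (s, r) z -> y = z.
Proof.
move=> [v [n [n' [/= hn hn' [v1 dv cv] [t t0 yt] y2]]]].
move=> [w [k [k' [/= hk hk' [w1 dw cw] [u u0 zu] z2]]]].
have vE := vdir_unique hn v1 dv cv; have wE := vdir_unique hk w1 dw cw.
rewrite vE in yt y2; rewrite wE in zu z2.
pose B := X s * fr1 vdir / a + Y s * fr2 vdir / b.
pose q := (fr1 vdir / a) ^+ 2 + (fr2 vdir / b) ^+ 2.
have q0 : 0 < q.
  have := vdir_norm => /enorm1 h; rewrite lt_neqAle addr_ge0 ?sqr_ge0// andbT eq_sym.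
  rewrite /q paddr_eq0 ?sqr_ge0// !sqrf_eq0; apply/negP => /andP[/eqP h1 /eqP h2].
  have g1 : fr1 vdir = fr1 vdir / a * a by rewrite divfK// gt_eqF.
  have g2 : fr2 vdir = fr2 vdir / b * b by rewrite divfK// gt_eqF.
  move: h; rewrite g1 g2 h1 h2 !mul0r expr0n addr0 => /esym/eqP.
  by rewrite oner_eq0.
have key x s' : 0 < x -> Ups s' = Ups s + x *: vdir -> x = - (2 * B) / q.
  move=> x0 eqs; have := XY1 s'; rewrite /cX /cY eqs coord1D coord2D fr1Z fr2Z.
  rewrite -[coord1 _ _ _ _]/(X s) -[coord2 _ _ _ _]/(Y s).
  have -> : (X s + x * fr1 vdir / a) ^+ 2 + (Y s + x * fr2 vdir / b) ^+ 2 =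
    (X s ^+ 2 + Y s ^+ 2) + x * (2 * B + x * q) by rewrite /B /q; ring.
  rewrite XY1 => /eqP; rewrite -subr_eq0 addrC addKr mulf_eq0 (gt_eqF x0)/= => /eqP h.
  apply: (mulIf (lt0r_neq0 q0)); rewrite divfK ?gt_eqF//; lra.
have tu : t = u by rewrite (key t y.1)// (key u z.1).
have yz1 : y.1 = z.1.
  by case: hUps => + _ _ _ _; apply; rewrite yt zu tu.
have nk : n' = k'.
  move: hn' hk'; rewrite yz1 => /inward_normalP[a1 a2] /inward_normalP[b1 b2].
  by apply: (frame_inj a0 ecc e01); rewrite ?a1 ?a2 ?b1 ?b2.
by rewrite [y]surjective_pairing [z]surjective_pairing yz1 y2 z2 nk.
Qed.

End One.

Lemma billiard_mapE s r : `|r| <= 1 ->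
  [/\ X (billiard_map Omega Ups (s, r)).1 = nextX a b (X s) (Y s) r,
      Y (billiard_map Omega Ups (s, r)).1 = nextY a b (X s) (Y s) r
    & (billiard_map Omega Ups (s, r)).2 = nextr a b (X s) (Y s) r].
Proof.
rewrite /billiard_map /= le_eqVlt => /orP[/eqP r1|r1].
  rewrite r1 ltxx /=; have r1' : `|r| <= 1 by rewrite r1.
  by have [-> -> ->] := next_boundary b0 ba (XY1 s) r1' r1.
rewrite r1; have [y [hy Xy Yy ry]] := billiard_step_exists s r1.
by rewrite (@xget_unique _ _ _ y)// => z hz; exact: (billiard_step_unique r1 hz hy).
Qed.

End Step.

(** * Dissipation functions and the topology of the cylinder *)

Section ClassC.
Context (R : realType).

Lemma is_derive_partial1 (g : R * R -> R) (x y : R) : derivable g (x, y) (1, 0) ->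
  is_derive x 1 (fun x => g (x, y)) ('D_(1, 0) g (x, y)).
Proof.
have E : (fun h : R => h^-1 *: (((fun x => g (x, y)) \o shift x) (h *: 1) - g (x, y))) =
  (fun h : R => h^-1 *: ((g \o shift (x, y)) (h *: (1, 0)) - g (x, y))).
  apply/funext => h; congr (_ *: (g _ - _)).
  by rewrite [RHS]surjective_pairing /=; congr (_, _); rewrite scaler0 add0r.
by move=> D; apply: DeriveDef; rewrite /derivable /derive E.
Qed.

Lemma is_derive_partial2 (g : R * R -> R) (x y : R) : derivable g (x, y) (0, 1) ->
  is_derive y 1 (fun y => g (x, y)) ('D_(0, 1) g (x, y)).
Proof.
have E : (fun h : R => h^-1 *: (((fun y => g (x, y)) \o shift y) (h *: 1) - g (x, y))) =
  (fun h : R => h^-1 *: ((g \o shift (x, y)) (h *: (0, 1)) - g (x, y))).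
  apply/funext => h; congr (_ *: (g _ - _)).
  by rewrite [RHS]surjective_pairing /=; congr (_, _); rewrite scaler0 add0r.
by move=> D; apply: DeriveDef; rewrite /derivable /derive E.
Qed.

Lemma mean_value_bound (f df : R -> R) (M u v : R) :
  (forall w, Num.min u v <= w <= Num.max u v -> is_derive w 1 f (df w) /\ `|df w| <= M) ->
  `|f u - f v| <= M * `|u - v|.
Proof.
wlog uv : u v / v <= u.
  move=> H H1; have [/H|/ltW/H] := leP v u; first exact.
  by rewrite minC maxC distrC [`|v - u|]distrC; apply.
rewrite (min_idPr uv) (max_idPl uv) => H.
have D w : w \in `]v, u[ -> is_derive w 1 f (df w).
  by rewrite in_itv/= => /andP[/ltW vw /ltW wu]; have [|//] := H w; rewrite vw.
have C : {within `[v, u], continuous f}.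
  by apply: derivable_within_continuous => w; rewrite in_itv/= => /H[[]].
have [w + eqw] := MVT_segment uv D C.
rewrite in_itv/= => /H[_ wM]; rewrite eqw normrM ler_wpM2r//.
Qed.

(** Go from one point to the other along the two coordinate directions. *)
Lemma C1_lip (g : R * R -> R) p :
  (forall x, derivable g x (1, 0)) -> (forall x, derivable g x (0, 1)) ->
  continuous (fun x => 'D_(1, 0) g x) -> continuous (fun x => 'D_(0, 1) g x) ->
  lipnear g p.
Proof.
move=> d1 d2 c1 c2.
have bnd (h : R * R -> R) : continuous h -> \forall x \near p, `|h x| <= `|h p| + 1.
  move=> ch; have /cvgrPdist_le/(_ 1 ltr01) := ch p; apply: filterS => x.
  by move=> /(le_trans (ler_dist_dist _ _)); rewrite ler_distlC => /andP[_]; rewrite addrC.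
pose M := `|'D_(1, 0) g p| + `|'D_(0, 1) g p| + 1.
have M0 : 0 < M by rewrite ltr_wpDl// addr_ge0.
have nbB : nbhs p [set x | `|'D_(1, 0) g x| <= `|'D_(1, 0) g p| + 1 /\
    `|'D_(0, 1) g x| <= `|'D_(0, 1) g p| + 1].
  exact: filterI (bnd _ c1) (bnd _ c2).
move/nbhs_ballP : nbB => [d /= d0 B].
exists (M + M); first exact: addr_gt0.
have nb := nbhsx_ballx p d d0.
apply: filterS (filterI (near_fst p nb) (near_snd p nb)).
move=> [[x y] [x' y']] /= [[/= bx byy] [/= bx' by']].
have seg (t u v w : R) : ball t d u -> ball t d v -> Num.min u v <= w <= Num.max u v ->
    ball t d w.
  rewrite /ball/= !ltr_distlC ge_min le_max.
  by move=> /andP[? ?] /andP[? ?] /andP[/orP[] ? /orP[] ?]; apply/andP; split; lra.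
have -> : g (x, y) - g (x', y') = (g (x, y) - g (x', y)) + (g (x', y) - g (x', y')) by ring.
apply: (le_trans (ler_normD _ _)); rewrite mulrDl; apply: lerD.
  apply: (@le_trans _ _ (M * `|x - x'|)); last first.
    by rewrite ler_pM2l//; exact: (normfst ((x, y) - (x', y'))).
  apply: (@mean_value_bound (fun x => g (x, y)) (fun x => 'D_(1, 0) g (x, y))) => w wI.
  split; first exact: is_derive_partial1.
  have [h _] := B (w, y) (conj (seg _ _ _ _ bx bx' wI) byy).
  by apply: (le_trans h); rewrite /M addrAC lerDl.
apply: (@le_trans _ _ (M * `|y - y'|)); last first.
  by rewrite ler_pM2l//; exact: (normsnd ((x, y) - (x', y'))).
apply: (@mean_value_bound (fun y => g (x', y)) (fun y => 'D_(0, 1) g (x', y))) => w wI.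
split; first exact: is_derive_partial2.
have [_ h] := B (x', w) (conj bx' (seg _ _ _ _ byy by' wI)).
by apply: (le_trans h); rewrite /M -addrA lerDr.
Qed.

Lemma class_C_continuous m (g : R * R -> R) : class_C m g -> continuous g.
Proof.
elim: m g => [//|m IH] g [d1 d2 /IH c1 /IH c2] p.
by apply: lip_cvg; exact: (C1_lip p d1 d2 c1 c2).
Qed.

Lemma class_C_lip m (g : R * R -> R) p : class_C m.+1 g -> lipnear g p.
Proof.
by move=> [d1 d2 /class_C_continuous c1 /class_C_continuous c2]; exact: (C1_lip p d1 d2 c1 c2).
Qed.

End ClassC.

Section Circle.
Context (R : realType).

Lemma cproj_continuous : continuous (@cproj R).
Proof. exact: pi_continuous. Qed.

Lemma cproj_surj (s : circle R) : exists x, cproj x = s.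
Proof. by exists (repr s); rewrite /cproj reprK. Qed.

(** The saturation of an open set is the union of its integer translates. *)
Lemma cproj_open (O : set R) : open O -> open ((@cproj R) @` O).
Proof.
move=> oO; suff : open ((@cproj R) @^-1` ((@cproj R) @` O)) by [].
have -> : (@cproj R) @^-1` ((@cproj R) @` O) =
    \bigcup_(k in [set k : int | True]) ((fun y => y + k%:~R) @^-1` O).
  apply/seteqP; split=> y /=.
    move=> [z Oz /cproj_eqP /intrP[k zy]]; exists k => //=.
    by rewrite -zy addrC subrK.
  move=> [k _ /= Oyk]; exists (y + k%:~R) => //.
  by apply/cproj_eqP; rewrite addrAC subrr add0r intr_int.
have ct (k : int) : continuous (fun y : R => y + k%:~R).
  by move=> y; apply: cvgD; [exact: cvg_id|exact: cvg_cst].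
by apply: bigcup_open => k _; move/continuousP: (ct k); apply.
Qed.

Lemma nbhs_cproj (x : R) (B : set R) : nbhs x B -> nbhs (cproj x) ((@cproj R) @` B).
Proof.
rewrite nbhsE => -[W [oW Wx] OB]; rewrite nbhsE; exists ((@cproj R) @` W).
  by split; [exact: cproj_open|exists x].
by move=> _ [y Oy <-]; exists y => //; exact: OB.
Qed.

Lemma circle_compact : compact [set: circle R].
Proof.
have -> : [set: circle R] = (@cproj R) @` `[0, 1].
  apply/seteqP; split=> // s _; have [x <-] := cproj_surj s.
  exists (x - (Num.floor x)%:~R).
    have := floor_itv x; rewrite /= in_itv /= intrD => /andP[h1 h2]; apply/andP; split; lra.
  by apply/cproj_eqP; rewrite addrAC subrr add0r rpredN intr_int.
apply: continuous_compact; last exact: segment_compact.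
by apply: continuous_subspaceT; exact: cproj_continuous.
Qed.

Lemma circle_connected : connected [set: circle R].
Proof.
have -> : [set: circle R] = (@cproj R) @` [set: R].
  by apply/seteqP; split=> // s _; have [x <-] := cproj_surj s; exists x.
apply: connected_continuous_connected.
  by apply/connected_intervalP => x y _ _ z _.
by apply: continuous_subspaceT; exact: cproj_continuous.
Qed.

Lemma annulusE : annulus (R := R) = [set: circle R] `*` `[-1, 1]%classic.
Proof.
by apply/seteqP; split=> -[s r] /=; rewrite /annulus /= in_itv /= ler_norml; [|case].
Qed.

Lemma annulus_compact : compact (annulus (R := R)).
Proof.
rewrite annulusE; apply: compact_setX; first exact: circle_compact.
exact: segment_compact.
Qed.

Lemma cylinder_hausdorff (X Y : circle R -> R) : continuous X -> continuous Y ->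
  (forall s t, X s = X t -> Y s = Y t -> s = t) -> hausdorff_space (circle R * R)%type.
Proof.
move=> cX cY XYi p q clpq.
have H (g : circle R * R -> R) : continuous g -> g p = g q.
  move=> cg; apply: (@cluster_image _ _ setT (nbhs q) g p (g q)) => //.
  - exact: continuous_subspaceT.
  - exact: filterT.
  - by move=> B C nB nC; have [x [Cx Bx]] := clpq _ _ nC nB; exists x.
  - exact: cg.
have c1 : continuous (@fst (circle R) R) by move=> x; exact: cvg_fst.
have c2 : continuous (@snd (circle R) R) by move=> x; exact: cvg_snd.
have h1 := H (X \o fst) (fun x => continuous_comp (c1 x) (cX _)).
have h2 := H (Y \o fst) (fun x => continuous_comp (c1 x) (cY _)).
rewrite [p]surjective_pairing [q]surjective_pairing (H snd c2).
by rewrite (XYi _ _ h1 h2).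
Qed.

End Circle.

Section Dissipation.
Context (R : realType) (k : nat) (lam : circle R * R -> R).
Hypothesis hk : (2 <= k)%N.
Hypothesis hlam : dissipation k.-1 lam.

(** The class is at least C^1, hence the lift to the plane is locally Lipschitz. *)
Lemma dissipation_lift : exists2 g : R * R -> R, (forall p, lipnear g p) &
  forall s r : R, `|r| <= 1 -> lam (cproj s, r) = g (s, r).
Proof.
case: hlam => -[g cg gE] _ _; exists g => // p.
by apply: (@class_C_lip _ k.-2); case: k hk cg => [|[|]].
Qed.

Lemma dissipation_continuous : {within annulus (R := R), continuous lam}.
Proof.
have [g Lg gE] := dissipation_lift.
apply/subspace_continuousP => -[s r] Ar; have [x xs] := cproj_surj s; subst s.
have lE : lam (cproj x, r) = g (x, r) by exact: gE.
move=> C nC; have {}nC : nbhs (g (x, r)) C by rewrite -lE.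
have [[P1 P2] /= [n1 n2] H] := lip_cvg (Lg (x, r)) nC.
exists ((@cproj R) @` P1, P2) => /=; first by split=> //; exact: nbhs_cproj.
move=> [_ q] /= [[y P1y <-] P2q] Aq.
have E : lam (cproj y, q) = g (y, q) by exact: gE.
have Cg : C (g (y, q)) by exact: (H (y, q)).
by suff : C (lam (cproj y, q)) by []; rewrite E.
Qed.

Lemma dissipation_bound x : annulus x -> 0 < lam x < 1.
Proof. by move=> Ax; case: hlam => _ h _; exact: h. Qed.

(** The assumption on the radial derivative says that r lam(s, r) increases in r. *)
Lemma dissipation_increasing (s : circle R) (r r' : R) : -1 <= r -> r < r' -> r' <= 1 ->
  lam (s, r) * r < lam (s, r') * r'.
Proof.
move=> r1 rr' r'1; have [x xs] := cproj_surj s; subst s.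
have [g gd2 gE] : exists2 g : R * R -> R, (forall p, derivable g p (0, 1)) &
  forall s r : R, `|r| <= 1 -> lam (cproj s, r) = g (s, r).
  case: hlam => -[g cg gE] _ _; exists g => //.
  by case: k hk cg => [|[|n]]// _ [_ d2 _ _].
pose h (u : R) : R := g (x, u) * u.
have dh (u : R) : is_derive u 1 h (g (x, u) * 1 + u * 'D_(0, 1) g (x, u)).
  exact: (is_deriveM (is_derive_partial2 (gd2 (x, u))) (is_derive_id u 1)).
have C : {within `[r, r'], continuous h}.
  by apply: derivable_within_continuous => u _; have [] := dh u.
have [u + eqh] := MVT rr' (fun u _ => dh u) C.
rewrite in_itv/= => /andP[ru ur'].
have u1 : `|u| < 1 by rewrite ltr_norml; apply/andP; split; lra.
have hE v : `|v| <= 1 -> lam (cproj x, v) * v = h v by move=> v1; rewrite gE.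
rewrite !hE ?ler_norml; [|apply/andP; split; lra..].
rewrite -subr_gt0 eqh mulr_gt0 ?subr_gt0//.
case: hlam => _ _ /(_ (cproj x) u u1) /andP[+ _].
have -> : lam (cproj x, u) = g (x, u) by rewrite gE// ltW.
suff -> : ((fun u : R => lam (cproj x, u))^`())%classic u = 'D_(0, 1) g (x, u).
  by rewrite mulr1 addrC mulrC.
rewrite derive1E; apply: derive_val.
apply: (@is_derive_near R (fun v => g (x, v))); last exact: is_derive_partial2.
have : \forall v \near u, `|v| < 1.
  by apply: (@cvgr_lt _ _ (nbhs u) _ _ `|u|) => //; exact: norm_continuous.
by apply: filterS => v /ltW v1; rewrite gE.
Qed.

End Dissipation.

(** * The dissipative map and its Lyapunov function *)

Section CvgNext.
Context (R : realType) (a b : R) (b0 : 0 < b) (ba : b < a).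
Context (T : Type) (F : set_system T) (FF : Filter F) (u v w : T -> R) (x y r : R).
Hypothesis (cu : u t @[t --> F] --> x) (cv : v t @[t --> F] --> y) (cw : w t @[t --> F] --> r).
Hypothesis (xy1 : x ^+ 2 + y ^+ 2 = 1) (r1 : `|r| <= 1).

Let a0 : 0 < a. Proof. exact: lt_trans ba. Qed.

Let cvgX2 (h : T -> R) (l : R) : h t @[t --> F] --> l -> h t ^+ 2 @[t --> F] --> l ^+ 2.
Proof. by move=> hl; rewrite expr2; under eq_fun do rewrite expr2; exact: cvgM. Qed.

Let cvgZ (c : R) (h : T -> R) (l : R) : h t @[t --> F] --> l -> c * h t @[t --> F] --> c * l.
Proof. by move=> hl; apply: cvgM => //; exact: cvg_cst. Qed.

Lemma cvg_sqspeed (h k : T -> R) (l n : R) : h t @[t --> F] --> l -> k t @[t --> F] --> n ->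
  sqspeed a b (h t) (k t) @[t --> F] --> sqspeed a b l n.
Proof. by move=> hl kn; apply: cvgD; apply: cvgZ; exact: cvgX2. Qed.

Lemma cvg_speed (h k : T -> R) (l n : R) : h t @[t --> F] --> l -> k t @[t --> F] --> n ->
  speed a b (h t) (k t) @[t --> F] --> speed a b l n.
Proof.
by move=> hl kn; apply: (cvg_comp _ _ (cvg_sqspeed hl kn)); exact: sqrt_continuous.
Qed.

Lemma cvg_cosr : cosr (w t) @[t --> F] --> cosr r.
Proof.
apply: (@cvg_comp _ _ _ (fun t => 1 - w t ^+ 2) Num.sqrt F (nbhs (1 - r ^+ 2))).
  by apply: cvgB; [exact: cvg_cst|exact: cvgX2].
exact: sqrt_continuous.
Qed.

Lemma cvg_dir1 : dir1 a b (u t) (v t) (w t) @[t --> F] --> dir1 a b x y r.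
Proof.
apply: cvgB; apply: cvgM => //; first exact: cvgZ.
by apply: cvgZ; exact: cvg_cosr.
Qed.

Lemma cvg_dir2 : dir2 a b (u t) (v t) (w t) @[t --> F] --> dir2 a b x y r.
Proof.
apply: cvgD; apply: cvgM => //; first exact: cvgZ.
by apply: cvgZ; exact: cvg_cosr.
Qed.

Lemma cvg_refl : refl a b (u t) (v t) (w t) @[t --> F] --> refl a b x y r.
Proof.
have c1 := cvg_dir1; have c2 := cvg_dir2.
apply: cvgM; first by apply: cvgZ; apply: cvgD; apply: cvgM.
apply: cvgV; first by rewrite gt_eqF// dir_gt0.
by apply: cvgD; exact: cvgX2.
Qed.

Lemma cvg_nextX : nextX a b (u t) (v t) (w t) @[t --> F] --> nextX a b x y r.
Proof. by apply: cvgB => //; apply: cvgM; [exact: cvg_refl|exact: cvg_dir1]. Qed.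

Lemma cvg_nextY : nextY a b (u t) (v t) (w t) @[t --> F] --> nextY a b x y r.
Proof. by apply: cvgB => //; apply: cvgM; [exact: cvg_refl|exact: cvg_dir2]. Qed.

Lemma cvg_nextr : nextr a b (u t) (v t) (w t) @[t --> F] --> nextr a b x y r.
Proof.
have cX := cvg_nextX; have cY := cvg_nextY.
have c1 := cvg_dir1; have c2 := cvg_dir2.
apply: cvgM.
  by apply: cvgD; apply: cvgM => //; exact: cvgZ.
apply: cvgV.
  by rewrite !mulf_neq0// gt_eqF// speed_gt0//; exact: next_unit.
by apply: cvgM; [apply: cvgZ; exact: cvg_speed|exact: cvg_speed].
Qed.

End CvgNext.

(** What the dynamics needs to know of the billiard: affine coordinates X, Y of boundary points,
    the parametrization pt of the boundary by the angle of (X, Y), and the formulas for f. *)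
Record ellipse_model (R : realType) (a b : R) (X Y : circle R -> R) (pt : R -> circle R)
    (lam : circle R * R -> R) (f : circle R * R -> circle R * R) : Prop := EllipseModel {
  model_b0 : 0 < b;
  model_ba : b < a;
  model_X : continuous X;
  model_Y : continuous Y;
  model_unit : forall s, X s ^+ 2 + Y s ^+ 2 = 1;
  model_inj : forall s t, X s = X t -> Y s = Y t -> s = t;
  model_pt : continuous pt;
  model_ptX : forall t, X (pt t) = cos t;
  model_ptY : forall t, Y (pt t) = sin t;
  model_lam : {within annulus (R := R), continuous lam};
  model_lam01 : forall x, annulus x -> 0 < lam x < 1;
  model_lam_incr : forall (s : circle R) (r r' : R), -1 <= r -> r < r' -> r' <= 1 ->
    lam (s, r) * r < lam (s, r') * r';
  model_lam_lip : forall t : R, lipnear (fun p : R * R => lam (pt p.1, p.2)) (t, 0);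
  model_fX : forall x, annulus x -> X (f x).1 = nextX a b (X x.1) (Y x.1) x.2;
  model_fY : forall x, annulus x -> Y (f x).1 = nextY a b (X x.1) (Y x.1) x.2;
  model_fr : forall x, annulus x -> (f x).2 =
    lam ((f x).1, nextr a b (X x.1) (Y x.1) x.2) * nextr a b (X x.1) (Y x.1) x.2 }.

Section Model.
Context (R : realType) (a b : R) (X Y : circle R -> R) (pt : R -> circle R)
    (lam : circle R * R -> R) (f : circle R * R -> circle R * R).
Hypothesis M : ellipse_model a b X Y pt lam f.

Let b0 := model_b0 M.
Let ba := model_ba M.
Let a0 : 0 < a. Proof. exact: lt_trans ba. Qed.
Let XY1 := model_unit M.
Local Notation A := (annulus (R := R)).
Implicit Types (x y z : circle R * R) (s : circle R) (r : R).

Definition bounce_sine x : R := nextr a b (X x.1) (Y x.1) x.2.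
Local Notation br := bounce_sine.
Definition chord_energy x : R := energy a b (X x.1) (Y x.1) x.2.
Local Notation en := chord_energy.

Let hT : hausdorff_space (circle R * R)%type :=
  cylinder_hausdorff (model_X M) (model_Y M) (model_inj M).

Lemma br_le1 x : A x -> `|br x| <= 1.
Proof. by move=> Ax; exact: nextr_le1. Qed.

Lemma brA x : A x -> A ((f x).1, br x).
Proof. exact: br_le1. Qed.

Lemma f_int x : A x -> `|(f x).2| < 1.
Proof.
move=> Ax; rewrite (model_fr M)// normrM -/(br x).
have /andP[l0 l1] := model_lam01 M (brA Ax).
rewrite ger0_norm; last exact: ltW.
apply: (@le_lt_trans _ _ (lam ((f x).1, br x) * 1)); last by rewrite mulr1.
by rewrite ler_wpM2l ?br_le1// ltW.
Qed.

Lemma fA x : A x -> A (f x).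
Proof. by move=> /f_int /ltW. Qed.

Lemma f_continuous : {within A, continuous f}.
Proof.
apply/subspace_continuousP => x Ax.
set F := within A (nbhs x).
have FF : ProperFilter F.
  by apply: within_nbhs_proper; exact: subset_closure.
have FA : F A by exact: withinT.
have c1 : y.1 @[y --> F] --> x.1 by apply: cvg_within_filter; exact: cvg_fst.
have c2 : y.2 @[y --> F] --> x.2 by apply: cvg_within_filter; exact: cvg_snd.
have cX : X y.1 @[y --> F] --> X x.1 by apply: (cvg_comp _ _ c1); exact: model_X M _.
have cY : Y y.1 @[y --> F] --> Y x.1 by apply: (cvg_comp _ _ c1); exact: model_Y M _.
have onA (g h : circle R * R -> R) (l : R) : (forall y, A y -> g y = h y) ->
    h y @[y --> F] --> l -> g y @[y --> F] --> l.
  move=> gh; apply: cvg_trans; apply: near_eq_cvg.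
  by apply: filterS FA => y Ay; rewrite gh.
have cfX : X (f y).1 @[y --> F] --> X (f x).1.
  rewrite (model_fX M Ax); apply: (onA _ _ _ (model_fX M)).
  exact: cvg_nextX.
have cfY : Y (f y).1 @[y --> F] --> Y (f x).1.
  rewrite (model_fY M Ax); apply: (onA _ _ _ (model_fY M)).
  exact: cvg_nextY.
have cbr : br y @[y --> F] --> br x by exact: cvg_nextr.
have cf1 : (f y).1 @[y --> F] --> (f x).1.
  have cXY : continuous (fun s : circle R => (X s, Y s) : R * R).
    by move=> s; apply: (@cvg_pair_nbhs _ _ _ (nbhs s)); [exact: model_X M _|exact: model_Y M _].
  apply: (@compact_inj_cvg _ _ setT _ (fun s => (X s, Y s))).
  - exact: norm_hausdorff.
  - exact: continuous_subspaceT.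
  - exact: circle_compact.
  - by move=> s t _ _ [h1 h2]; exact: (model_inj M).
  - exact: filterT.
  - by [].
  - exact: cvg_pair_nbhs.
have cl : lam ((f y).1, br y) @[y --> F] --> lam ((f x).1, br x).
  have cp : ((f y).1, br y) @[y --> F] --> ((f x).1, br x) by exact: cvg_pair_nbhs.
  move=> C nC.
  have := proj1 (subspace_continuousP _ _) (model_lam M) _ (brA Ax) _ nC.
  move=> /cp H; have : F [set y | A y /\ (A ((f y).1, br y) -> C (lam ((f y).1, br y)))].
    by apply: filterI.
  by apply: filterS => y [Ay]; apply; exact: brA.
have cf2 : (f y).2 @[y --> F] --> (f x).2.
  rewrite (model_fr M Ax); apply: (onA _ _ _ (model_fr M)).
  exact: cvgM.
have -> : f = fun y => ((f y).1, (f y).2) by apply/funext => y; exact: surjective_pairing.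
exact: cvg_pair_nbhs.
Qed.

Lemma rev x : A x -> [/\ nextX a b (X (f x).1) (Y (f x).1) (- br x) = X x.1,
   nextY a b (X (f x).1) (Y (f x).1) (- br x) = Y x.1 &
   nextr a b (X (f x).1) (Y (f x).1) (- br x) = - x.2].
Proof.
move=> Ax; rewrite !(model_fX M)// !(model_fY M)//.
by split; [exact: revX|exact: revY|exact: revr].
Qed.

(** The position and the direction after a bounce determine the incoming chord, by time
    reversal, and r lam(s, r) determines r. *)
Lemma f_inj x y : A x -> A y -> f x = f y -> x = y.
Proof.
move=> Ax Ay e; have brE : br x = br y.
  have h : lam ((f x).1, br x) * br x = lam ((f x).1, br y) * br y.
    by rewrite -[LHS](model_fr M Ax) {2}e -[RHS](model_fr M Ay) e.
  have := br_le1 Ax; have := br_le1 Ay; rewrite !ler_norml => /andP[y1 y2] /andP[x1 x2].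
  case: (ltgtP (br x) (br y)) => // c.
    by have := model_lam_incr M (f x).1 x1 c y2; rewrite h ltxx.
  by have := model_lam_incr M (f x).1 y1 c x2; rewrite h ltxx.
have [X1 Y1 r1] := rev Ax; have [X2 Y2 r2] := rev Ay.
rewrite [x]surjective_pairing [y]surjective_pairing; congr (_, _).
  by apply: (model_inj M); rewrite -?X1 -?X2 -?Y1 -?Y2 e brE.
by apply: oppr_inj; rewrite -r1 -r2 e brE.
Qed.

Lemma surjXY (p q : R) : p ^+ 2 + q ^+ 2 = 1 -> exists s, X s = p /\ Y s = q.
Proof.
move=> /unit_angle[t [-> ->]]; exists (pt t).
by rewrite (model_ptX M) (model_ptY M).
Qed.

(** The collars that f(A) leaves uncovered start exactly at lam(s, 1) and -lam(s, -1). *)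
Lemma f_image s r : - lam (s, -1) <= r <= lam (s, 1) -> exists2 x, A x & f x = (s, r).
Proof.
move=> /andP[rl ru].
pose h (u : R) : R := lam (s, u) * u.
have A1 u : -1 <= u <= 1 -> A (s, u) by rewrite -ler_norml.
have ch : {within `[-1, 1], continuous h}.
  apply/subspace_continuousP => u; rewrite /= in_itv/= => u1.
  apply: cvgM; last by apply: cvg_within_filter; exact: cvg_id.
  move=> C nC.
  have := proj1 (subspace_continuousP _ _) (model_lam M) _ (A1 _ u1) _ nC.
  move=> [[P1 P2] /= [n1 n2] H].
  suff : nbhs u [set v | v \in `[-1, 1] -> C (lam (s, v))] by [].
  apply: filterS n2 => v P2v /=; rewrite in_itv/= => v1; apply: (H (s, v)); last exact: A1.
  by split => //=; exact: nbhs_singleton.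
have mr : Num.min (h (-1)) (h 1) <= r <= Num.max (h (-1)) (h 1).
  by rewrite /h mulrN1 mulr1 ge_min le_max rl ru orbT.
have N11 : -1 <= 1 :> R by lra.
have [v] := @IVT R h (-1) 1 r N11 ch mr.
rewrite in_itv/= => v1 hv.
have Asv : `|- v| <= 1 by rewrite normrN ler_norml.
have [s0 [Xs0 Ys0]] := surjXY (next_unit b0 ba (XY1 s) Asv).
pose x := (s0, - nextr a b (X s) (Y s) (- v)).
have Ax : A x by rewrite /annulus /x/= normrN; exact: nextr_le1.
exists x => //.
have f1 : (f x).1 = s.
  apply: (model_inj M); first by rewrite (model_fX M Ax) /= Xs0 Ys0 revX.
  by rewrite (model_fY M Ax) /= Xs0 Ys0 revY.
have f2 : nextr a b (X x.1) (Y x.1) x.2 = v by rewrite /= Xs0 Ys0 revr// opprK.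
rewrite [LHS]surjective_pairing f1; congr (_, _).
by rewrite (model_fr M Ax) f1 f2.
Qed.

Lemma f_image_bound x : A x -> - lam ((f x).1, -1) <= (f x).2 <= lam ((f x).1, 1).
Proof.
move=> Ax; rewrite (model_fr M Ax) -/(br x).
have := br_le1 Ax; rewrite ler_norml => /andP[x1 x2].
have e1 : - lam ((f x).1, -1) = lam ((f x).1, -1) * -1 by ring.
have e2 : lam ((f x).1, 1) = lam ((f x).1, 1) * 1 by ring.
apply/andP; split; [rewrite e1|rewrite e2].
  move: x1; rewrite le_eqVlt => /orP[/eqP <-//|c]; exact/ltW/(model_lam_incr M).
move: x2; rewrite le_eqVlt => /orP[/eqP ->//|c]; exact/ltW/(model_lam_incr M).
Qed.

Lemma f_boundary s r : `|r| = 1 -> f (s, r) = (s, lam (s, r) * r).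
Proof.
move=> r1; have Ax : A (s, r) by rewrite /annulus /= r1.
have [e1 e2 e3] := next_boundary b0 ba (XY1 s) Ax r1.
have f1 : (f (s, r)).1 = s.
  by apply: (model_inj M); rewrite ?(model_fX M)// ?(model_fY M).
by rewrite [LHS]surjective_pairing f1 (model_fr M)// f1 /= e3.
Qed.

(** The whole gain of energy comes from the decrease of r^2 at the bounce. *)
Lemma en_f x : A x -> en (f x) = en x + sqspeed a b (X (f x).1) (Y (f x).1) *
  ((br x) ^+ 2 - (f x).2 ^+ 2).
Proof.
move=> Ax; rewrite {2}/en -(energy_next b0 ba (XY1 _) Ax) -(model_fX M Ax) -(model_fY M Ax).
by rewrite /en /energy -/(br x); ring.
Qed.

Let fr2 x : A x -> (f x).2 ^+ 2 <= br x ^+ 2 /\ ((f x).2 ^+ 2 = br x ^+ 2 -> (f x).2 = 0).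
Proof.
move=> Ax; rewrite (model_fr M)// -/(br x).
have /andP[l0 l1] := model_lam01 M (brA Ax); set l := lam _ in l0 l1 *.
have l2 : l ^+ 2 < 1 by rewrite expr_lt1// ltW.
rewrite exprMn; split.
  by rewrite -[leRHS]mul1r ler_wpM2r ?sqr_ge0// ltW.
move=> /eqP; rewrite -subr_eq0 -[X in _ - X]mul1r -mulrBl mulf_eq0 subr_eq0 (lt_eqF l2)/=.
by rewrite sqrf_eq0 => /eqP ->; rewrite mulr0.
Qed.

Lemma en_le x : A x -> en x <= en (f x).
Proof.
move=> Ax; rewrite en_f// lerDl mulr_ge0 ?subr_ge0 ?(proj1 (fr2 Ax))//.
exact/ltW/sqspeed_gt0.
Qed.

Lemma en_eq x : A x -> en (f x) = en x -> (f x).2 = 0.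
Proof.
move=> Ax; rewrite en_f// => /eqP; rewrite -subr_eq0 addrC addKr mulf_eq0.
rewrite gt_eqF ?sqspeed_gt0//= subr_eq0 => /eqP h.
exact: (proj2 (fr2 Ax)).
Qed.

Lemma en_le_a2 x : en x <= a ^+ 2.
Proof.
rewrite /en /energy; apply: (@le_trans _ _ (sqspeed a b (X x.1) (Y x.1) * 1)).
  by rewrite ler_wpM2l ?gerBl ?sqr_ge0// ltW// sqspeed_gt0.
by rewrite mulr1; exact: sqspeed_le.
Qed.

Lemma en_continuous : continuous en.
Proof.
move=> x; have c1 : y.1 @[y --> x] --> x.1 by exact: cvg_fst.
have c2 : y.2 @[y --> x] --> x.2 by exact: cvg_snd.
have cX : X y.1 @[y --> x] --> X x.1 by apply: (cvg_comp _ _ c1); exact: model_X M _.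
have cY : Y y.1 @[y --> x] --> Y x.1 by apply: (cvg_comp _ _ c1); exact: model_Y M _.
apply: cvgM; first exact: cvg_sqspeed.
by apply: cvgB; [exact: cvg_cst|under eq_fun do rewrite expr2; rewrite expr2; exact: cvgM].
Qed.

Definition axis_points : set (circle R * R) := [set x | x.2 = 0 /\ X x.1 * Y x.1 = 0].

Lemma axisA x : axis_points x -> A x.
Proof. by move=> [x0 _]; rewrite /annulus /= x0 normr0. Qed.

Lemma axis_f x : axis_points x -> [/\ X (f x).1 = - X x.1, Y (f x).1 = - Y x.1 & (f x).2 = 0].
Proof.
move=> xa; have Ax := axisA xa; have [x0 xy] := xa.
have [e1 e2 e3] := next_axis a b (XY1 x.1) x0 xy.
by rewrite (model_fX M)// (model_fY M)// (model_fr M)// e1 e2 e3 mulr0.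
Qed.

Lemma axis_faxis x : axis_points x -> axis_points (f x).
Proof. by move=> xa; have [e1 e2 e3] := axis_f xa; split; rewrite // e1 e2 mulrNN; case: xa. Qed.

Lemma axis_ff x : axis_points x -> f (f x) = x.
Proof.
move=> xa; have [e1 e2 e3] := axis_f xa; have [g1 g2 g3] := axis_f (axis_faxis xa).
rewrite [LHS]surjective_pairing [RHS]surjective_pairing; congr (_, _).
  by apply: (model_inj M); rewrite ?g1 ?g2 ?e1 ?e2 opprK.
by rewrite g3; case: xa.
Qed.

(** Two stationary steps mean that both ends of a chord are orthogonal bounces. *)
Lemma axis_of_en x : A x -> en (f x) = en x -> en (f (f x)) = en (f x) -> axis_points x.
Proof.
move=> Ax /(en_eq Ax) r1 /(en_eq (fA Ax)) r2.
have b2 : br (f x) = 0.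
  move: r2; rewrite (model_fr M (fA Ax)) -/(br (f x)) => /eqP.
  by rewrite mulf_eq0 gt_eqF//=; [move=> /eqP|case/andP: (model_lam01 M (brA (fA Ax)))].
have fx : axis_points (f x).
  by split => //; apply: (normal_both b0 ba (XY1 _) (fA Ax) r1 b2).
have -> : x = f (f x).
  apply: f_inj => //; first exact/fA/fA.
  by rewrite axis_ff.
exact: axis_faxis.
Qed.

Lemma focal_flip x : A x -> b ^+ 2 < en x -> Y x.1 * Y (f x).1 < 0.
Proof. by move=> Ax ex; rewrite (model_fY M Ax); exact: (focal_side b0 ba (XY1 x.1) Ax ex). Qed.

End Model.

(** * Limit points of orbits *)

Lemma cluster_ge0 (T : topologicalType) (R : realType) (F : set_system T) (g : T -> R) z :
  Filter F -> continuous g -> F [set x | 0 <= g x] -> cluster F z -> 0 <= g z.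
Proof.
move=> FF cg Fg clz; rewrite leNgt; apply/negP => gz.
have n : nbhs z (g @^-1` [set u | u < 0]).
  by apply: cg; exact: lt_nbhsl.
by have [x /= [gx0 gx1]] := clz _ _ Fg n; move: gx0; rewrite leNgt gx1.
Qed.

Section Dyn.
Context (R : realType) (a b : R) (X Y : circle R -> R) (pt : R -> circle R)
    (lam : circle R * R -> R) (f : circle R * R -> circle R * R).
Hypothesis M : ellipse_model a b X Y pt lam f.

Let b0 := model_b0 M.
Let ba := model_ba M.
Let a0 : 0 < a. Proof. exact: lt_trans ba. Qed.
Let XY1 := model_unit M.
Let Minj := model_inj M.
Local Notation A := (annulus (R := R)).
Local Notation en := (chord_energy a b X Y).
Local Notation axis_points := (axis_points X Y).
Implicit Types (x z p : circle R * R) (s : circle R) (r : R) (y : nat -> circle R * R).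

Let hT : hausdorff_space (circle R * R)%type :=
  cylinder_hausdorff (model_X M) (model_Y M) Minj.
Let cA := @annulus_compact R.

Let fA x : A x -> A (f x) := @fA _ _ _ _ _ _ _ _ M x.
Let itA n x : A x -> A (iter n f x) := @iterA _ _ _ fA n x.
Let f_inj := f_inj M.
Let it_inj n x z : A x -> A z -> iter n f x = iter n f z -> x = z := @iter_inj _ _ _ fA f_inj n x z.
Let cf := f_continuous M.

Lemma X1_continuous : continuous (fun x : circle R * R => X x.1).
Proof. by move=> x; apply: (cvg_comp _ _ cvg_fst); exact: model_X M _. Qed.

Lemma Y1_continuous : continuous (fun x : circle R * R => Y x.1).
Proof. by move=> x; apply: (cvg_comp _ _ cvg_fst); exact: model_Y M _. Qed.

Lemma en_ge0 x : A x -> 0 <= en x.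
Proof.
move=> Ax; rewrite mulr_ge0 ?subr_ge0//; first exact/ltW/sqspeed_gt0.
by rewrite -real_normK ?num_real// expr_le1.
Qed.

Lemma en_axis z : axis_points z -> en z = a ^+ 2 /\ X z.1 = 0 \/ en z = b ^+ 2 /\ Y z.1 = 0.
Proof.
move=> [r0 /eqP]; have := XY1 z.1; rewrite mulf_eq0 /en /energy /sqspeed r0.
by move=> h /orP[/eqP e|/eqP e]; [left|right]; split => //; move: h; rewrite e expr0n/= ?add0r ?addr0 => ->; ring.
Qed.

Lemma en_top x : A x -> en x = a ^+ 2 -> X x.1 = 0 /\ x.2 = 0.
Proof.
move=> Ax; rewrite /en /energy => e.
have sl := sqspeed_le b0 ba (XY1 x.1); have s0 := sqspeed_gt0 b0 ba (XY1 x.1).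
have a2 : 0 < a ^+ 2 by rewrite exprn_gt0.
have r0 : x.2 ^+ 2 = 0.
  apply/eqP; rewrite eq_le sqr_ge0 andbT leNgt; apply/negP => r0.
  have : sqspeed a b (X x.1) (Y x.1) * x.2 ^+ 2 > 0 by rewrite mulr_gt0.
  move: e; rewrite mulrBr mulr1; lra.
split; last by apply/eqP; rewrite -sqrf_eq0 r0.
move: e; rewrite r0 subr0 mulr1 sqspeedE// => e.
have c0 : a ^+ 2 - b ^+ 2 != 0 by rewrite gt_eqF// subr_gt0 ltr_sqr ?nnegrE// ltW.
have Y1 : Y x.1 ^+ 2 = 1.
  by apply: (mulfI c0); rewrite mulr1; lra.
have : X x.1 ^+ 2 = 0 by have := XY1 x.1; rewrite Y1; lra.
by move/eqP; rewrite sqrf_eq0 => /eqP.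
Qed.

Lemma axis_eq p q : axis_points p -> axis_points q -> X p.1 = X q.1 -> Y p.1 = Y q.1 -> p = q.
Proof.
move=> [p2 _] [q2 _] h1 h2; rewrite [p]surjective_pairing [q]surjective_pairing p2 q2.
by rewrite (Minj h1 h2).
Qed.

(** At a cluster point the energy of two more iterates is the same limit, by continuity, so that
    [axis_of_en] applies. *)
Lemma lasalle y (l : R) z : (forall n, A (y n)) ->
  en (y n) @[n --> \oo] --> l -> en (f (y n)) @[n --> \oo] --> l ->
  en (f (f (y n))) @[n --> \oo] --> l -> A z -> cluster (y n @[n --> \oo]) z ->
  axis_points z /\ en z = l.
Proof.
move=> Ay c0 c1 c2 Az clz.
have ce := @en_continuous _ _ _ _ _ _ _ _ M.
have FA : (y n @[n --> \oo]) A by exact: (@filterE _ \oo).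
have ce0 : {within A, continuous en} by exact: continuous_subspaceT.
have ce1 : {within A, continuous (en \o f)}.
  by apply: (within_continuous_comp cf _ (B := setT)) => //; exact: continuous_subspaceT.
have ce2 : {within A, continuous (en \o f \o f)}.
  by apply: (within_continuous_comp cf ce1).
have hR : hausdorff_space R by exact: norm_hausdorff.
have e0 : en z = l by exact: (cluster_image hR ce0 _ FA Az clz c0).
have e1 : en (f z) = l by exact: (cluster_image hR ce1 _ FA Az clz c1).
have e2 : en (f (f z)) = l by exact: (cluster_image hR ce2 _ FA Az clz c2).
by split=> //; apply: (axis_of_en M) => //; rewrite ?e0 ?e1 ?e2.
Qed.

(** Injectivity makes the backward orbit unique, but it exists only in the attractor. *)
Definition backward_orbit x y := y 0 = x /\ forall n, A (y n) /\ f (y n.+1) = y n.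
Local Notation borbit := backward_orbit.

Lemma borbit_iter x y n k : borbit x y -> iter k f (y (k + n)%N) = y n.
Proof.
move=> [_ h]; elim: k => // k IH; rewrite addSn iterSr.
by rewrite (proj2 (h _)).
Qed.

Lemma borbit_attractor x y n : borbit x y -> attractor f (y n).
Proof.
move=> h k _; exists (y (k + n)%N); first by case: h => _ /(_ (k + n)%N)[].
exact: borbit_iter h.
Qed.

Lemma borbit_of x y : (forall n, A (y n) /\ iter n f (y n) = x) -> borbit x y.
Proof.
move=> h; split; first by have [_] := h 0.
move=> n; have [An en'] := h n; have [An1 en1] := h n.+1; split => //.
by apply: (it_inj (n := n)) => //; [exact: fA|rewrite -iterSr en1 en'].
Qed.

Lemma attractor_borbit x : attractor f x -> exists y, borbit x y.
Proof.
move=> ax; have /choice[y hy] : forall n, exists z, A z /\ iter n f z = x.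
  by move=> n; have [z Az zx] := ax n I; exists z.
by exists y; exact: borbit_of.
Qed.

Lemma borbit_unstable x p y : borbit x y -> y (2 * n)%N @[n --> \oo] --> p ->
  unstable_set2 f p x.
Proof.
move=> h hp; split; first by case: h => <- /(_ 0)[].
exists (fun n => y (2 * n)%N) => // n; split; first by case: h => _ /(_ (2 * n)%N)[].
by rewrite -[X in y X]addn0 (borbit_iter _ _ h); case: h.
Qed.

Lemma unstable_attractor x p : unstable_set2 f p x -> attractor f x.
Proof.
move=> [Ax [y hy _]] k _; have [Ay yx] := hy k.
exists (iter k f (y k)); first exact: itA.
by rewrite -iterD addnn -mul2n.
Qed.

Lemma borbit_en_le x y m n : borbit x y -> (m <= n)%N -> en (y n) <= en (y m).
Proof.
move=> [_ h] mn; rewrite -(subnK mn); elim: (n - m)%N => [//|k IH].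
by apply: le_trans IH; rewrite addSn -(proj2 (h (k + m)%N)); exact: en_le M _ (proj1 (h _)).
Qed.

Lemma borbit_cvg_en x y : borbit x y -> exists l,
  [/\ en (y n) @[n --> \oo] --> l, l <= en x & 0 <= l].
Proof.
move=> h.
have dec : nonincreasing_seq (fun n => en (y n)) by move=> m n mn; exact: (borbit_en_le h mn).
have lb : has_lbound (range (fun n => en (y n))).
  by exists 0 => _ [n _ <-]; apply: en_ge0; case: h => _ /(_ n)[].
have c := nonincreasing_is_cvgn dec lb.
exists (limn (fun n => en (y n))); split => //.
  by have := nonincreasing_cvgn_ge dec c 0; case: h => ->.
by apply: limr_ge => //; apply: (@filterE _ \oo) => n; apply: en_ge0; case: h => _ /(_ n)[].
Qed.

Lemma borbit_cluster x y z (k : nat -> nat) : borbit x y ->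
  {homo k : m n / (m < n)%N} -> A z -> cluster (y (k n) @[n --> \oo]) z ->
  axis_points z /\ en z <= en x /\ (en z = a ^+ 2 -> en x = a ^+ 2).
Proof.
move=> h hk Az clz; have [l [cl lx l0]] := borbit_cvg_en h.
have kn n : (n <= k n)%N by elim: n => // n IH; apply: leq_ltn_trans IH (hk _ _ _).
have kcv (u : nat -> R) : u n @[n --> \oo] --> l -> u (k n) @[n --> \oo] --> l.
  move=> ul C /ul [N _ NC]; exists N => // n Nn; apply: NC => /=.
  exact: (leq_trans Nn).
have c0 := kcv _ cl.
have sh (j : nat) : en (y (k n - j)%N) @[n --> \oo] --> l.
  move=> C /cl [N _ NC]; exists (N + j)%N => // n /= Nn; apply: NC => /=.
  by rewrite leq_subRL; [rewrite addnC; apply: leq_trans Nn (kn n)|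
    apply: leq_trans (kn n); apply: leq_trans Nn; exact: leq_addl].
have near2 (j : nat) : \forall n \near \oo, (j <= k n)%N.
  by exists j => // n /= jn; exact: leq_trans (kn n).
have [|||] := @lasalle (fun n => y (k n)) l z _ c0 _ _ Az clz.
- by move=> n; case: h => _ /(_ (k n))[].
- apply: cvg_trans (sh 1%N); apply: near_eq_cvg; apply: filterS (near2 1%N) => n k1.
  by case: h => _ /(_ (k n - 1)%N)[_ <-]; rewrite -addn1 subnK.
- apply: cvg_trans (sh 2%N); apply: near_eq_cvg; apply: filterS (near2 2%N) => n k2.
  case: h => _ h; have [_ <-] := h (k n - 2)%N; have [_ <-] := h (k n - 2).+1.
  by rewrite -addn2 subnK.
move=> az ez; split => //; split; first by rewrite ez.
by move=> ea; apply/eqP; rewrite eq_le (en_le_a2 M) -ea ez.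
Qed.

(** Along a backward orbit the energy decreases to that of a point of the axes, hence is at least
    b^2.  If it starts from b^2 it is constant, so the last bounce is stationary and r = 0. *)
Lemma attractor_en x : attractor f x ->
  b ^+ 2 <= en x /\ (en x = b ^+ 2 -> Y x.1 = 0 /\ x.2 = 0).
Proof.
move=> /attractor_borbit[y h].
have ab : b ^+ 2 <= a ^+ 2 by rewrite ler_sqr ?nnegrE ltW.
have FA : (y n @[n --> \oo]) A by apply: (@filterE _ \oo) => n; case: h => _ /(_ n)[].
have [z [Az clz]] := cA _ FA.
have [az [ez _]] := borbit_cluster (k := id) h (fun m n mn => mn) Az clz.
have bz : b ^+ 2 <= en x.
  by apply: le_trans ez; have [[->]|[->]] := en_axis az.
split => // ex; have [y0 hy] := h.
have [A1 f1] := hy 1%N; have [_ f0] := hy 0; rewrite y0 in f0.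
have e1 : en (y 1%N) = b ^+ 2.
  apply/eqP; rewrite eq_le -{1}ex -y0 (borbit_en_le h)//=.
  have [z1 [Az1 clz1]] := cA _ FA.
  have h1 : borbit (y 1%N) (fun n => y n.+1) by split => // n; exact: hy.
  have FA1 : (y n.+1 @[n --> \oo]) A by apply: (@filterE _ \oo) => n; case: (hy n.+1).
  have [z2 [Az2 clz2]] := cA _ FA1.
  have [az2 [ez2 _]] := borbit_cluster (k := id) h1 (fun m n mn => mn) Az2 clz2.
  by apply: le_trans ez2; have [[->]|[->]] := en_axis az2.
have r0 : x.2 = 0.
  by rewrite -f0; apply: (en_eq M A1); rewrite f0 e1.
split => //; move: ex; rewrite /en /energy r0 expr0n subr0 mulr1 sqspeedE// => /eqP.
rewrite -subr_eq0 addrAC subrr add0r mulf_eq0 sqrf_eq0 gt_eqF ?subr_gt0 ?ltr_sqr ?nnegrE ?ltW//=.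
by move=> /eqP.
Qed.

Lemma axis_attractor x : axis_points x -> attractor f x.
Proof.
move=> ax k _; exists (iter k f x); first exact/itA/(axisA ax).
have E n : axis_points (iter n f x) by elim: n => // n; exact: axis_faxis M _.
elim: k => // k IH; rewrite iterSr [iter k.+1 f x]iterS (axis_ff M (E k)).
by rewrite -[RHS]IH.
Qed.

(** The energy of the cluster points is larger than b^2, hence they are ends of the minor axis;
    the sign of Y, which is kept by two bounces, selects one of them. *)
Lemma forward_sink x z : A x -> b ^+ 2 < en x -> axis_points z -> X z.1 = 0 ->
  0 < Y x.1 * Y z.1 -> iter (2 * n) f x @[n --> \oo] --> z.
Proof.
move=> Ax ex az Xz Yxz.
have inc : nondecreasing_seq (fun n => en (iter n f x)).
  by apply/nondecreasing_seqP => n; rewrite iterS; exact: en_le M _ (itA n Ax).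
have ub : has_ubound (range (fun n => en (iter n f x))).
  by exists (a ^+ 2) => _ [n _ <-]; exact: en_le_a2 M _.
have c := nondecreasing_is_cvgn inc ub; set l := limn _ in c.
have lx : en x <= l by have := nondecreasing_cvgn_le inc c 0.
have sub (j : nat) : en (iter (2 * n + j)%N f x) @[n --> \oo] --> l.
  move=> C /c [N _ NC]; exists N => // n Nn; apply: NC => /=.
  by apply: (leq_trans Nn); rewrite mul2n -addnn -addnA leq_addr.
have exn n : b ^+ 2 < en (iter n f x).
  by apply: lt_le_trans ex _; exact: (inc 0 n).
have sgn n : 0 < Y (iter (2 * n) f x).1 * Y z.1.
  elim: n => // n IH; rewrite mulnS iterD /=.
  set w := iter (2 * n) f x in IH *.
  have h1 := focal_flip M (itA (2 * n) Ax) (exn _).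
  have h2 := focal_flip M (itA (2 * n).+1 Ax) (exn _).
  rewrite -/w in h1; rewrite iterS -/w in h2.
  have h3 : 0 < (Y w.1 * Y (f w).1) * (Y (f w).1 * Y (f (f w)).1) by rewrite nmulr_lgt0.
  have h4 : 0 < (Y w.1 * Y z.1) * ((Y w.1 * Y (f w).1) * (Y (f w).1 * Y (f (f w)).1)).
    by rewrite mulr_gt0.
  have e : (Y w.1 * Y z.1) * ((Y w.1 * Y (f w).1) * (Y (f w).1 * Y (f (f w)).1)) =
    (Y w.1 * Y (f w).1) ^+ 2 * (Y (f (f w)).1 * Y z.1) by ring.
  rewrite e in h4; rewrite -(pmulr_rgt0 _ (_ : 0 < (Y w.1 * Y (f w).1) ^+ 2))//.
  by rewrite exprn_even_gt0//= lt_eqF.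
apply: (compact_cvg _ cA); first by apply: (@filterE _ \oo) => n; exact: itA.
move=> z' Az' clz'.
have [||||az' ez'] := @lasalle (fun n => iter (2 * n) f x) l z' _ _ _ _ Az' clz'.
- by move=> n; exact: itA.
- by have := sub 0; under eq_fun do rewrite addn0.
- by have := sub 1%N; under eq_fun do rewrite addn1 iterS.
- by have := sub 2; under eq_fun do rewrite addn2 2!iterS.
have X0 : X z'.1 = 0.
  have [[_ //]|[eb _]] := en_axis az'.
  by move: ex; rewrite -eb ez' ltNge lx.
have Y0 : 0 <= Y z'.1 * Y z.1.
  apply: (@cluster_ge0 _ _ (iter (2 * n) f x @[n --> \oo]) (fun x => Y x.1 * Y z.1)) => //.
    by move=> u; apply: cvgM; [exact: Y1_continuous|exact: cvg_cst].
  by apply: (@filterE _ \oo) => n; exact/ltW/sgn.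
apply: axis_eq => //; first by rewrite X0 Xz.
have y1 := XY1 z'.1; have y2 := XY1 z.1; move: y1 y2; rewrite X0 Xz expr0n !add0r => y1 y2.
have /eqP : Y z'.1 ^+ 2 = Y z.1 ^+ 2 by rewrite y1 y2.
rewrite eqf_sqr => /orP[/eqP//|/eqP e]; move: Y0; rewrite e mulNr -expr2 y2.
by rewrite oppr_ge0 ler10.
Qed.

(** The cluster points of the even backward iterates are ends of the major axis, where f^2 preserves the sign of X.
    So this sign is eventually constant along them, and only one end remains. *)
Lemma attractor_saddle x : attractor f x -> en x != a ^+ 2 ->
  exists p, [/\ axis_points p, Y p.1 = 0 & unstable_set2 f p x].
Proof.
move=> /attractor_borbit[y h] exa; have [y0 hy] := h.
have Ay n : A (y n) by case: (hy n).
have hk : {homo (fun n => 2 * n)%N : m n / (m < n)%N} by move=> m n; rewrite ltn_pmul2l.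
have cl z : A z -> cluster (y (2 * n)%N @[n --> \oo]) z -> axis_points z /\ Y z.1 = 0.
  move=> Az clz; have [az [_ ez]] := borbit_cluster h hk Az clz.
  by split => //; have [[/ez/eqP]|[_ ->]] := en_axis az; rewrite ?(negbTE exa).
pose g x := X x.1 * X (f (f x)).1.
have cg : {within A, continuous g}.
  have cff : {within A, continuous (f \o f)} by apply: (within_continuous_comp cf cf).
  have c2 : {within A, continuous (fun x => X (f (f x)).1)}.
    apply: (within_continuous_comp cff (B := setT) (g := fun x => X x.1)) => //.
    exact: (continuous_subspaceT X1_continuous).
  move=> u; apply: cvgM; last exact: c2.
  exact: (continuous_subspaceT X1_continuous).
have gpos : \forall n \near \oo, 0 < g (y (2 * n)%N).
  apply: (@compact_cluster_near _ A (y (2 * n)%N @[n --> \oo]) [set x | 0 < g x]) => //.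
    by apply: (@filterE _ \oo) => n; exact: Ay.
  move=> z Az /(cl _ Az)[az Yz].
  have gz : g z = 1.
    by rewrite /g (axis_ff M az) -expr2; have := XY1 z.1; rewrite Yz expr0n addr0.
  apply: (proj1 (subspace_continuousP _ _) cg z Az [set u | 0 < u]).
  have g0 : 0 < g z by rewrite gz.
  exact: lt_nbhsr.
have [N _ NP] := gpos.
have step n : f (f (y (2 * n.+1)%N)) = y (2 * n)%N.
  by rewrite mulnS add2n (proj2 (hy _)) (proj2 (hy _)).
pose s := X (y (2 * N)%N).1.
have s0 : s != 0.
  by apply/eqP => s0; have := NP N (leqnn N); rewrite /g /= -/s s0 mul0r ltxx.
have sgn k : 0 < s * X (y (2 * (k + N))%N).1.
  elim: k => [|k IH]; first by rewrite add0n -/s -expr2 exprn_even_gt0.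
  have := NP (k.+1 + N)%N (leq_addl _ _); rewrite /g /= addSn step => gp.
  have hp := mulr_gt0 IH gp.
  rewrite -(pmulr_rgt0 _ (_ : 0 < X (y (2 * (k + N))%N).1 ^+ 2)); last first.
    rewrite exprn_even_gt0//=; apply/eqP => e; move: IH; by rewrite e mulr0 ltxx.
  by move: hp; congr (0 < _); ring.
pose c : R := if 0 < s then 1 else -1.
have c1 : c ^+ 2 = 1 by rewrite /c; case: ifP; rewrite ?sqrrN expr1n.
have sc : 0 < s * c.
  by rewrite /c; case: ifPn => [?|]; rewrite ?mulr1// -leNgt le_eqVlt (negbTE s0)/= mulrN1 oppr_gt0.
have [t [Xt Yt]] : exists t, X t = c /\ Y t = 0.
  by apply: (surjXY M); rewrite c1 expr0n addr0.
have ap : axis_points (t, 0) by split; rewrite //= Yt mulr0.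
exists (t, 0); split => //; apply: (borbit_unstable h).
apply: (compact_cvg _ cA); first by apply: (@filterE _ \oo) => n; exact: Ay.
move=> z Az clz; have [az Yz] := cl z Az clz.
have Xz : 0 <= s * X z.1.
  apply: (@cluster_ge0 _ _ (y (2 * n)%N @[n --> \oo]) (fun x => s * X x.1)) => //.
    by move=> u; apply: cvgM; [exact: cvg_cst|exact: X1_continuous].
  by exists N => // n /= Nn; rewrite -(subnK Nn); exact/ltW/sgn.
apply: axis_eq => //=; last by rewrite Yz Yt.
have /eqP : X z.1 ^+ 2 = c ^+ 2 by rewrite c1; have := XY1 z.1; rewrite Yz expr0n addr0.
rewrite Xt eqf_sqr => /orP[/eqP//|/eqP e]; move: Xz; rewrite e mulrN oppr_ge0.
by rewrite leNgt sc.
Qed.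

(** * The two sides of the attractor *)

Definition sgb (c : bool) : R := if c then 1 else -1.
Definition collar (c : bool) : set (circle R * R) :=
  [set x | A x /\ lam (x.1, sgb c) <= sgb c * x.2].
Definition edge (c : bool) : set (circle R * R) := [set x | x.2 = sgb c].

Let sgb2 c : sgb c * sgb c = 1. Proof. by case: c; rewrite /sgb ?mulr1// mulrNN mulr1. Qed.
Let sgbN c : sgb (~~ c) = - sgb c. Proof. by case: c; rewrite /sgb ?opprK. Qed.
Let sgb_norm c : `|sgb c| = 1. Proof. by case: c; rewrite /sgb ?normrN normr1. Qed.
Let edgeA c s : A (s, sgb c). Proof. by rewrite /annulus /= sgb_norm. Qed.
Let lam01 c s : 0 < lam (s, sgb c) < 1. Proof. exact: (model_lam01 M (edgeA c s)). Qed.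

Let lam_edge_continuous c : continuous (fun s => lam (s, sgb c)).
Proof.
move=> s C nC.
have := proj1 (subspace_continuousP _ _) (model_lam M) _ (edgeA c s) _ nC.
move=> [[P1 P2] /= [n1 n2] H]; apply: filterS n1 => t P1t.
by apply: (H (t, sgb c)); [split => //=; exact: nbhs_singleton|exact: edgeA].
Qed.

Let strip c (x : circle R * R) : circle R * R :=
  (x.1, sgb c * (lam (x.1, sgb c) + x.2 * (1 - lam (x.1, sgb c)))).

Let strip_continuous c : continuous (strip c).
Proof.
move=> x; have c1 : z.1 @[z --> x] --> x.1 by exact: cvg_fst.
have c2 : z.2 @[z --> x] --> x.2 by exact: cvg_snd.
have cl : lam (z.1, sgb c) @[z --> x] --> lam (x.1, sgb c).
  exact: (@cvg_comp _ _ _ (fun z : circle R * R => z.1) (fun s => lam (s, sgb c)) _ _ _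
    c1 (@lam_edge_continuous c x.1)).
apply: cvg_pair_nbhs => //; apply: cvgM; first exact: cvg_cst.
apply: cvgD => //; apply: cvgM => //; apply: cvgB => //; exact: cvg_cst.
Qed.

Let collarE c : collar c = strip c @` ([set: circle R] `*` `[0, 1]%classic).
Proof.
apply/seteqP; split=> -[s r] /=.
  move=> [Ar lr]; have /andP[l0 l1] := lam01 c s; set l := lam _ in lr l0 l1 *.
  have l1' : 0 < 1 - l by rewrite subr_gt0.
  exists (s, (sgb c * r - l) / (1 - l)) => /=.
    split => //; rewrite in_itv/=; apply/andP; split.
      by apply: divr_ge0; [rewrite subr_ge0|exact: ltW].
    rewrite ler_pdivrMr// mul1r lerB//.
    by apply: (le_trans (ler_norm _)); rewrite normrM sgb_norm mul1r.
  rewrite /strip /= -/l divfK ?gt_eqF// addrC subrK mulrA sgb2 mul1r //.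
move=> [[t u] /= [_]]; rewrite in_itv/= => /andP[u0 u1] [-> <-].
have /andP[l0 l1] := lam01 c s; rewrite /strip /=; set l := lam (s, sgb c) in l0 l1 *.
have l1' : 0 <= 1 - l by rewrite subr_ge0 ltW.
have v0 : 0 <= l + u * (1 - l) by rewrite addr_ge0 ?mulr_ge0// ltW.
split; last by rewrite /= mulrA sgb2 mul1r lerDl mulr_ge0.
rewrite /annulus /= normrM sgb_norm mul1r ger0_norm//.
have : u * (1 - l) <= 1 * (1 - l) by rewrite ler_wpM2r.
lra.
Qed.

Let rect_compact : compact ([set: circle R] `*` `[(0 : R), 1]%classic).
Proof. by apply: compact_setX; [exact: circle_compact|exact: segment_compact]. Qed.

Let rect_connected : connected ([set: circle R] `*` `[(0 : R), 1]%classic).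
Proof.
have -> : [set: circle R] `*` `[(0 : R), 1]%classic =
    \bigcup_s (((fun t : circle R => (t, 1 : R)) @` setT) `|` ((fun r => (s, r)) @` `[(0 : R), 1]%classic)).
  apply/seteqP; split=> -[s r] /=.
    by move=> [_ r01]; exists s => //; right; exists r.
  move=> [t _ [[u _ [_ <-]]|[u u01 [_ <-]]]] //=; split => //.
  by rewrite in_itv/= ler01 lexx.
apply: bigcup_connected.
  by exists (cproj 0, 1) => s _; left; exists (cproj 0).
move=> s _; apply: connectedU.
- exists (s, 1); split; first by exists s.
  by exists 1 => //=; rewrite in_itv/= ler01 lexx.
- apply: connected_continuous_connected; first exact: circle_connected.
  by apply: continuous_subspaceT => t; apply: (@cvg_pair_nbhs _ _ _ (nbhs t)); [exact: cvg_id|exact: cvg_cst].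
- apply: connected_continuous_connected; first exact: segment_connected.
  by apply: continuous_subspaceT => t; apply: cvg_pair_nbhs; [exact: cvg_cst|exact: cvg_id].
Qed.

Let collarA c : collar c `<=` A. Proof. by move=> x []. Qed.

Let collar_compact c : compact (collar c).
Proof.
rewrite collarE; apply: continuous_compact; last exact: rect_compact.
by apply: continuous_subspaceT; exact: strip_continuous.
Qed.

Let collar_connected c : connected (collar c).
Proof.
rewrite collarE; apply: connected_continuous_connected; first exact: rect_connected.
by apply: continuous_subspaceT; exact: strip_continuous.
Qed.

Let edge_collar c : edge c `<=` collar c.
Proof.
move=> [s r]; rewrite /edge /= => ->; split; first exact: edgeA.
by rewrite /= sgb2; case/andP: (lam01 c s) => _ /ltW.
Qed.

Let edge0 c : edge c !=set0. Proof. by exists (cproj 0, sgb c). Qed.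

Let collar_cover x : A x -> (f @` A) x \/ exists c, collar c x.
Proof.
case: x => s r Ax; have [h|h] := boolP (- lam (s, -1) <= r <= lam (s, 1)).
  by left; have [z Az zx] := f_image M h; exists z.
right; move: h; rewrite negb_and -!ltNge => /orP[h|h].
  by exists false; split => //; rewrite /sgb /= mulN1r ltW// ltrNr.
by exists true; split => //; rewrite /sgb /= mul1r ltW.
Qed.

Let f_edge c x : edge c x -> f x = (x.1, sgb c * lam (x.1, sgb c)).
Proof.
by case: x => s r; rewrite /edge /= => ->; rewrite (f_boundary M) ?sgb_norm// mulrC.
Qed.

Let edge_f c x : edge c x -> collar c (f x).
Proof.
move=> ex; rewrite (f_edge ex); split; last by rewrite /= mulrA sgb2 mul1r.
rewrite -(f_edge ex); apply: fA; case: x ex => s r; rewrite /edge /= => ->; exact: edgeA.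
Qed.

Let collar_fA c x : collar c x -> (f @` A) x -> (f @` edge c) x.
Proof.
move=> [Ax lx] [z Az zx]; exists (x.1, sgb c) => //.
rewrite (@f_edge c)//= [RHS]surjective_pairing; congr (_, _).
have := f_image_bound M Az; rewrite zx => /andP[h1 h2].
case: c lx; rewrite /sgb /= => lx.
  by rewrite mul1r in lx; rewrite mul1r; apply/eqP; rewrite eq_le lx h2.
by rewrite mulN1r in lx; rewrite mulN1r; apply/eqP; rewrite eq_le h1 lerNr lx.
Qed.

Let edge_fA c x : edge c x -> ~ (f @` A) x.
Proof.
move=> ex [z Az zx]; have := f_int M Az; rewrite zx.
by case: x ex {zx} => s r; rewrite /edge /= => ->; rewrite sgb_norm ltxx.
Qed.

Let collar_disj x : collar true x -> collar false x -> False.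
Proof.
move=> [_ h1] [_ h2]; have /andP[l1 _] := lam01 true x.1; have /andP[l2 _] := lam01 false x.1.
by move: h1 h2; rewrite /sgb in l1 l2 *; lra.
Qed.

Definition side (c : bool) : set (circle R * R) := collars f collar c.

Lemma side_cover : A `\` attractor f = side true `|` side false.
Proof. exact: (@collars_cover _ A f collar edge). Qed.

Lemma side_open c : open_in_annulus (side c).
Proof. exact: (@collars_open _ A f collar edge). Qed.

Lemma side_connected c : connected (side c).
Proof. exact: (@collars_connected _ A f collar edge). Qed.

Lemma side_disjoint c x : side c x -> side (~~ c) x -> False.
Proof. exact: (@collars_disjoint _ A f collar edge). Qed.

Lemma side_edge c s : side c (s, sgb c).
Proof. by exists 0, (s, sgb c) => //; exact: edge_collar. Qed.

Lemma side_f c x : side c x -> side c (f x).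
Proof. exact: collars_forward. Qed.

Lemma attractor_cpt : compact (attractor f).
Proof. exact: (@attractor_compact _ A f). Qed.

Lemma side_split : complement_split f (side false) (side true).
Proof.
split.
- by rewrite side_cover setUC.
- by apply/seteqP; split=> // x [h1 h2]; exact: (side_disjoint h1 h2).
- by split; exact: side_open.
- by split; exact: side_connected.
- by split=> s; [exact: (side_edge false)|exact: (side_edge true)].
Qed.

(** The map is continuous within the annulus, and it maps each side into itself. *)
Lemma closure_side_f c x : attractor f x -> closure (side c) x -> closure (side c) (f x).
Proof.
move=> ax cx B /= nB; have Ax : A x by case: (ax 0 I) => z Az <-.
have nf : nbhs x [set z | A z -> B (f z)].
  by move/subspace_continuousP : cf => /(_ x Ax _ nB).
have [z [sz /= Bz]] := cx _ nf; exists (f z); split; first exact: side_f.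
by apply: Bz; have [W _ sE] := side_open c; move: sz; rewrite sE => -[].
Qed.

(** Take the highest point of the vertical outside the upper side, or the lowest one outside the lower
    side.  It is a limit of points of this side, and it is not in the other side, which is open
    and disjoint from it. *)
Lemma vertical_meets c s : exists r, attractor f (s, r) /\ closure (side c) (s, r).
Proof.
pose v (t : R) : circle R * R := (s, sgb c * t).
have cv : continuous v.
  move=> t; apply: cvg_pair_nbhs; first exact: cvg_cst.
  by apply: cvgM; [exact: cvg_cst|exact: cvg_id].
have vA t : -1 <= t <= 1 -> A (v t).
  by move=> t1; rewrite /annulus /= normrM sgb_norm mul1r ler_norml.
have [W oW sE] := side_open c.
pose S := `[(-1 : R), 1]%classic `&` v @^-1` (~` W).
have cS : compact S.
  apply: compact_closedI; first exact: segment_compact.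
  by apply: closed_comp (open_closedC oW) => t _; exact: cv.
have S0 : S !=set0.
  exists (-1); split; first by rewrite /= in_itv/= lexx; lra.
  move=> /= Wv; apply: (@side_disjoint c (v (-1))).
    by rewrite sE; split => //; apply: vA; lra.
  by rewrite /v mulrN1 -sgbN; exact: side_edge.
have cid : {within S, continuous (id : R -> R)}.
  by apply: continuous_subspaceT => t; exact: cvg_id.
have [t /set_mem[]] := compact_EVT_max S0 cS cid.
rewrite /= in_itv/= => t1 Wt tmax.
have sideu u : t < u -> u <= 1 -> side c (v u).
  move=> tu u1; have Iu : -1 <= u <= 1 by move: t1 => /andP[? _]; apply/andP; split; lra.
  rewrite sE; split; first exact: vA.
  apply: contrapT => Wu; have /tmax : u \in S by apply/mem_set; split; rewrite //= in_itv.
  by rewrite leNgt tu.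
have lt1 : t < 1.
  rewrite lt_neqAle; case/andP: (t1) => _ ->; rewrite andbT; apply/eqP => e.
  by apply: Wt; rewrite e; have := side_edge c s; rewrite sE /v mulr1 => -[].
have ex B : nbhs (v t) B -> exists u, [/\ t < u, u <= 1 & B (v u)].
  move=> /cv /nbhs_ballP[e /= e0 Be]; exists (Num.min 1 (t + e / 2)).
  have e2 : 0 < e / 2 by rewrite divr_gt0.
  split; first by rewrite lt_min lt1 ltrDl.
    by rewrite ge_min lexx.
  apply: Be; rewrite /ball/= ltr_distlC; apply/andP; split.
    by rewrite lt_min; apply/andP; split; lra.
  by rewrite gt_min; apply/orP; right; rewrite ltrD2l ltr_pdivrMr// ltr_pMr// ltr1n.
exists (sgb c * t); rewrite -/(v t); split; last first.
  by move=> B /ex[u [tu u1 Bu]]; exists (v u); split => //; exact: sideu.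
apply: contrapT => nat.
have : (A `\` attractor f) (v t) by split => //; exact: vA.
rewrite side_cover => sv.
have nsc : ~ side c (v t) by rewrite sE => -[].
have [W' oW' sE'] := side_open (~~ c).
have [_ Wt'] : (A `&` W') (v t).
  by rewrite -sE'; move: sv nsc; case: (c) => -[].
have [|u [tu u1 Wu]] := ex W'; first exact: open_nbhs_nbhs.
have su := sideu u tu u1; apply: (side_disjoint su); rewrite sE'; split => //.
by move: su; rewrite sE => -[].
Qed.

End Dyn.

(** * A hyperbolic cone *)

Section Cone.
Context (R : realType).

(** One step of a map whose linear part is the matrix with rows (p, -q) and (-l t, l p), up to an
    error that is small with respect to the size of the vector. *)
Definition almost_linear (p q t l e : R) (x0 y0 x1 y1 : R) : Prop :=
  `|x0 - (p * x1 - q * y1)| <= e * Num.max `|x1| `|y1| /\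
  `|y0 - l * (p * y1 - t * x1)| <= e * Num.max `|x1| `|y1|.

Let cone_margin (p q t d x0 y0 x1 y1 : R) : 1 < p -> 0 < d -> d <= 1 -> d <= t / 2 ->
  d <= q / 2 -> 0 <= x0 -> 0 <= y0 -> p * x0 + q * y0 - d * (x0 + y0) <= x1 ->
  t * x0 + p * y0 - d * (x0 + y0) <= y1 ->
  [/\ 0 <= x1, 0 <= y1 & p * (x0 + y0) <= x1 + y1].
Proof.
move=> p1 d0 d1 dt dq x0p y0p L1 L2.
have pos (c x : R) : d <= c -> 0 <= x -> 0 <= (c - d) * x.
  by move=> dc x0'; rewrite mulr_ge0// subr_ge0.
have m1 : 0 <= (p - d) * x0 by apply: pos => //; lra.
have m2 : 0 <= (q - d) * y0 by apply: pos => //; lra.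
have m3 : 0 <= (t - d) * x0 by apply: pos => //; lra.
have m4 : 0 <= (p - d) * y0 by apply: pos => //; lra.
have m5 : 0 <= (t - 2 * d) * x0 by rewrite mulr_ge0// subr_ge0; lra.
have m6 : 0 <= (q - 2 * d) * y0 by rewrite mulr_ge0// subr_ge0; lra.
by split; lra.
Qed.

(** The matrix expands the quadrant where the two coordinates have opposite signs, and its inverse
    expands the quadrant where they agree.  Both survive a small relative error. *)
Lemma hyperbolic_cone (p q t l : R) : 1 < p -> 0 < q -> 0 < t -> p ^+ 2 - q * t = 1 ->
  0 < l < 1 -> exists2 e0, 0 < e0 & forall e x0 y0 x1 y1, e <= e0 ->
    almost_linear p q t l e x0 y0 x1 y1 ->
    (0 <= x1 -> y1 <= 0 -> (1 + p) / 2 * x1 <= x0) /\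
    (0 <= x0 -> 0 <= y0 -> [/\ 0 <= x1, 0 <= y1 & p * (x0 + y0) <= x1 + y1]).
Proof.
move=> p1 q0 t0 det /andP[l0 l1].
pose K := p + q / l + t + p / l.
have p0 : 0 < p by lra.
have ql : q <= q / l by rewrite ler_pdivlMr// ger_pMr// ltW.
have pl : p <= p / l by rewrite ler_pdivlMr// ger_pMr// ltW.
have K0 : 0 < K by rewrite /K; lra.
(* K is the sum of the entries of the inverse matrix, and d is the error that its rows allow *)
have [d [d0 d1 dt dq]] : exists d, [/\ 0 < d, d <= 1, d <= t / 2 & d <= q / 2].
  exists (Num.min 1 (Num.min (t / 2) (q / 2))).
  by split; rewrite ?lt_min ?ge_min ?lexx ?orbT// ltr01 !divr_gt0.
have [e1 [e10 e1a e1b]] : exists e1,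
    [/\ 0 < e1, e1 <= 1 / (2 * K) & e1 <= d / (2 * K ^+ 2)].
  exists (Num.min (1 / (2 * K)) (d / (2 * K ^+ 2))).
  split; rewrite ?lt_min ?ge_min ?lexx ?orbT//.
  by rewrite !divr_gt0// mulr_gt0// exprn_gt0.
exists (Num.min e1 (Num.min q ((p - 1) / 2))).
  by rewrite !lt_min e10 q0/= divr_gt0// subr_gt0.
move=> e x0 y0 x1 y1; rewrite !le_min => /andP[ee1 /andP[eq1 ep]] [h1 h2].
set S := Num.max _ _ in h1 h2.
have S0 : 0 <= S by rewrite le_max normr_ge0.
have Sx : `|x1| <= S by rewrite le_max lexx.
have Sy : `|y1| <= S by rewrite le_max lexx orbT.
split=> [x1p y1n|x0p y0p].
  have : S <= x1 - y1.
    by rewrite /S ge_max ger0_norm// ler0_norm//; apply/andP; split; lra.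
  move=> SS; have [e0|e0] := leP e 0.
    have h : e * S <= 0 by rewrite mulr_le0_ge0.
    have h1' := le_trans h1 h; move: h1'; rewrite normr_le0 subr_eq0 => /eqP ->.
    have : 0 <= q * - y1 by rewrite mulr_ge0 ?oppr_ge0// ltW.
    have : 0 <= (p - 1) * x1 by rewrite mulr_ge0// subr_ge0 ltW.
    lra.
  have h3 : e * S <= e * (x1 - y1) by rewrite ler_wpM2l// ltW.
  have h4 : e * x1 <= (p - 1) / 2 * x1 by rewrite ler_wpM2r.
  have h5 : e * - y1 <= q * - y1 by rewrite ler_wpM2r// oppr_ge0.
  move: (le_trans h1 h3); rewrite ler_distl => /andP[h6 _]; lra.
pose u := x0 - (p * x1 - q * y1); pose v := y0 - l * (p * y1 - t * x1).
have x1E : x1 = p * x0 + q / l * y0 - (p * u + q / l * v).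
  have -> : p * x0 + q / l * y0 - (p * u + q / l * v) = (p ^+ 2 - q * t) * x1.
    by rewrite /u /v; field; rewrite gt_eqF.
  by rewrite det mul1r.
have y1E : y1 = t * x0 + p / l * y0 - (t * u + p / l * v).
  have -> : t * x0 + p / l * y0 - (t * u + p / l * v) = (p ^+ 2 - q * t) * y1.
    by rewrite /u /v; field; rewrite gt_eqF.
  by rewrite det mul1r.
have eS : e * S <= e1 * S by rewrite ler_wpM2r.
have uS : `|u| <= e1 * S := le_trans h1 eS.
have vS : `|v| <= e1 * S := le_trans h2 eS.
clearbody u v.
have err (c1 c2 : R) : 0 <= c1 -> 0 <= c2 -> c1 + c2 <= K ->
    `|c1 * u + c2 * v| <= K * (e1 * S).
  move=> c10 c20 cK; apply: (le_trans (ler_normD _ _)); rewrite !normrM (ger0_norm c10) (ger0_norm c20).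
  have := ler_wpM2l c10 uS; have := ler_wpM2l c20 vS.
  have : (c1 + c2) * (e1 * S) <= K * (e1 * S).
    by rewrite ler_wpM2r// mulr_ge0// ltW.
  lra.
have q'0 : 0 <= q / l by rewrite divr_ge0// ltW.
have p'0 : 0 <= p / l by rewrite divr_ge0// ltW.
have E1 : `|p * u + q / l * v| <= K * (e1 * S).
  by apply: err => //; [exact: ltW|rewrite /K; lra].
have E2 : `|t * u + p / l * v| <= K * (e1 * S).
  by apply: err => //; [exact: ltW|rewrite /K; lra].
pose S' := x0 + y0.
have S'0 : 0 <= S' by rewrite addr_ge0.
have lin (c1 c2 : R) : 0 <= c1 -> 0 <= c2 -> c1 + c2 <= K -> c1 * x0 + c2 * y0 <= K * S'.
  move=> c10 c20 cK.
  have := ler_wpM2r x0p (_ : c1 <= K); have := ler_wpM2r y0p (_ : c2 <= K).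
  rewrite /S' mulrDr => h3 h4; apply: lerD; [apply: h4|apply: h3]; lra.
have B1 := lin _ _ (ltW p0) q'0 (_ : p + q / l <= K).
have B2 := lin _ _ (ltW t0) p'0 (_ : t + p / l <= K).
have Ke1 : K * e1 <= 1 / 2.
  apply: (@le_trans _ _ (K * (1 / (2 * K)))); first by rewrite ler_wpM2l ?(ltW K0).
  by rewrite le_eqVlt; apply/orP; left; apply/eqP; field; rewrite gt_eqF.
have KeS : K * (e1 * S) <= S / 2.
  by rewrite mulrA [S / 2]mulrC -[2^-1]mul1r ler_wpM2r.
have pos1 : 0 <= p * x0 + q / l * y0 by apply: addr_ge0; apply: mulr_ge0 => //; exact: ltW.
have pos2 : 0 <= t * x0 + p / l * y0 by apply: addr_ge0; apply: mulr_ge0 => //; exact: ltW.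
have SK : S <= 2 * K * S'.
  have : S <= K * S' + S / 2.
    rewrite {1}/S ge_max; apply/andP; split.
      rewrite x1E; apply: (le_trans (ler_normB _ _)).
      rewrite ger0_norm//; apply: lerD; last exact: le_trans E1 KeS.
      by apply: B1; rewrite /K; lra.
    rewrite y1E; apply: (le_trans (ler_normB _ _)).
    rewrite ger0_norm//; apply: lerD; last exact: le_trans E2 KeS.
    by apply: B2; rewrite /K; lra.
  lra.
have eD : K * (e1 * S) <= d * S'.
  apply: (@le_trans _ _ (K * (e1 * (2 * K * S')))).
    by rewrite ler_wpM2l ?(ltW K0)// ler_wpM2l ?(ltW e10).
  have -> : K * (e1 * (2 * K * S')) = (2 * K ^+ 2 * e1) * S' by ring.
  rewrite ler_wpM2r//.
  apply: (@le_trans _ _ (2 * K ^+ 2 * (d / (2 * K ^+ 2)))).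
    by apply: ler_wpM2l => //; apply: mulr_ge0 => //; exact: sqr_ge0.
  by rewrite le_eqVlt; apply/orP; left; apply/eqP; field; rewrite gt_eqF.
have F1 := le_trans E1 eD; have F2 := le_trans E2 eD.
have L1 : p * x0 + q * y0 - d * (x0 + y0) <= x1.
  have h3 : q * y0 <= q / l * y0 by rewrite ler_wpM2r.
  have := ler_norm (p * u + q / l * v); rewrite /S' in F1; lra.
have L2 : t * x0 + p * y0 - d * (x0 + y0) <= y1.
  have h3 : p * y0 <= p / l * y0 by rewrite ler_wpM2r.
  have := ler_norm (t * u + p / l * v); rewrite /S' in F2; lra.
exact: (cone_margin p1 d0 d1 dt dq x0p y0p L1 L2).
Qed.

End Cone.

(** * Backward orbits near the major axis *)

Section Local.
Context (R : realType) (a b : R) (X Y : circle R -> R) (pt : R -> circle R)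
    (lam : circle R * R -> R) (f : circle R * R -> circle R * R).
Hypothesis M : ellipse_model a b X Y pt lam f.

Let b0 := model_b0 M.
Let ba := model_ba M.
Let a0 : 0 < a. Proof. exact: lt_trans ba. Qed.
Let XY1 := model_unit M.
Let Minj := model_inj M.
Local Notation A := (annulus (R := R)).
Local Notation en := (chord_energy a b X Y).
Local Notation axis_points := (axis_points X Y).
Local Notation borbit := (backward_orbit f).
Implicit Types (x z : circle R * R) (s : circle R) (r : R) (y : nat -> circle R * R).

Let fA x : A x -> A (f x) := @fA _ _ _ _ _ _ _ _ M x.

Lemma pt_eq (t u : R) : cos t = cos u -> sin t = sin u -> pt t = pt u.
Proof. by move=> h1 h2; apply: Minj; rewrite ?(model_ptX M) ?(model_ptY M). Qed.

Definition lift_step (p : R * R) : R * R :=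
  (angle_lift a b p, lam (pt (angle_lift a b p), sin_lift a b p) * sin_lift a b p).

Lemma f_lift (t r : R) : `|r| < 1 ->
  f (pt t, r) = (pt (lift_step (t, r)).1, (lift_step (t, r)).2).
Proof.
move=> r1; have Ax : A (pt t, r) by exact: ltW.
have [e1 e2] := nextXY_angle b0 ba (XY1 (pt t)) r1 (model_ptX M t) (model_ptY M t).
have f1 : (f (pt t, r)).1 = pt (angle_lift a b (t, r)).
  apply: Minj; rewrite ?(model_fX M Ax) ?(model_fY M Ax) /= ?e1 ?e2 ?(model_ptX M) ?(model_ptY M);
    by rewrite /angle_lift /slope_lift /=.
have f2 : nextr a b (X (pt t)) (Y (pt t)) r = sin_lift a b (t, r).
  rewrite (nextrK b0 ba (XY1 (pt t)) (ltW r1) r1) e1 e2 /sin_lift /angle_lift /slope_lift /=.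
  by rewrite (model_ptX M) (model_ptY M).
by rewrite [LHS]surjective_pairing f1 (model_fr M Ax) f1 /= f2.
Qed.

Definition base (j : bool) : R := if j then 0 else pi.

Let cos_base j u : cos (base j + u) = (if j then 1 else -1) * cos u.
Proof. by case: j; rewrite /base ?add0r ?mul1r// cosD cospi sinpi; ring. Qed.

Let sin_base j u : sin (base j + u) = (if j then 1 else -1) * sin u.
Proof. by case: j; rewrite /base ?add0r ?mul1r// sinD cospi sinpi; ring. Qed.

Lemma base_XY j u : X (pt (base j + u)) = (if j then 1 else -1) * cos u /\
  Y (pt (base j + u)) = (if j then 1 else -1) * sin u.
Proof. by rewrite (model_ptX M) (model_ptY M) cos_base sin_base. Qed.

Let sg2 (j : bool) : (if j then 1 else -1 : R) ^+ 2 = 1.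
Proof. by case: j; rewrite ?sqrrN expr1n. Qed.

Let sgM (j : bool) (u v : R) :
  (if j then 1 else -1) * u * ((if j then 1 else -1) * v) = u * v.
Proof. by rewrite mulrACA -expr2 sg2 mul1r. Qed.

Let sqspeed_base (t : R) j : sqspeed a b (cos (base j + t)) (sin (base j + t)) =
  sqspeed a b (cos t) (sin t).
Proof. by rewrite cos_base sin_base /sqspeed !exprMn sg2 !mul1r. Qed.

Let slope_base j u r : slope_lift a b (base j + u, r) = slope_lift a b (u, r).
Proof.
rewrite /slope_lift /slope /= sqspeed_base cos_base sin_base.
by rewrite sgM.
Qed.

Let angle_base j u r : angle_lift a b (base j + u, r) = base j + angle_lift a b (u, r).
Proof. by rewrite /angle_lift slope_base /= -addrA. Qed.

Let sin_lift_base j u r : sin_lift a b (base j + u, r) = sin_lift a b (u, r).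
Proof.
rewrite /sin_lift slope_base angle_base /speed /= !sqspeed_base !cos_base !sin_base.
by rewrite sgM.
Qed.

(** The billiard map near the major axis, read in the coordinate u of the angle
    base j + u.  The parity j changes at every step, so that the linear part at the
    vertex is the same at both ends of the axis and only the dissipation factor
    depends on j. *)
Definition loc1 (p : R * R) : R := angle_lift a b p - pi.
Definition loc2 (j : bool) (p : R * R) : R :=
  lam (pt (base j + angle_lift a b p), sin_lift a b p) * sin_lift a b p.

Lemma local_step j u r : `|r| < 1 ->
  f (pt (base j + u), r) = (pt (base (~~ j) + loc1 (u, r)), loc2 j (u, r)).
Proof.
move=> r1; rewrite f_lift// /lift_step /= angle_base sin_lift_base /loc2; congr (_, _).
rewrite /loc1; apply: pt_eq; rewrite ?cos_base ?sin_base ?cosB ?sinB cospi sinpi;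
  by case: j => /=; ring.
Qed.

Let c2 : R := a ^+ 2 - b ^+ 2.
Let P : R := 1 + 2 * c2 / b ^+ 2.
Let Q : R := 2 * (a * b) / b ^+ 2.
Let T : R := 2 * c2 * (a * b) / b ^+ 4.
Let l (j : bool) : R := lam (pt (base j + pi), 0).

Let axis0 : cos (0 : R) * sin 0 = 0. Proof. by rewrite sin0 mulr0. Qed.
Let w0 : sqspeed a b (cos 0) (sin 0) = b ^+ 2.
Proof. by rewrite cos0 sin0 /sqspeed expr0n expr1n mulr0 mulr1 add0r. Qed.

Let strict_loc1 : strict loc1 (0, 0) P (- Q).
Proof.
have := strictD (strict_angle b0 ba axis0) (strict_cst (- pi) (0, 0)).
apply: strict_eq => //.
  by rewrite w0 cos0 sin0 /P /c2 expr1n expr0n subr0 mulr1 addr0.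
by rewrite w0 addr0 /Q.
Qed.

Let strict_sin0 : strict (sin_lift a b) (0, 0) (- T) P.
Proof.
have := strict_sin b0 ba axis0; apply: strict_eq => //.
  by rewrite w0 cos0 sin0 /T /c2 expr1n expr0n subr0 mulr1 -exprM.
by rewrite w0 cos0 sin0 /P /c2 expr1n expr0n subr0 mulr1.
Qed.

Let loc1_0 : loc1 (0, 0) = 0.
Proof. by rewrite /loc1 angle_lift0// add0r subrr. Qed.

Let sin0_0 : sin_lift a b (0, 0) = 0. Proof. exact: sin_lift0. Qed.

Let strict_loc2 j : strict (loc2 j) (0, 0) (l j * - T) (l j * P).
Proof.
have La : lipnear (fun p => base j + angle_lift a b p) (0, 0).
  apply: lipD; first exact: lip_cst.
  exact: strict_lip (strict_angle b0 ba axis0).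
have Ls := strict_lip strict_sin0.
have L : lipnear (fun p => lam (pt (base j + angle_lift a b p), sin_lift a b p)) (0, 0).
  apply: (lip_comp2 (g := fun p => lam (pt p.1, p.2)) La Ls).
  by rewrite sin0_0; exact: (model_lam_lip M).
have := strict0M L strict_sin0 sin0_0.
by rewrite sin0_0 angle_lift0// add0r.
Qed.

Let c20 : 0 < c2. Proof. by rewrite subr_gt0 ltr_sqr ?nnegrE// ltW. Qed.
Let b20 : 0 < b ^+ 2. Proof. exact: exprn_gt0. Qed.
Let P1 : 1 < P. Proof. by rewrite ltrDl divr_gt0// mulr_gt0. Qed.
Let Q0 : 0 < Q. Proof. by rewrite divr_gt0// !mulr_gt0. Qed.
Let T0 : 0 < T. Proof. by rewrite divr_gt0 ?exprn_gt0// !mulr_gt0. Qed.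
Let PQT : P ^+ 2 - Q * T = 1.
Proof. by rewrite /P /Q /T /c2; field; rewrite gt_eqF. Qed.
Let l01 j : 0 < l j < 1.
Proof. by apply: (model_lam01 M); rewrite /annulus /= normr0. Qed.

Definition axis_angle x : R := atan (Y x.1 / X x.1).
Definition right_half x : bool := 0 < X x.1.
Local Notation ux := axis_angle.
Local Notation jx := right_half.

Lemma loc_coord x : X x.1 != 0 -> x.1 = pt (base (jx x) + ux x).
Proof.
move=> X0; have c0 : 0 < cos (ux x) by rewrite cos_gt0_pihalf// atan_gtNpi2 atan_ltpi2.
have cK : cos (ux x) ^+ 2 = X x.1 ^+ 2.
  apply: invr_inj; rewrite cos2_tan2 ?gt_eqF// atanK expr_div_n.
  have -> : 1 + Y x.1 ^+ 2 / X x.1 ^+ 2 = (X x.1 ^+ 2 + Y x.1 ^+ 2) / X x.1 ^+ 2.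
    by field.
  by rewrite XY1 mul1r.
have sK : sin (ux x) = Y x.1 / X x.1 * cos (ux x).
  by rewrite -[Y x.1 / X x.1]atanK /tan divfK// gt_eqF.
have [j|j] := boolP (jx x).
  have cX : cos (ux x) = X x.1.
    by apply/eqP; rewrite -(@eqrXn2 _ 2)// ?cK// ltW.
  apply: Minj; rewrite ?(model_ptX M) ?(model_ptY M) ?cos_base ?sin_base mul1r ?sK ?cX ?divfK//.
have Xn : X x.1 < 0 by rewrite lt_neqAle X0 leNgt.
have cX : cos (ux x) = - X x.1.
  apply/eqP; rewrite -(@eqrXn2 _ 2)// ?sqrrN ?cK// ?oppr_ge0 ltW//.
apply: Minj; rewrite ?(model_ptX M) ?(model_ptY M) ?cos_base ?sin_base mulN1r ?sK ?cX ?opprK//.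
by rewrite mulrN opprK divfK.
Qed.

Lemma loc_coord_pt j (u r : R) : `|u| < pi / 2 ->
  [/\ X (pt (base j + u)) != 0, jx (pt (base j + u), r) = j & ux (pt (base j + u), r) = u].
Proof.
rewrite ltr_norml => upi; have c0 := cos_gt0_pihalf upi.
have XE : X (pt (base j + u)) = (if j then 1 else -1) * cos u.
  by rewrite (model_ptX M) cos_base.
have YE : Y (pt (base j + u)) = (if j then 1 else -1) * sin u.
  by rewrite (model_ptY M) sin_base.
split.
- by rewrite XE mulf_neq0 ?(gt_eqF c0)//; case: (j); rewrite ?oppr_eq0 oner_eq0.
- by rewrite /jx /= XE; case: (j); rewrite ?mul1r ?mulN1r// oppr_gt0 ltNge ltW.
- rewrite /ux /= XE YE -mulf_div divff ?mul1r; last by case: (j); rewrite ?oppr_eq0 oner_eq0.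
  by rewrite -[sin u / cos u]/(tan u) tanK// in_itv.
Qed.

Definition nearH (d : R) x := [/\ X x.1 != 0, `|ux x| < d & `|x.2| < d].

(** The cone estimates hold for differences of points because the derivatives are strict. *)
Lemma local_cone : exists d kap : R, [/\ 0 < d, d < 1, 1 < kap &
  forall x z, nearH d x -> nearH d z -> jx x = jx z ->
    [/\ X (f x).1 != 0 /\ X (f z).1 != 0,
        jx (f x) = ~~ jx x /\ jx (f z) = ~~ jx z,
        0 <= ux x - ux z -> x.2 - z.2 <= 0 ->
          kap * (ux x - ux z) <= ux (f x) - ux (f z)
      & 0 <= ux (f x) - ux (f z) -> 0 <= (f x).2 - (f z).2 ->
        [/\ 0 <= ux x - ux z, 0 <= x.2 - z.2 &
          kap * ((ux (f x) - ux (f z)) + ((f x).2 - (f z).2)) <=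
            (ux x - ux z) + (x.2 - z.2)]]].
Proof.
have [et et0 Ht] := hyperbolic_cone P1 Q0 T0 PQT (l01 true).
have [ef ef0 Hf] := hyperbolic_cone P1 Q0 T0 PQT (l01 false).
pose e := Num.min et ef.
have e0 : 0 < e by rewrite lt_min et0.
have pi0 := @pi_gt0 R.
have small : \forall p \near ((0 : R), (0 : R)), `|loc1 p| < pi / 2.
  have := lip_cvg (strict_lip strict_loc1); rewrite loc1_0 => /cvgr0_norm_lt; apply.
  by rewrite divr_gt0.
have small' := near_fst ((0 : R), (0 : R)) small.
have small'' := near_snd ((0 : R), (0 : R)) small.
have := filterI (filterI (strict_loc1 e0) (filterI (@strict_loc2 true _ e0) (@strict_loc2 false _ e0)))
  (filterI small' small'').
move=> N; have [d0 /= d00 B] := (@nbhs_ballP R ((R * R) * (R * R))%type ((0, 0), (0, 0)) _).1 (N _ _ _ _).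
have [d [dd d1 dd0]] : exists d, [/\ 0 < d, d < 1 & d <= d0].
  exists (Num.min d0 (1 / 2)); split; rewrite ?lt_min ?ge_min ?lexx ?d00//=.
  by rewrite gt_min; apply/orP; right; lra.
exists d, ((1 + P) / 2); split => //; first by have := P1; lra.
move=> x z [Xx ux1 rx] [Xz uz1 rz] jxz.
have bx : ball ((0 : R), (0 : R)) d0 (ux x, x.2).
  by split; rewrite /ball/= sub0r normrN; apply: lt_le_trans dd0.
have bz : ball ((0 : R), (0 : R)) d0 (ux z, z.2).
  by split; rewrite /ball/= sub0r normrN; apply: lt_le_trans dd0.
have [[B1 [Bt Bf]] [Bs1 Bs2]] := B ((ux x, x.2), (ux z, z.2)) (conj bx bz).
have xE : x = (pt (base (jx x) + ux x), x.2).
  by rewrite -loc_coord// -surjective_pairing.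
have zE : z = (pt (base (jx z) + ux z), z.2).
  by rewrite -loc_coord// -surjective_pairing.
have fx : f x = (pt (base (~~ jx x) + loc1 (ux x, x.2)), loc2 (jx x) (ux x, x.2)).
  by rewrite {1}xE local_step//; apply: lt_trans d1.
have fz : f z = (pt (base (~~ jx z) + loc1 (ux z, z.2)), loc2 (jx z) (ux z, z.2)).
  by rewrite {1}zE local_step//; apply: lt_trans d1.
have [X1 j1 u1] := loc_coord_pt (~~ jx x) (loc2 (jx x) (ux x, x.2)) Bs1.
have [X2 j2 u2] := loc_coord_pt (~~ jx z) (loc2 (jx z) (ux z, z.2)) Bs2.
have AL : almost_linear P Q T (l (jx x)) e (ux (f x) - ux (f z)) ((f x).2 - (f z).2)
    (ux x - ux z) (x.2 - z.2).
  rewrite fx fz u1 u2 /=; split.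
    by move: B1; rewrite prod_normE /= mulNr.
  have BB : `|loc2 (jx x) (ux x, x.2) - loc2 (jx x) (ux z, z.2) -
    (l (jx x) * - T * (ux x - ux z) + l (jx x) * P * (x.2 - z.2))| <=
    e * `|(ux x, x.2) - (ux z, z.2)| by move: Bt Bf; case: (jx x).
  move: BB; rewrite -jxz prod_normE /=; congr (`| _ | <= _); ring.
have C : (0 <= ux x - ux z -> x.2 - z.2 <= 0 -> (1 + P) / 2 * (ux x - ux z) <= ux (f x) - ux (f z)) /\
  (0 <= ux (f x) - ux (f z) -> 0 <= (f x).2 - (f z).2 ->
     [/\ 0 <= ux x - ux z, 0 <= x.2 - z.2 &
      P * ((ux (f x) - ux (f z)) + ((f x).2 - (f z).2)) <= (ux x - ux z) + (x.2 - z.2)]).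
  move: AL; case: (jx x) => AL; [apply: (Ht e)|apply: (Hf e)] => //.
    by rewrite ge_min lexx.
  by rewrite ge_min lexx orbT.
split; [by rewrite fx fz|by rewrite {1}fx {1}fz j1 j2|exact: (proj1 C)|].
move=> h1 h2; have [g1 g2 g3] := proj2 C h1 h2; split => //.
have h3 := addr_ge0 h1 h2; apply: le_trans g3; apply: ler_wpM2r => //.
by rewrite ler_pdivrMr// mulrDr mulr1 addrC lerD2l ltW//; exact: P1.
Qed.

Let orbit_sum (d kap : R) y w : d < 1 -> 1 < kap ->
  (forall n, nearH d (y n)) -> (forall n, nearH d (w n)) ->
  (forall n, 0 <= ux (y n) - ux (w n) -> 0 <= (y n).2 - (w n).2 ->
    [/\ 0 <= ux (y n.+1) - ux (w n.+1), 0 <= (y n.+1).2 - (w n.+1).2 &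
      kap * ((ux (y n) - ux (w n)) + ((y n).2 - (w n).2)) <=
      (ux (y n.+1) - ux (w n.+1)) + ((y n.+1).2 - (w n.+1).2)]) ->
  forall n, 0 <= ux (y n) - ux (w n) -> 0 <= (y n).2 - (w n).2 ->
    ux (y n) = ux (w n) /\ (y n).2 = (w n).2.
Proof.
move=> d1 k1 Ny Nw; pose Du n := ux (y n) - ux (w n); pose Dr n := (y n).2 - (w n).2.
move=> C n u0 r0.
suff S : Du n + Dr n <= 0 by rewrite /Du /Dr in S; split; lra.
rewrite leNgt; apply/negP => S0.
have bd m : `|Du m + Dr m| <= 4.
  have [_ h1 h2] := Ny m; have [_ h3 h4] := Nw m.
  have := ler_normD (Du m) (Dr m); have := ler_normB (ux (y m)) (ux (w m)).
  have := ler_normB (y m).2 (w m).2; rewrite /Du /Dr; lra.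
(* the sum of the two coordinates of the difference grows at least linearly *)
have G k : [/\ 0 <= Du (n + k)%N, 0 <= Dr (n + k)%N &
    (Du n + Dr n) + k%:R * ((kap - 1) * (Du n + Dr n)) <= Du (n + k)%N + Dr (n + k)%N].
  elim: k => [|k [g1 g2 g3]]; first by rewrite addn0 mul0r addr0.
  have [h1 h2 h3] := C (n + k)%N g1 g2; rewrite addnS; split => //.
  apply: le_trans h3; rewrite -natr1 mulrDl mul1r addrA.
  have h4 : 0 <= k%:R * ((kap - 1) * (Du n + Dr n)).
    by rewrite mulr_ge0// mulr_ge0 ?(ltW S0)// subr_ge0 ltW.
  have h5 : Du n + Dr n <= Du (n + k)%N + Dr (n + k)%N by lra.
  have h6 : (kap - 1) * (Du n + Dr n) <= (kap - 1) * (Du (n + k)%N + Dr (n + k)%N).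
    by rewrite ler_wpM2l// subr_ge0 ltW.
  rewrite /Du /Dr in g3 h6 *; lra.
have S1 : 0 < (kap - 1) * (Du n + Dr n) by rewrite mulr_gt0// subr_gt0.
pose k := (Num.truncn (4 / ((kap - 1) * (Du n + Dr n)))).+1.
have kk : 4 < k%:R * ((kap - 1) * (Du n + Dr n)).
  by rewrite -ltr_pdivrMr//; exact: truncnS_gt.
have [_ _ g3] := G k; have := bd (n + k)%N; have := ler_norm (Du (n + k)%N + Dr (n + k)%N); lra.
Qed.

(** The difference of two backward orbits cannot enter the quadrant of equal signs, which is expanded in
    backward time while the orbits stay bounded.  So the coordinates of the difference have
    opposite signs for ever, and this quadrant is contracted in backward time. *)
Lemma borbit_pair : exists d kap : R, [/\ 0 < d, d < 1, 1 < kap, forall x, nearH d x -> jx (f x) = ~~ jx x &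
  forall x z y w, borbit x y -> borbit z w ->
    (forall n, nearH d (y n)) -> (forall n, nearH d (w n)) -> jx x = jx z ->
    [/\ forall n, jx (y n) = jx (w n), ux x = ux z -> x = z
      & ux z < ux x -> ux (w 1%N) < ux (y 1%N) /\
          kap * (ux (y 1%N) - ux (w 1%N)) <= ux x - ux z]].
Proof.
have [d [kap [d0 d1 k1 H]]] := local_cone.
have k0 : 0 < kap by rewrite (lt_trans _ k1).
have jE u : nearH d u -> jx (f u) = ~~ jx u.
  by move=> Nu; have [_ [-> _] _ _] := H u u Nu Nu erefl.
exists d, kap; split => //.
have jj x z y w : borbit x y -> borbit z w ->
    (forall n, nearH d (y n)) -> (forall n, nearH d (w n)) -> jx x = jx z ->
    forall n, jx (y n) = jx (w n).
  move=> [y0 hy] [w0' hw] Ny Nw jxz; elim=> [|n IH]; first by rewrite y0 w0'.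
  have e1 := jE _ (Ny n.+1); have e2 := jE _ (Nw n.+1).
  rewrite (proj2 (hy n)) in e1; rewrite (proj2 (hw n)) in e2.
  by apply: negb_inj; rewrite -e1 -e2.
have ne x z y w : borbit x y -> borbit z w ->
    (forall n, nearH d (y n)) -> (forall n, nearH d (w n)) -> jx x = jx z ->
    forall n, 0 <= ux (y n) - ux (w n) -> 0 <= (y n).2 - (w n).2 ->
    ux (y n) = ux (w n) /\ (y n).2 = (w n).2.
  move=> by_ bw Ny Nw jxz; apply: (orbit_sum d1 k1 Ny Nw) => n.
  have [_ _ _] := H _ _ (Ny n.+1) (Nw n.+1) (jj _ _ _ _ by_ bw Ny Nw jxz n.+1).
  by rewrite (proj2 (by_.2 n)) (proj2 (bw.2 n)).
move=> x z y w by_ bw Ny Nw jxz.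
have j := jj _ _ _ _ by_ bw Ny Nw jxz.
have n1 := ne _ _ _ _ by_ bw Ny Nw jxz.
have n2 := ne _ _ _ _ bw by_ Nw Ny (esym jxz).
have eqn n : ux (y n) = ux (w n) -> (y n).2 = (w n).2 -> x = z.
  move=> eu er; have e : y n = w n.
    have [X1 _ _] := Ny n; have [X2 _ _] := Nw n.
    by rewrite [LHS]surjective_pairing [RHS]surjective_pairing er
      (loc_coord X1) (loc_coord X2) eu (j n).
  have : forall k, (k <= n)%N -> y (n - k)%N = w (n - k)%N.
    elim=> [|k IH] kn; first by rewrite subn0.
    have := IH (ltnW kn); rewrite -(subnSK kn) => e'.
    by rewrite -(proj2 (by_.2 _)) e' (proj2 (bw.2 _)).
  by move=> /(_ n (leqnn n)); rewrite subnn (proj1 by_) (proj1 bw).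
split => //.
  move=> eu; have [r0|r0] := leP 0 ((y 0%N).2 - (w 0%N).2).
    have [|h1 h2] := n1 0%N _ r0; first by rewrite (proj1 by_) (proj1 bw) eu subrr.
    exact: eqn h1 h2.
  have [||h1 h2] := n2 0%N; first by rewrite (proj1 by_) (proj1 bw) eu subrr.
    lra.
  exact: eqn (esym h1) (esym h2).
move=> ult.
have xz : x <> z by move=> e; rewrite e ltxx in ult.
have [_ _ h1 _] := H _ _ (Ny 1%N) (Nw 1%N) (j 1%N).
have [_ _ h2 _] := H _ _ (Nw 1%N) (Ny 1%N) (esym (j 1%N)).
rewrite (proj2 (by_.2 0%N)) (proj2 (bw.2 0%N)) (proj1 by_) (proj1 bw) in h1 h2.
have m1 := n1 1%N; have m2 := n2 1%N.
have e1 := @eqn 1%N.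
case: (leP 0 (ux (y 1%N) - ux (w 1%N))) => u1; case: (leP 0 ((y 1%N).2 - (w 1%N).2)) => r1.
- by case: xz; have [g1 g2] := m1 u1 r1; exact: e1.
- have h3 := h1 u1 (ltW r1); split => //.
  rewrite -subr_gt0 lt_neqAle u1 andbT eq_sym; apply/eqP => u2.
  have [||g1 g2] := m2; [lra|lra|by case: xz; apply: e1].
- have : kap * (ux (w 1%N) - ux (y 1%N)) <= ux z - ux x by apply: h2; lra.
  have : 0 <= kap * (ux (w 1%N) - ux (y 1%N)).
    by rewrite mulr_ge0 ?(ltW k0)//; lra.
  lra.
- have [||g1 g2] := m2; [lra|lra|by case: xz; apply: e1].
Qed.

End Local.

(** * The attractor near the saddle is a graph *)

Section Graph.
Context (R : realType) (a b : R) (X Y : circle R -> R) (pt : R -> circle R)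
    (lam : circle R * R -> R) (f : circle R * R -> circle R * R).
Hypothesis M : ellipse_model a b X Y pt lam f.

Let b0 := model_b0 M.
Let ba := model_ba M.
Let a0 : 0 < a. Proof. exact: lt_trans ba. Qed.
Let XY1 := model_unit M.
Let Minj := model_inj M.
Local Notation A := (annulus (R := R)).
Local Notation en := (chord_energy a b X Y).
Local Notation axis_points := (axis_points X Y).
Local Notation borbit := (backward_orbit f).
Local Notation att := (attractor f).
Local Notation base := (base R).
Local Notation ux := (axis_angle X Y).
Local Notation jx := (right_half X).
Local Notation nearH := (nearH X Y).
Implicit Types (x z : circle R * R) (s : circle R) (r : R) (y : nat -> circle R * R).

Let hT : hausdorff_space (circle R * R)%type :=
  cylinder_hausdorff (model_X M) (model_Y M) (model_inj M).
Let c20 : 0 < a ^+ 2 - b ^+ 2. Proof. by rewrite subr_gt0 ltr_sqr ?nnegrE// ltW. Qed.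

Lemma attA x : att x -> A x.
Proof. by move=> /(_ 0%N I) [z Az <-]. Qed.

Lemma en_le_speed x : en x <= b ^+ 2 + (a ^+ 2 - b ^+ 2) * Y x.1 ^+ 2.
Proof.
rewrite -(sqspeedE a b (XY1 x.1)) /chord_energy /energy ler_piMr// ?gerBl ?sqr_ge0//.
exact/ltW/sqspeed_gt0.
Qed.

Let sq_small (u e : R) : 0 < e -> u ^+ 2 < e ^+ 2 -> `|u| < e.
Proof.
by move=> e0; rewrite -(real_normK (num_real u)) ltr_pXn2r// ?nnegrE//; exact: ltW.
Qed.

Let near_of_small (d : R) : 0 < d -> exists2 e : R, 0 < e &
  forall x, Y x.1 ^+ 2 + x.2 ^+ 2 < e ^+ 2 -> nearH d x.
Proof.
move=> d0; have : atan u @[u --> (0 : R)] --> atan (0 : R) := @continuous_atan R 0; rewrite atan0 => /cvgr0_norm_lt.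
move=> /(_ d d0) /nbhs_ballP[d1 /= d10 B].
have [e [e0 ed e1 e2]] : exists e : R, [/\ 0 < e, e <= d, e <= 1 / 2 & 2 * e <= d1].
  exists (Num.min d (Num.min (1 / 2) (d1 / 2))).
  split; rewrite ?lt_min ?ge_min ?lexx ?orbT//.
    by rewrite d0 divr_gt0//= divr_gt0.
  by rewrite mulrC -ler_pdivlMr// !ge_min lexx !orbT.
exists e => // x small.
have Yr := sqr_ge0 (Y x.1); have rr := sqr_ge0 x.2.
have Ye : `|Y x.1| < e by apply: sq_small => //; lra.
have re : `|x.2| < e by apply: sq_small => //; lra.
have e4 : e ^+ 2 <= (1 / 2) ^+ 2 by apply: lerXn2r; rewrite ?nnegrE; lra.
have Xe : (1 / 2) ^+ 2 < `|X x.1| ^+ 2.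
  have := XY1 x.1; rewrite real_normK ?num_real// => h; move: e4; rewrite expr2; lra.
have Xh : 1 / 2 < `|X x.1| by move: Xe; rewrite ltr_pXn2r// ?nnegrE//; lra.
have X0 : X x.1 != 0 by rewrite -normr_gt0; lra.
split => //; last exact: lt_le_trans ed.
apply: B; rewrite /ball/= sub0r normrN normrM normfV.
rewrite ltr_pdivrMr; last by rewrite normr_gt0.
apply: lt_le_trans Ye _; apply: le_trans (_ : d1 * (1 / 2) <= _); first by lra.
by rewrite ler_wpM2l// ltW.
Qed.

(** On the part of the attractor away from the ends of the major axis the energy is bounded below by some
    m > b^2, and the energy decreases along backward orbits.  Points whose vertical is close to
    an end of the axis have energy below m, whatever their r. *)
Lemma orbit_trap j (d : R) : 0 < d -> exists2 eps : R, 0 < eps & eps < pi / 2 /\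
  forall t x, `|t| <= eps -> att x -> x.1 = pt (base j + t) ->
    forall y, borbit x y -> forall n, nearH d (y n).
Proof.
move=> d0; have [e e0 He] := near_of_small d0.
pose g x := Y x.1 ^+ 2 + x.2 ^+ 2.
have gc : continuous g.
  move=> x; apply: cvgD; rewrite expr2; under eq_fun do rewrite expr2.
    by apply: cvgM; exact: (Y1_continuous M).
  by apply: cvgM; exact: cvg_snd.
have [m mb Hm] : exists2 m : R, b ^+ 2 < m & forall x, att x -> en x < m -> g x < e ^+ 2.
  pose K := att `&` [set x | e ^+ 2 <= g x].
  have cK : compact K.
    apply: compact_closedI; first exact: (attractor_cpt M).
    by apply: (@closed_comp _ _ g [set u | e ^+ 2 <= u]) => [x _|]; [exact: gc|exact: closed_ge].
  have [[z0 Kz0]|K0] := pselect (K !=set0); last first.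
    exists (b ^+ 2 + 1); first by rewrite ltrDl.
    move=> x ax _; rewrite ltNge; apply/negP => h; apply: K0; by exists x.
  have [z /set_mem[az gz] zmin] := compact_EVT_min (ex_intro _ z0 Kz0) cK
    (continuous_subspaceT (en_continuous M)).
  exists (en z).
    have [h1 h2] := attractor_en M az; rewrite lt_neqAle h1 andbT eq_sym; apply/eqP => /h2[Y0 r0].
    by move: gz; rewrite /= /g Y0 r0 expr0n/= addr0 leNgt exprn_gt0.
  move=> x ax; apply: contraTT; rewrite -!leNgt => gx.
  by apply: zmin; apply/mem_set.
have : sin u @[u --> (0 : R)] --> sin (0 : R) := @continuous_sin R 0; rewrite sin0 => /cvgr0_norm_lt.
pose h : R := Num.min 1 ((m - b ^+ 2) / (a ^+ 2 - b ^+ 2)).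
have h0 : 0 < h by rewrite lt_min ltr01 divr_gt0// subr_gt0.
move=> /(_ h h0) /nbhs_ballP[d1 /= d10 B].
have pi0 := @pi_gt0 R.
exists (Num.min (d1 / 2) (pi / 4)); first by rewrite lt_min !divr_gt0.
split; first by rewrite gt_min; apply/orP; right; lra.
move=> t x tle ax xt y by_ n; apply: He; apply: (Hm _ (borbit_attractor n by_)).
apply: (le_lt_trans (borbit_en_le M by_ (leq0n n))); rewrite (proj1 by_).
apply: le_lt_trans (en_le_speed x) _; rewrite xt (proj2 (base_XY M _ _)) exprMn.
have -> : (if j then 1 else -1 : R) ^+ 2 = 1 by case: (j); rewrite ?sqrrN expr1n.
have td : `|sin t| < h.
  apply: B; rewrite /ball/= sub0r normrN; apply: le_lt_trans tle _.
  by rewrite gt_min ltr_pdivrMr// mulr_natr mulr2n ltrDl d10.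
rewrite mul1r -ltrBrDl mulrC -ltr_pdivlMr//.
have h1 : `|sin t| < 1 by apply: lt_le_trans td _; rewrite /h ge_min lexx.
have h2 : `|sin t| < (m - b ^+ 2) / (a ^+ 2 - b ^+ 2).
  by apply: lt_le_trans td _; rewrite /h ge_min lexx orbT.
rewrite -(real_normK (num_real (sin t))) expr2; apply: le_lt_trans h2.
by rewrite ler_piMl// ltW.
Qed.

(** Existence on each vertical comes from [vertical_meets], for both sides, and uniqueness from
    [borbit_pair]; hence the point is in the closure of both sides, and it depends
    continuously on the vertical by compactness of the attractor. *)
Lemma unstable_graph j : exists (eps kap : R) (W : R -> circle R * R) (q : R -> R),
  [/\ 0 < eps < pi / 2, 1 < kap,
    [/\ forall t, `|t| <= eps -> att (W t) /\ (W t).1 = pt (base j + t),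
        forall t x, `|t| <= eps -> att x -> x.1 = pt (base j + t) -> x = W t,
        forall t c, `|t| <= eps -> closure (side lam f c) (W t),
        W 0 = (pt (base j), 0)
      & {within [set t | `|t| <= eps], continuous W}],
    q 0 = 0 /\ (forall t, `|t| <= eps -> f (f (W (q t))) = W t)
  & forall t t', - eps <= t -> t < t' -> t' <= eps -> 0 < q t' - q t <= (t' - t) / kap].
Proof.
have [d [kap [d0 d1 k1 jE pair]]] := borbit_pair M.
have k0 : 0 < kap by rewrite (lt_trans _ k1).
have [eps eps0 [epi trap]] := orbit_trap j d0.
have pi0 := @pi_gt0 R.
have tpi (t : R) : `|t| <= eps -> `|t| < pi / 2 by move=> h; exact: le_lt_trans epi.
have coord t x : `|t| <= eps -> x.1 = pt (base j + t) -> jx x = j /\ ux x = t.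
  move=> te xt; have [_ h1 h2] := loc_coord_pt M j x.2 (tpi _ te).
  by rewrite -xt -surjective_pairing in h1 h2.
have uniq t x z : `|t| <= eps -> att x -> att z -> x.1 = pt (base j + t) ->
    z.1 = pt (base j + t) -> x = z.
  move=> te ax az xt zt; have [y by_] := attractor_borbit M ax; have [w bw] := attractor_borbit M az.
  have [jx1 ux1] := coord _ _ te xt; have [jz uz] := coord _ _ te zt.
  have [_ h _] := pair _ _ _ _ by_ bw (trap _ _ te ax xt _ by_) (trap _ _ te az zt _ bw)
    (etrans jx1 (esym jz)).
  by apply: h; rewrite ux1.
have : forall t : R, exists x, `|t| <= eps -> att x /\ x.1 = pt (base j + t).
  move=> t; have [r [h _]] := vertical_meets M true (pt (base j + t)).
  by exists (pt (base j + t), r).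
move=> /choice[W HW].
have W1 t : `|t| <= eps -> (W t).1 = pt (base j + t) by move=> /HW[].
have Wa t : `|t| <= eps -> att (W t) by move=> /HW[].
have W0 : W 0 = (pt (base j), 0).
  have n0 : `|0 : R| <= eps by rewrite normr0 ltW.
  apply: (@uniq 0); rewrite ?addr0//; [exact: Wa| |by rewrite W1// addr0].
  apply: (axis_attractor M); split => //=.
  by rewrite -[base j]addr0 (proj1 (base_XY M _ _)) (proj2 (base_XY M _ _)) sin0 !mulr0.
have WE t x : `|t| <= eps -> att x -> x.1 = pt (base j + t) -> x = W t.
  by move=> te ax xt; apply: (uniq t) => //; [exact: Wa|exact: W1].
have a0p : axis_points (W 0).
  rewrite W0; split => //=.
  by rewrite -[base j]addr0 (proj1 (base_XY M _ _)) (proj2 (base_XY M _ _)) sin0 !mulr0.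
have n0 : `|0 : R| <= eps by rewrite normr0 ltW.
have step t t' y y' : `|t| <= eps -> `|t'| <= eps -> borbit (W t) y -> borbit (W t') y' -> t < t' ->
    0 < ux (y' 2%N) - ux (y 2%N) <= (t' - t) / kap.
  move=> te te' by_ by' tt'.
  have [j1 u1] := coord _ _ te (W1 _ te); have [j2 u2] := coord _ _ te' (W1 _ te').
  have N1 := trap _ _ te (Wa _ te) (W1 _ te) _ by_.
  have N2 := trap _ _ te' (Wa _ te') (W1 _ te') _ by'.
  have [jj _ h1] := pair _ _ _ _ by' by_ N2 N1 (etrans j2 (esym j1)).
  have [|g1 g2] := h1; first by rewrite u1 u2.
  have bs : borbit (y 1%N) (fun n => y n.+1) by split => // n; exact: (proj2 by_).
  have bs' : borbit (y' 1%N) (fun n => y' n.+1) by split => // n; exact: (proj2 by').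
  have [_ _ h2] := pair _ _ _ _ bs' bs (fun n => N2 n.+1) (fun n => N1 n.+1) (jj 1%N).
  have [g3 g4] := h2 g1.
  rewrite subr_gt0 g3 /= ler_pdivlMr// mulrC; apply: le_trans g4 _.
  rewrite u1 u2 in g2; apply: le_trans g2; rewrite ler_peMl ?(ltW k1)// subr_ge0 ltW//.
have back0 y : borbit (W 0) y -> y 2%N = W 0.
  move=> [y0 hy]; have [A1 f2] := hy 1%N; have [_ f1] := hy 0%N; have [A2 _] := hy 2%N.
  have Af := fA M (axisA a0p); rewrite y0 in f1.
  by apply: (f_inj M A2 (axisA a0p)); rewrite f2; apply: (f_inj M A1 Af); rewrite f1 (axis_ff M).
have two t y : `|t| <= eps -> borbit (W t) y ->
    [/\ `|ux (y 2%N)| <= eps, W (ux (y 2%N)) = y 2%N & f (f (W (ux (y 2%N)))) = W t].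
  move=> te by_; have N := trap _ _ te (Wa _ te) (W1 _ te) _ by_.
  have b0' : borbit (W 0) (fun n => iter n f (W 0)).
    have an n : axis_points (iter n f (W 0)) by elim: n => //= n; exact: (axis_faxis M).
    by split => // n; split; [exact: axisA (an n)|exact: (axis_ff M (an n))].
  have u2 : ux (iter 2 f (W 0)) = 0.
    by rewrite /= (axis_ff M a0p); have [_] := coord 0 (W 0) n0 (W1 _ n0).
  have ule : `|ux (y 2%N)| <= eps.
    have [t0|t0|t0] := ltgtP t 0.
    - have := step _ _ _ _ te n0 by_ b0' t0; rewrite u2 !sub0r oppr_gt0 => /andP[h1 h2].
      rewrite ltr0_norm//; apply: le_trans h2 _; rewrite ler_pdivrMr//.
      rewrite ltr0_norm// in te; apply: le_trans te _; rewrite ler_peMr ?(ltW k1)//; exact: ltW.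
    - have := step _ _ _ _ n0 te b0' by_ t0; rewrite u2 !subr0 => /andP[h1 h2].
      rewrite gtr0_norm//; apply: le_trans h2 _; rewrite ler_pdivrMr//.
      rewrite gtr0_norm// in te; apply: le_trans te _; rewrite ler_peMr ?(ltW k1)//; exact: ltW.
    - rewrite t0 in by_; rewrite (back0 _ by_).
      by have [_ ->] := coord 0 (W 0) n0 (W1 _ n0); rewrite normr0 ltW.
  have [X2 _ _] := N 2%N.
  have j2 : jx (y 2%N) = j.
    have [j0 _] := coord _ _ te (W1 _ te).
    have h1 := jE _ (N 2%N); have h2 := jE _ (N 1%N).
    rewrite (proj2 (proj2 by_ 1%N)) in h1; rewrite (proj2 (proj2 by_ 0%N)) (proj1 by_) j0 in h2.
    by apply: negb_inj; rewrite -h1; apply: negb_inj; rewrite negbK.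
  have e : W (ux (y 2%N)) = y 2%N.
    apply/esym/WE => //; first exact: (borbit_attractor 2 by_).
    by rewrite -j2; exact: (loc_coord M X2).
  by split => //; rewrite e (proj2 (proj2 by_ 1%N)) (proj2 (proj2 by_ 0%N)) (proj1 by_).
have : forall t : R, exists y, `|t| <= eps -> borbit (W t) y.
  move=> t; have [te|te] := pselect (`|t| <= eps); last by exists (fun=> W t).
  by have [y by_] := attractor_borbit M (Wa _ te); exists y.
move=> /choice[y Hy].
exists eps, kap, W, (fun t => ux (y t 2%N)); split => //.
- by rewrite eps0.
- split => //.
  + move=> t c te; have [r [h1 h2]] := vertical_meets M c (pt (base j + t)).
    by rewrite -(@WE t (pt (base j + t), r)).
  + apply/subspace_continuousP => t /= te.
    have PF : ProperFilter (within [set t | `|t| <= eps] (nbhs t)).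
      by apply: within_nbhs_proper; exact: subset_closure.
    have FK : ((W u) @[u --> within [set t | `|t| <= eps] (nbhs t)]) att.
      by apply: filterS (withinT _ _) => u /= ue; exact: Wa.
    apply: (compact_cvg (K := att)) => //; first exact: (attractor_cpt M).
    move=> z az cz; apply: WE => //.
    have E u : `|u| <= eps -> (W u).1 = pt (base j + u) := @W1 u.
    have cpt : pt (base j + u) @[u --> within [set t | `|t| <= eps] (nbhs t)] --> pt (base j + t).
      apply: cvg_within_filter; apply: (cvg_comp (fun u => base j + u) pt).
        by apply: cvgD; [exact: cvg_cst|exact: cvg_id].
      exact: (model_pt M).
    have cg (g : circle R -> R) : continuous g -> g z.1 = g (pt (base j + t)).
      move=> gc; have gc' : continuous (fun x : circle R * R => g x.1).
        by move=> x; apply: (cvg_comp fst g); [exact: cvg_fst|exact: gc].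
      have c1 : g (W u).1 @[u --> within [set t | `|t| <= eps] (nbhs t)] --> g (pt (base j + t)).
        have c2 := cvg_comp _ _ cpt (gc (pt (base j + t))).
        move=> B /c2 nB; move: nB.
        by apply: (@filterS _ (nbhs t)) => u uB ue; rewrite /= E//; exact: uB.
      apply: (@cluster_image _ _ att _ (fun x => g x.1) z _ (@Rhausdorff R)
        (continuous_subspaceT gc') _ FK az cz).
        exact: c1.
    apply: Minj; apply: cg; [exact: (model_X M)|exact: (model_Y M)].
- split.
    by rewrite (back0 _ (Hy 0 n0)); have [_ ->] := coord 0 (W 0) n0 (W1 _ n0).
  by move=> t te; have [] := two _ _ te (Hy t te).
- move=> t t' h1 h2 h3.
  have te : `|t| <= eps by rewrite ler_norml h1 (le_trans (ltW h2)).
  have te' : `|t'| <= eps by rewrite ler_norml h3 (le_trans h1 (ltW h2)).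
  exact: step te te' (Hy _ te) (Hy _ te') h2.
Qed.

End Graph.

(** * The unstable set as a curve *)

Section Extend.
Context (R : realType) (eps kap : R) (q : R -> R).
Hypotheses (eps0 : 0 < eps) (k1 : 1 < kap) (q0 : q 0 = 0).
Hypothesis qinc : forall t t', - eps <= t -> t < t' -> t' <= eps -> 0 < q t' - q t <= (t' - t) / kap.

Let k0 : 0 < kap. Proof. exact: lt_trans k1. Qed.
Definition clamp (t : R) : R := if t < - eps then - eps else if eps < t then eps else t.
(** The extension has slope 1 / kap outside the interval, so it keeps the contraction and becomes onto. *)
Definition extend (t : R) : R := q (clamp t) + (t - clamp t) / kap.

Lemma clamp_id t : `|t| <= eps -> clamp t = t.
Proof.
rewrite ler_norml => /andP[h1 h2]; rewrite /clamp; case: ifP => h3; first by lra.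
by case: ifP => h4 //; lra.
Qed.

Lemma clamp_le t : - eps <= clamp t <= eps.
Proof.
have e0 := eps0; rewrite /clamp; case: ltP => h1; first by rewrite lexx /=; lra.
by case: ltP => h2; apply/andP; split; lra.
Qed.

Lemma clamp_incr t t' : t < t' -> clamp t <= clamp t' <= clamp t + (t' - t).
Proof.
rewrite /clamp => h; have e0 := eps0.
case: (ltP t) => h1; case: (ltP t') => h2;
  case: (ltP eps t) => h3; case: (ltP eps t') => h4; apply/andP; split; lra.
Qed.

Lemma extend_id t : `|t| <= eps -> extend t = q t.
Proof. by move=> h; rewrite /extend clamp_id// subrr mul0r addr0. Qed.

Lemma extend0 : extend 0 = 0.
Proof. by rewrite extend_id ?normr0 ?(ltW eps0). Qed.

Lemma extend_incr t t' : t < t' -> 0 < extend t' - extend t <= (t' - t) / kap.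
Proof.
move=> tt'; have /andP[c1 c2] := clamp_incr tt'.
have /andP[l1 l2] := clamp_le t; have /andP[l3 l4] := clamp_le t'.
have kV : 0 < kap^-1 by rewrite invr_gt0.
rewrite /extend; have [e|n] := eqVneq (clamp t) (clamp t').
  have h : 0 < (t' - t) / kap by rewrite divr_gt0 ?subr_gt0.
  by rewrite e; apply/andP; split; lra.
have lt : clamp t < clamp t' by rewrite lt_neqAle n.
have /andP[h1 h2] := qinc l1 lt l4.
have h3 : 0 <= (t' - t - (clamp t' - clamp t)) / kap by rewrite divr_ge0 ?(ltW k0)//; lra.
by apply/andP; split; lra.
Qed.

Lemma extend_dist t t' : `|extend t' - extend t| <= `|t' - t| / kap.
Proof.
wlog tt' : t t' / t < t'.
  move=> h; case: (ltgtP t t') => [|h1|->]; first exact: h.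
    by rewrite distrC (distrC t'); exact: h.
  by rewrite !subrr normr0 mul0r.
have /andP[h1 h2] := extend_incr tt'.
by rewrite gtr0_norm// gtr0_norm// subr_gt0.
Qed.

Lemma extend_continuous : continuous extend.
Proof.
move=> t; apply/cvgrPdist_lt => e e0.
apply: (@filterS _ (nbhs t) _ (ball t e)); last exact: nbhsx_ballx.
move=> u tu; apply: le_lt_trans (extend_dist _ _) _; rewrite ltr_pdivrMr//.
by apply: (@lt_trans _ _ e); last by rewrite ltr_pMr.
Qed.

Lemma iter_extend_continuous n : continuous (iter n extend).
Proof.
elim: n => [|n IH] t; first exact: cvg_id.
by apply: (cvg_comp (iter n extend) extend); [exact: IH|exact: extend_continuous].
Qed.

Lemma iter_extend_incr n t t' : t < t' -> iter n extend t < iter n extend t'.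
Proof.
move=> h; elim: n => //= n IH.
by have /andP[] := extend_incr IH; rewrite subr_gt0.
Qed.

Lemma iter_extend0 n : iter n extend 0 = 0.
Proof. by elim: n => //= n ->; exact: extend0. Qed.

Lemma iter_extend_inj n : injective (iter n extend).
Proof.
move=> t t' e; case: (ltgtP t t') => // /(iter_extend_incr n); rewrite e ltxx//.
Qed.

Lemma iter_extend_le n t : `|iter n extend t| <= `|t| * kap^-1 ^+ n.
Proof.
elim: n => [|n IH]; first by rewrite mulr1.
have := extend_dist 0 (iter n extend t); rewrite extend0 !subr0 => h /=.
apply: le_trans h _; rewrite exprSr mulrA ler_wpM2r// invr_ge0; exact: ltW.
Qed.

Lemma iter_extend_small (B : R) : exists N, forall n t, (N <= n)%N -> `|t| <= B ->
  `|iter n extend t| <= eps.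
Proof.
have kV : `|kap^-1| < 1.
  by rewrite gtr0_norm ?invr_gt0// invf_lt1.
have c : geometric B kap^-1 n @[n --> \oo] --> 0 by exact: cvg_geometric.
have /cvgr0_norm_le/(_ eps eps0)[N _ HN] := c.
exists N => n t Nn tB; apply: le_trans (iter_extend_le _ _) _.
have := HN n Nn; rewrite /geometric /=; apply: le_trans.
apply: le_trans (ler_norm _); rewrite ler_wpM2r// exprn_ge0// invr_ge0; exact: ltW.
Qed.

Lemma extend_surj s : exists t, extend t = s.
Proof.
(* outside the interval the slope is 1 / kap, so at T the value exceeds `|s| *)
pose T := eps + kap * `|s|.
have s0 : 0 <= kap * `|s| by rewrite mulr_ge0// ltW.
have e0 := eps0.
have eT : extend T = q eps + `|s|.
  rewrite /extend /clamp /T; case: ltP => h1; first by lra.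
  case: ltP => h2.
    by rewrite addrAC subrr add0r mulrAC divff ?mul1r// gt_eqF.
  have h : kap * `|s| = 0 by lra.
  rewrite h !addr0 subrr mul0r addr0; move/eqP: h; rewrite mulf_eq0 gt_eqF//= => /eqP ->.
  by rewrite addr0.
have eT' : extend (- T) = q (- eps) - `|s|.
  rewrite /extend /clamp /T; case: ltP => h1.
    by rewrite opprD addrAC subrr add0r mulNr mulrAC divff ?mul1r// gt_eqF.
  have h : kap * `|s| = 0 by lra.
  case: ltP => h2; first by lra.
  rewrite h !addr0 subrr mul0r addr0; move/eqP: h; rewrite mulf_eq0 gt_eqF//= => /eqP ->.
  by rewrite subr0.
have N0 : - eps <= 0 by lra.
have Ne : - eps < 0 by lra.
have /andP[p1 _] := qinc N0 e0 (lexx _).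
have /andP[p2 _] := qinc (lexx _) Ne (ltW e0).
rewrite q0 in p1 p2.
have TT : - T <= T by rewrite /T; lra.
have s1 := ler_norm s; have s2 : - `|s| <= s by rewrite lerNl -normrN; exact: ler_norm.
have [|t _ ts] := IVT TT (continuous_subspaceT extend_continuous) (v := s).
  by rewrite eT eT' ge_min le_max; apply/andP; split; apply/orP; [left|right]; lra.
by exists t.
Qed.

Lemma iter_extend_surj n s : exists t, iter n extend t = s.
Proof.
elim: n s => [|n IH] s; first by exists s.
by have [u us] := extend_surj s; have [t tu] := IH u; exists t; rewrite /= tu.
Qed.

End Extend.

Section Curve.
Context (R : realType) (a b : R) (X Y : circle R -> R) (pt : R -> circle R)
    (lam : circle R * R -> R) (f : circle R * R -> circle R * R).
Hypothesis M : ellipse_model a b X Y pt lam f.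

Let b0 := model_b0 M.
Let ba := model_ba M.
Let XY1 := model_unit M.
Let Minj := model_inj M.
Local Notation A := (annulus (R := R)).
Local Notation en := (chord_energy a b X Y).
Local Notation axis_points := (axis_points X Y).
Local Notation borbit := (backward_orbit f).
Local Notation att := (attractor f).
Local Notation base := (base R).
Local Notation ux := (axis_angle X Y).
Local Notation jx := (right_half X).
Implicit Types (x z : circle R * R) (s : circle R) (r : R) (y : nat -> circle R * R).

Let hT : hausdorff_space (circle R * R)%type :=
  cylinder_hausdorff (model_X M) (model_Y M) (model_inj M).

Lemma fA_iter n x : A x -> A (iter n f x).
Proof. by move=> Ax; elim: n => //= n; exact: (fA M). Qed.

Lemma f_iter_inj n x z : A x -> A z -> iter n f x = iter n f z -> x = z.
Proof. exact: (iter_inj (@fA _ _ _ _ _ _ _ _ M) (@f_inj _ _ _ _ _ _ _ _ M)). Qed.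

Lemma en_iter_le n x : A x -> en x <= en (iter n f x).
Proof.
move=> Ax; elim: n => //= n IH; apply: le_trans IH _; exact: (en_le M (fA_iter n Ax)).
Qed.

Lemma attractor_f x : att x -> att (f x).
Proof.
move=> ax; have [y [y0 hy]] := attractor_borbit M ax.
apply: (@borbit_attractor _ f (f x) (fun n => if n is n'.+1 then y n' else f x) 0%N).
split => // -[|n] /=; last exact: hy.
by split; [apply: (fA M); exact: (attA ax)|rewrite y0].
Qed.

Lemma attractor_iter n x : att x -> att (iter n f x).
Proof. by move=> ax; elim: n => //= n; exact: attractor_f. Qed.

Lemma closure_side_iter c n x : att x -> closure (side lam f c) x ->
  closure (side lam f c) (iter n f x).
Proof.
move=> ax cx; elim: n => //= n; apply: (closure_side_f M); exact: attractor_iter.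
Qed.

(** Each bounce exchanges the upper and the lower half of the ellipse. *)
Lemma halves_iter n x (sg : R) : A x -> b ^+ 2 < en x -> 0 < sg * Y x.1 ->
  0 < sg * Y (iter (2 * n) f x).1.
Proof.
move=> Ax ex sx; elim: n => // n IH.
rewrite mulnS iterD; set z := iter (2 * n) f x; rewrite -/z in IH.
have Az : A z by exact: fA_iter.
have ez : b ^+ 2 < en z by apply: lt_le_trans ex _; exact: en_iter_le.
have h1 := focal_flip M Az ez.
have h2 := focal_flip M (fA M Az) (lt_le_trans ez (en_le M Az)).
have h3 : 0 < (Y (f z).1) ^+ 2.
  rewrite lt_neqAle sqr_ge0 andbT eq_sym sqrf_eq0; apply/eqP => e.
  by rewrite e mul0r ltxx in h2.
have h4 : 0 < Y z.1 ^+ 2.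
  rewrite lt_neqAle sqr_ge0 andbT eq_sym sqrf_eq0; apply/eqP => e.
  by rewrite e mul0r ltxx in h1.
have h5 : 0 < Y z.1 * Y (f (f z)).1.
  rewrite -(pmulr_rgt0 _ h3).
  have -> : Y (f z).1 ^+ 2 * (Y z.1 * Y (f (f z)).1) =
    (Y z.1 * Y (f z).1) * (Y (f z).1 * Y (f (f z)).1) by ring.
  by rewrite nmulr_rgt0.
rewrite -(pmulr_rgt0 _ h4).
have -> : Y z.1 ^+ 2 * (sg * Y (iter 2 f z).1) = (sg * Y z.1) * (Y z.1 * Y (f (f z)).1).
  by rewrite /=; ring.
exact: mulr_gt0.
Qed.

(** By injectivity they coincide with the points of a backward orbit. *)
Lemma backward_iterates_attractor x (p : circle R * R) y : (forall n, A (y n) /\ iter (2 * n) f (y n) = x) ->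
  y n @[n --> \oo] --> p -> forall n, att (y n).
Proof.
move=> hy yp n; have [Ay yx] := hy n.
have ax : att x.
  by apply: (unstable_attractor M (p := p)); split; [case: (hy 0%N) => ? <-|exists y].
have [z bz] := attractor_borbit M ax.
have e := borbit_iter 0 (2 * n) bz; rewrite addn0 (proj1 bz) in e.
have -> : y n = z (2 * n)%N.
  by apply: (@f_iter_inj (2 * n)) => //; [exact: (proj1 (proj2 bz _))|rewrite yx e].
exact: borbit_attractor bz.
Qed.

(** The point f^2n (W (Q^n t)) does not depend on n, as soon as Q^n t is in the domain of W, because
    W semiconjugates q to the inverse of f^2; n can be chosen locally uniformly, which gives
    continuity. *)
Lemma unstable_curve j : exists gam : R -> circle R * R,
  [/\ [/\ continuous gam, injective gam & gam 0 = (pt (base j), 0)],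
    range gam = unstable_set2 f (pt (base j), 0),
    forall t, exists u, f (f (gam t)) = gam u,
    forall t c, closure (side lam f c) (gam t)
  & forall t, t != 0 -> b ^+ 2 < en (gam t) /\
      0 < (if j then 1 else -1) * t * Y (gam t).1].
Proof.
have [eps [kap [W [q [epi k1 [Wp Wu Wc W0 Wcont] [q0 qW] qinc]]]]] := unstable_graph M j.
have /andP[eps0 ep] := epi; have pi0 := @pi_gt0 R.
pose Q := extend eps kap q.
have n0 : `|0 : R| <= eps by rewrite normr0 ltW.
have Wa t : `|t| <= eps -> att (W t) by move=> /Wp[].
have WA t : `|t| <= eps -> A (W t) by move=> /Wa /attA.
have Qle t : `|Q t| <= `|t|.
  have := iter_extend_le eps0 k1 q0 qinc 1 t; rewrite /= expr1 => /le_trans; apply.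
  by rewrite ler_piMr// invf_le1 ?ltW// (lt_trans _ k1).
have Qid t : `|t| <= eps -> Q t = q t by exact: extend_id.
have stable_def t n m : `|iter n Q t| <= eps ->
    `|iter (m + n) Q t| <= eps /\
    iter (2 * (m + n)) f (W (iter (m + n) Q t)) = iter (2 * n) f (W (iter n Q t)).
  move=> h; elim: m => // m [IH1 IH2]; split.
    by apply: le_trans IH1; rewrite addSn iterS; exact: Qle.
  rewrite -IH2 addSn mulnS addnC iterD; congr (iter _ _ _).
  by rewrite /= Qid// qW.
have : forall t, exists x, forall n, `|iter n Q t| <= eps -> x = iter (2 * n) f (W (iter n Q t)).
  move=> t; have [N HN] := iter_extend_small eps0 k1 q0 qinc `|t|.
  have Nt := HN N t (leqnn _) (lexx _).
  exists (iter (2 * N) f (W (iter N Q t))) => n nt.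
  have [_ <-] := stable_def t n N nt; have [_ <-] := stable_def t N n Nt.
  by rewrite addnC.
move=> /choice[gam Hgam].
have gE t : `|t| <= eps -> gam t = W t by move=> h; rewrite (Hgam t 0%N).
have fgam t : f (f (gam (Q t))) = gam t.
  have [N HN] := iter_extend_small eps0 k1 q0 qinc (`|t|).
  have h1 := HN N t (leqnn _) (lexx _); have h2 := HN N.+1 t (leqnSn _) (lexx _).
  rewrite -/Q in h1 h2.
  rewrite (Hgam t N.+1)// (Hgam (Q t) N); last by rewrite -iterSr.
  by rewrite -iterSr mulnS.
have fgamn n t : iter (2 * n) f (gam (iter n Q t)) = gam t.
  elim: n => // n IH; rewrite -[RHS]IH mulnS addnC iterD; congr (iter _ _ _).
  by rewrite /= fgam.
have gam0 : gam 0 = (pt (base j), 0) by rewrite gE.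
have gamW t : exists2 n, `|iter n Q t| <= eps & gam t = iter (2 * n) f (W (iter n Q t)).
  have [N HN] := iter_extend_small eps0 k1 q0 qinc (`|t|).
  by exists N; [exact: HN|apply: Hgam; exact: HN].
have gama t : att (gam t).
  by have [n h ->] := gamW t; apply: attractor_iter; exact: Wa.
have gcont : continuous gam.
  move=> t; have [N HN] := iter_extend_small eps0 k1 q0 qinc (`|t| + 1).
  pose D := [set u : R | `|u| <= eps].
  have near1 : \forall u \near t, D (iter N Q u).
    apply: (@filterS _ (nbhs t) _ (ball t 1)); last exact: nbhsx_ballx.
    move=> u tu; apply: HN => //; have := ler_distD t u 0; rewrite !subr0.
    move: tu; rewrite /ball/= distrC; lra.
  pose G u := iter (2 * N) f (W u).
  have Gc : {within D, continuous G}.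
    apply: (within_continuous_comp Wcont _ (B := A)); last by move=> u /=; exact: WA.
    exact: (iter_continuous (f_continuous M) (@fA _ _ _ _ _ _ _ _ M)).
  have Dt : D (iter N Q t) by apply: HN => //; rewrite lerDl.
  have Gt : G u @[u --> within D (nbhs (iter N Q t))] --> G (iter N Q t).
    by move/subspace_continuousP : Gc; exact.
  have Qt : iter N Q u @[u --> t] --> within D (nbhs (iter N Q t)).
    move=> B; rewrite /within /= => nB.
    have Qc := iter_extend_continuous eps0 k1 qinc (n := N).
    have := Qc t _ nB; rewrite !nbhs_simpl /= => nB'.
    by apply: filterS2 nB' near1 => u h1 h2; exact: h1.
  have c := cvg_comp _ _ Qt Gt.
  rewrite /continuous_at (Hgam t N)// => B /c nB.
  have nB' : nbhs t [set u | B (G (iter N Q u))] := nB.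
  apply: (@filterS2 _ (nbhs t) _ _ _ _ _ nB' near1) => u h1 h2.
  by rewrite /= (Hgam u N).
have ginj : injective gam.
  move=> t u e; have [n hn en_] := gamW t; have [m hm em] := gamW u.
  have [h1 e1] := stable_def t n m hn; have [h2 e2] := stable_def u m n hm.
  rewrite addnC in h2 e2.
  have : W (iter (m + n) Q t) = W (iter (m + n) Q u).
    apply: (@f_iter_inj (2 * (m + n))); [exact: WA|exact: WA|].
    by rewrite e1 e2 -en_ -em.
  move=> /(congr1 (fun x => ux x)).
  have U v : `|v| <= eps -> ux (W v) = v.
    move=> hv; have [_ hv1] := Wp v hv.
    have [_ _] := loc_coord_pt M j (W v).2 (le_lt_trans hv ep).
    by rewrite -hv1 -surjective_pairing.
  by rewrite !U// => /(iter_extend_inj eps0 k1 qinc).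
exists gam; split => //.
- apply/seteqP; split => [_ [t _ <-]|x [Ax [y hy yp]]].
    split; first exact: attA.
    exists (fun n => gam (iter n Q t)).
      by move=> n; split; [exact: attA|exact: fgamn].
    rewrite -gam0; apply: (cvg_comp _ gam); last exact: gcont.
    have kV : `|kap^-1| < 1.
      by rewrite gtr0_norm ?invr_gt0 ?invf_lt1// (lt_trans _ k1).
    apply: norm_cvg0; apply: (@squeeze_cvgr _ _ _ _ (fun=> 0) (geometric `|t| kap^-1)).
    + by apply: nearW => n; rewrite normr_ge0 iter_extend_le.
    + exact: cvg_cst.
    + exact: cvg_geometric.
  have ay := backward_iterates_attractor hy yp.
  have [X0 j0 u0] := loc_coord_pt M j 0 (u := 0) ltac:(by rewrite normr0 divr_gt0).
  rewrite addr0 in X0 j0 u0.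
  have cX : X (y n).1 @[n --> \oo] --> X (pt (base j)).
    exact: (cvg_comp _ _ yp (X1_continuous M (x := (pt (base j), 0)))).
  have cY : Y (y n).1 @[n --> \oo] --> Y (pt (base j)).
    exact: (cvg_comp _ _ yp (Y1_continuous M (x := (pt (base j), 0)))).
  have cu : ux (y n) @[n --> \oo] --> (0 : R).
    rewrite -[X in _ --> X]u0.
    apply: (cvg_comp _ (@atan R) (cvgM cY (cvgV X0 cX))).
    exact: continuous_atan.
  have e1 : \forall n \near \oo, `|ux (y n)| <= eps.
    by move/cvgr0_norm_le : cu; apply.
  have e2 : \forall n \near \oo, jx (y n) = j.
    have c1 : X (y n).1 * X (pt (base j)) @[n --> \oo] --> X (pt (base j)) * X (pt (base j)).
      by apply: cvgM => //; exact: cvg_cst.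
    have p0 : 0 < X (pt (base j)) * X (pt (base j)).
      by rewrite -expr2 lt_neqAle sqr_ge0 andbT eq_sym sqrf_eq0.
    have [N _ HN] : \forall n \near \oo, 0 < X (y n).1 * X (pt (base j)).
      exact: (cvgr_gt _ c1 _ p0).
    exists N => // n /HN /=.
    rewrite -[RHS]j0 /right_half /=; case: (ltgtP 0 (X (pt (base j)))) => [h|h|h].
    + by rewrite pmulr_lgt0// => ->; rewrite h.
    + by rewrite nmulr_lgt0// => h1; rewrite ltNge (ltW h1).
    + by rewrite -h eqxx in X0.
  have e3 : \forall n \near \oo, X (y n).1 != 0.
    exact: (cvgr_neq0 _ cX X0).
  have [n [[h1 h2] h3]] := filter_ex (filterI (filterI e1 e2) e3).
  have yW : y n = W (ux (y n)).
    by apply: Wu => //; rewrite -h2; exact: (loc_coord M h3).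
  have [t tu] := iter_extend_surj eps0 k1 q0 qinc n (ux (y n)).
  by exists t => //; rewrite (Hgam t n) -/Q /Q tu// -yW (proj2 (hy n)).
- move=> t; have [u ut] := extend_surj eps0 k1 q0 qinc t; exists u.
  by rewrite -ut fgam.
- move=> t c; have [n h ->] := gamW t; apply: closure_side_iter; [exact: Wa|exact: Wc].
- move=> t t0; have [n h gt] := gamW t; set u := iter n Q t in h gt.
  have u0 : 0 < t * u.
    case: (ltgtP t 0) t0 => // h0 _.
      rewrite nmulr_rgt0//; have := iter_extend_incr eps0 k1 qinc n h0.
      by rewrite iter_extend0.
    rewrite pmulr_rgt0//; have := iter_extend_incr eps0 k1 qinc n h0.
    by rewrite iter_extend0.
  have un0 : u != 0 by apply/eqP => e; rewrite e mulr0 ltxx in u0.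
  have [_ W1] := Wp u h.
  have us : 0 < u * sin u.
    have := ler_normlP _ _ h => -[h1 h2].
    case: (ltgtP u 0) un0 => // h0 _.
      rewrite nmulr_rgt0// -oppr_gt0 -sinN; apply: sin_gt0_pi; rewrite ?oppr_gt0 ?h0 //=; lra.
    by rewrite pmulr_rgt0//; apply: sin_gt0_pi; rewrite h0 /=; lra.
  have sgg : 0 < (if j then 1 else -1) * t * Y (W u).1.
    rewrite W1 (proj2 (base_XY M j u)).
    have u2 : 0 < u ^+ 2 by rewrite lt_neqAle sqr_ge0 andbT eq_sym sqrf_eq0.
    rewrite -(pmulr_rgt0 _ u2).
    have -> : u ^+ 2 * ((if j then 1 else -1) * t * ((if j then 1 else -1) * sin u)) =
      (if j then 1 else -1) ^+ 2 * ((t * u) * (u * sin u)) by ring.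
    by apply: mulr_gt0; [case: (j); rewrite ?sqrrN expr1n|exact: mulr_gt0].
  have eW : b ^+ 2 < en (W u).
    have [h1 h2] := attractor_en M (Wa _ h).
    rewrite lt_neqAle h1 andbT eq_sym; apply/eqP => /h2[Y0 _].
    by rewrite Y0 mulr0 ltxx in sgg.
  rewrite gt; split; last exact: halves_iter (WA _ h) eW sgg.
  by apply: lt_le_trans eW _; apply: en_iter_le; exact: WA.
Qed.

End Curve.

(** * The attractor, its sides and its sinks *)

Section Global.
Context (R : realType) (a b : R) (X Y : circle R -> R) (pt : R -> circle R)
    (lam : circle R * R -> R) (f : circle R * R -> circle R * R).
Hypothesis M : ellipse_model a b X Y pt lam f.

Let b0 := model_b0 M.
Let ba := model_ba M.
Let XY1 := model_unit M.
Let Minj := model_inj M.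
Local Notation A := (annulus (R := R)).
Local Notation en := (chord_energy a b X Y).
Local Notation axis_points := (axis_points X Y).
Local Notation att := (attractor f).
Local Notation base := (base R).
Implicit Types (x z : circle R * R) (s : circle R) (r : R).

Let hT : hausdorff_space (circle R * R)%type :=
  cylinder_hausdorff (model_X M) (model_Y M) (model_inj M).

Variables H E : circle R * R.
Hypotheses (aH : axis_points H) (YH : Y H.1 = 0) (aE : axis_points E) (XE : X E.1 = 0).

Let YE : Y E.1 ^+ 2 = 1. Proof. by have := XY1 E.1; rewrite XE expr0n add0r. Qed.

(** Reversing the curve if necessary makes positive parameters go to the half of the ellipse that contains E. *)
Lemma saddle_curve p : axis_points p -> Y p.1 = 0 -> exists gam : R -> circle R * R,
  [/\ [/\ continuous gam, injective gam & gam 0 = p],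
    range gam = unstable_set2 f p,
    forall t, exists u, f (f (gam t)) = gam u,
    forall t c, closure (side lam f c) (gam t)
  & forall t, t != 0 -> b ^+ 2 < en (gam t) /\ 0 < t * (Y (gam t).1 * Y E.1)].
Proof.
move=> ap Yp; pose j := 0 < X p.1.
have Xp : X p.1 ^+ 2 = 1 by have := XY1 p.1; rewrite Yp expr0n addr0.
have pE : p = (pt (base j), 0).
  have [h1 h2] := base_XY M j 0; rewrite addr0 cos0 sin0 mulr0 mulr1 in h1 h2.
  apply: (axis_eq M) => //=; rewrite ?h1 ?h2//.
    by split => //=; rewrite h2 mulr0.
  have : (X p.1 - 1) * (X p.1 + 1) = 0 by rewrite -subr_sqr_1 Xp subrr.
  move/eqP; rewrite mulf_eq0 subr_eq0 addr_eq0 /j => /orP[]/eqP ->; rewrite ?ltr01//.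
  by rewrite ltr0N1.
have [gam [[gc gi g0] gr gf gs gY]] := unstable_curve M j.
set sg : R := if j then 1 else -1 in gY.
have sg2 : sg ^+ 2 = 1 by rewrite /sg; case: (j); rewrite ?sqrrN expr1n.
pose c := sg * Y E.1.
have c2 : c ^+ 2 = 1 by rewrite exprMn sg2 YE mulr1.
have cn : c != 0 by rewrite -sqrf_eq0 c2 oner_eq0.
exists (fun t => gam (c * t)); split.
- split; last by rewrite mulr0 pE.
    move=> t; apply: (cvg_comp (fun t => c * t) gam); last exact: gc.
    by apply: cvgM; [exact: cvg_cst|exact: cvg_id].
  by move=> t u /gi /(mulfI cn).
- rewrite pE -gr; apply/seteqP; split => _ [t _ <-]; first by exists (c * t).
  by exists (c^-1 * t) => //; rewrite mulVKf.
- by move=> t; have [u ut] := gf (c * t); exists (c^-1 * u); rewrite mulVKf.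
- by move=> t d; exact: gs.
- move=> t t0; have [|h1 h2] := gY (c * t); first by rewrite mulf_neq0.
  split => //; move: h2; congr (_ < _).
  transitivity (sg ^+ 2 * (t * (Y (gam (c * t)).1 * Y E.1))); first by rewrite /c; ring.
  by rewrite sg2 mul1r.
Qed.

Let fE := axis_f M aE.

Lemma to_sink x : A x -> b ^+ 2 < en x -> 0 < Y x.1 * Y E.1 ->
  iter (2 * n) f x @[n --> \oo] --> E.
Proof. by move=> Ax ex yx; exact: (forward_sink M Ax ex aE). Qed.

Lemma to_sink' x : A x -> b ^+ 2 < en x -> Y x.1 * Y E.1 < 0 ->
  iter (2 * n) f x @[n --> \oo] --> f E.
Proof.
move=> Ax ex yx; have [h1 h2 h3] := fE.
apply: (forward_sink M Ax ex (axis_faxis M aE)); first by rewrite h1 XE oppr0.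
by rewrite h2 mulrN oppr_gt0.
Qed.

Lemma saddle_branches p : axis_points p -> Y p.1 = 0 -> exists C1 C2,
  [/\ unstable_branches f p C1 C2, unstable_set2 f p `\ p = C1 `|` C2, C1 `&` C2 = set0,
    C1 `<=` stable_set2 f (iter 1 f E) & C2 `<=` stable_set2 f (iter 2 f E)].
Proof.
move=> ap Yp; have [gam [[gc gi g0] gr gf gs gY]] := saddle_curve ap Yp.
have gA t : A (gam t).
  by apply: (@attA _ f); apply: (unstable_attractor M (p := p)); rewrite -gr; exists t.
exists (gam @` [set t | t < 0]), (gam @` [set t | 0 < t]); split.
- by exists gam; split.
- rewrite -gr -g0; apply/seteqP; split => [x [[t _ <-] /= tx]|x].
    have [t0|t0|t0] := ltgtP t 0; [by left; exists t|by right; exists t|].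
    by case: tx; rewrite t0.
  by case=> -[t /= t0 <-]; split; [exists t| move=> /= /gi e; rewrite e ltxx in t0|
    exists t| move=> /= /gi e; rewrite e ltxx in t0].
- apply/seteqP; split => // x [[t /= t0 <-] [u /= u0 /gi e]].
  by move: (lt_trans t0 u0); rewrite e ltxx.
- move=> _ [t /= t0 <-]; have [|h1 h2] := gY t; first exact: ltr0_neq0.
  split; first exact: gA.
  by apply: to_sink' => //; rewrite -(nmulr_rgt0 _ t0).
- move=> _ [t /= t0 <-]; have [|h1 h2] := gY t; first by rewrite gt_eqF.
  split; first exact: gA.
  rewrite /= (axis_ff M aE); apply: to_sink => //; by rewrite -(pmulr_rgt0 _ t0).
Qed.

Let aH' := axis_faxis M aH.
Let YH' : Y (f H).1 = 0. Proof. by have [_ -> _] := axis_f M aH; rewrite YH oppr0. Qed.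

Lemma attractorE : att = unstable_set_orbit f H `|` [set E; f E].
Proof.
apply/seteqP; split => x.
  move=> ax; have [e|n] := eqVneq (en x) (a ^+ 2).
    right; have [X0 r0] := en_top M (attA ax) e.
    have ax' : axis_points x by split => //; rewrite X0 mul0r.
    have := XY1 x.1; rewrite X0 expr0n add0r -YE => /eqP; rewrite -subr_eq0 subr_sqr mulf_eq0.
    rewrite subr_eq0 addr_eq0 => /orP[]/eqP h.
      by left; apply: (axis_eq M ax' aE) => //; rewrite X0 XE.
    right; have [h1 h2 _] := fE; apply: (axis_eq M ax' (axis_faxis M aE)); last by rewrite h2.
    by rewrite h1 X0 XE oppr0.
  left; have [p [ap Yp px]] := attractor_saddle M ax n.
  have [h1 h2 _] := axis_f M aH.
  have := XY1 p.1; rewrite Yp expr0n addr0 -(XY1 H.1) YH expr0n addr0.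
  move=> /eqP; rewrite -subr_eq0 subr_sqr mulf_eq0 subr_eq0 addr_eq0 => /orP[]/eqP h.
    by left; rewrite -(axis_eq M ap aH h)// Yp YH.
  by right; rewrite -(axis_eq M ap aH')// ?Yp ?YH'// h1.
case=> [[]|[]] => [|| ->|->]; try exact: (unstable_attractor M).
  exact: (axis_attractor M aE).
exact: (axis_attractor M (axis_faxis M aE)).
Qed.

Let sink_limit z : (z = E \/ z = f E) -> exists t (gam : R -> circle R * R),
  [/\ range gam = unstable_set2 f H, forall t, exists u, f (f (gam t)) = gam u,
    forall t c, closure (side lam f c) (gam t) &
    iter (2 * n) f (gam t) @[n --> \oo] --> z].
Proof.
move=> zE; have [gam [_ gr gf gs gY]] := saddle_curve aH YH.
have gA t : A (gam t).
  by apply: (@attA _ f); apply: (unstable_attractor M (p := H)); rewrite -gr; exists t.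
case: zE => ->.
  exists 1, gam; split => //; have [|h1 h2] := gY 1; first exact: oner_neq0.
  by apply: to_sink => //; rewrite mul1r in h2.
exists (-1), gam; split => //; have [|h1 h2] := gY (-1); first by rewrite oppr_eq0 oner_neq0.
by apply: to_sink' => //; rewrite mulN1r oppr_gt0 in h2.
Qed.

Let gam_iter (gam : R -> circle R * R) : (forall t, exists u, f (f (gam t)) = gam u) ->
  forall n t, exists u, iter (2 * n) f (gam t) = gam u.
Proof.
move=> gf; elim=> [|n IH] t; first by exists t.
have [u ut] := gf t; have [v vu] := IH u; exists v.
by rewrite mulnS addnC iterD /= ut.
Qed.

(** Both sinks are limits of forward orbits of points of the unstable curve of H. *)
Let sink_closure (D : set (circle R * R)) z : (z = E \/ z = f E) ->
  (forall (gam : R -> circle R * R), range gam = unstable_set2 f H ->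
    (forall t c, closure (side lam f c) (gam t)) -> forall t, closure D (gam t)) -> closure D z.
Proof.
move=> /sink_limit[t [gam [gr gf gs gl]]] h.
have cl : closed (closure D) by exact: closed_closure.
apply: (@closed_cvg _ _ _ _ _ (closure D) cl _ _ gl); apply: (@filterE _ \oo) => n /=.
by have [u ->] := gam_iter gf n t; exact: h.
Qed.

Lemma attractor_closed : closed att.
Proof. exact: (compact_closed hT (attractor_cpt M)). Qed.

Lemma attractor_closure : att = closure (unstable_set_orbit f H).
Proof.
apply/seteqP; split => x; last first.
  move=> cx; rewrite [X in X x](closure_id att).1; last exact: attractor_closed.
  by apply: closure_subset cx => z zW; rewrite attractorE; left.
rewrite attractorE => -[|zE]; first exact: subset_closure.
apply: (sink_closure (z := x)); first by case: zE => ->; [left|right].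
by move=> gam gr _ t; apply: subset_closure; left; rewrite -gr; exists t.
Qed.

(** True on the unstable curves, and it passes to the limit at the sinks. *)
Lemma attractor_sides x c : att x -> closure (side lam f c) x.
Proof.
rewrite attractorE => -[[xW|xW]|zE].
- have [gam [_ gr _ gs _]] := saddle_curve aH YH.
  by move: xW; rewrite -gr => -[t _ <-].
- have [gam [_ gr _ gs _]] := saddle_curve aH' YH'.
  by move: xW; rewrite -gr => -[t _ <-].
- apply: (sink_closure (z := x)); first by case: zE => ->; [left|right].
  by move=> gam _ gs t.
Qed.

Lemma annulus_closed : closed A.
Proof. exact: (compact_closed hT (@annulus_compact R)). Qed.

(** The two sides are disjoint and open, so none of them meets the closure of the other,
    and a point in both closures is in neither. *)
Lemma birkhoff_sub (U V : set (circle R * R)) :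
  complement_split f U V -> closure U `&` closure V `<=` att.
Proof.
move=> [UV disj [ [B1 oO1 UE] [B2 oO2 VE] ] _ _] x [cU cV].
have Ax : A x.
  rewrite [X in X x](closure_id A).1; last exact: annulus_closed.
  by apply: closure_subset cU => z; rewrite UE => -[].
apply: contrapT => nx; have : (U `|` V) x by rewrite -UV.
case=> Ux.
- have O1x : nbhs x B1 by apply: open_nbhs_nbhs; split => //; move: Ux; rewrite UE => -[].
  have [z [Vz Oz]] := cV _ O1x.
  have : (U `&` V) z by split => //; rewrite UE; split => //; move: Vz; rewrite VE => -[].
  by rewrite disj.
- have O2x : nbhs x B2 by apply: open_nbhs_nbhs; split => //; move: Ux; rewrite VE => -[].
  have [z [Uz Oz]] := cU _ O2x.
  have : (U `&` V) z by split => //; rewrite VE; split => //; move: Uz; rewrite UE => -[].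
  by rewrite disj.
Qed.

Lemma birkhoffE : att = birkhoff_attractor f.
Proof.
apply/seteqP; split => [x ax|x [U [V [UV xUV]]]]; last exact: birkhoff_sub UV _ xUV.
exists (side lam f false), (side lam f true); split; first exact: (side_split M).
by split; exact: attractor_sides.
Qed.

End Global.

(** * Jacobians from strict derivatives *)

Section Frechet.
Context (R : realType).

Lemma mx_entry_le m n (v : 'M[R]_(m.+1, n.+1)) i j : `|v i j| <= `|v|.
Proof.
rewrite [`|v|]mx_normrE; exact: (le_bigmax _ (fun ij => `|v ij.1 ij.2|) (i, j)).
Qed.

Lemma row2_norm_le (v : 'rV[R]_2) (c : R) : `|v 0 0| <= c -> `|v 0 1| <= c -> `|v| <= c.
Proof.
move=> h0 h1; rewrite [`|v|]mx_normrE; apply/bigmax_leP; split.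
  exact: le_trans h0.
move=> [i j] _ /=; rewrite (ord1 i).
have [->//|] : j = 0 \/ j = 1.
  by case: j => -[|[|//]] k; [left|right]; apply: val_inj.
by move=> ->.
Qed.

Definition pair_of (v : 'rV[R]_2) : R * R := (v 0 0, v 0 1).
Definition row_of (p : R * R) : 'rV[R]_2 := \row_j (if j == 0 then p.1 else p.2).

Lemma row_of0 p : row_of p 0 0 = p.1. Proof. by rewrite mxE. Qed.
Lemma row_of1 p : row_of p 0 1 = p.2. Proof. by rewrite mxE. Qed.

Lemma row_of_pair p : pair_of (row_of p) = p.
Proof. by rewrite /pair_of row_of0 row_of1 -surjective_pairing. Qed.

Lemma strict_at g (p : R * R) (A B : R) : strict g p A B -> forall e, 0 < e ->
  \forall z \near p, `|g z - g p - (A * (z.1 - p.1) + B * (z.2 - p.2))| <= e * `|z - p|.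
Proof.
move=> Sg e e0; have [[P1 P2] [/= n1 n2] H] := Sg e e0.
apply: (@filterS _ (nbhs p) _ P1) => // z Pz.
exact: (H (z, p) (conj Pz (nbhs_singleton n2))).
Qed.

(** Row vectors are used, hence the transposed matrix. *)
Lemma jacobian_strict (g1 g2 : R * R -> R) (p : R * R) (A1 B1 A2 B2 : R) :
  strict g1 p A1 B1 -> strict g2 p A2 B2 ->
  let G := fun v => row_of (g1 (pair_of v), g2 (pair_of v)) in
  let J : 'M[R]_2 := \matrix_(i, j)
    (if i == 0 then (if j == 0 then A1 else A2) else (if j == 0 then B1 else B2)) in
  differentiable G (row_of p) /\ jacobian G (row_of p) = J.
Proof.
move=> S1 S2 G J; pose x := row_of p.
pose df : {linear 'rV[R]_2 -> 'rV[R]_2} := mulmxr J.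
have dfE v : df v = row_of (A1 * v 0 0 + B1 * v 0 1, A2 * v 0 0 + B2 * v 0 1).
  apply/rowP => j; rewrite /df /= !mxE big_ord_recl big_ord1 /= !mxE /=.
  rewrite (_ : lift 0 0 = 1); last exact: val_inj.
  by case: (j == 0); rewrite /= ![v _ _ * _]mulrC.
have dfc : continuous df.
  have K0 : 0 < `|A1| + `|B1| + (`|A2| + `|B2|) + 1 by rewrite ltr_wpDl// !addr_ge0.
  apply/linear_bounded_continuous/bounded_funP => r.
  exists ((`|A1| + `|B1| + (`|A2| + `|B2|)) * `|r|) => v vr.
  have vr' : `|v| <= `|r| by apply: le_trans vr _; exact: ler_norm.
  have h0 := le_trans (mx_entry_le v 0 0) vr'; have h1 := le_trans (mx_entry_le v 0 1) vr'.
  have bd (A B A' B' : R) : `|A * v 0 0 + B * v 0 1| <= (`|A| + `|B| + (`|A'| + `|B'|)) * `|r|.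
    apply: le_trans (ler_normD _ _) _; rewrite !normrM.
    have := ler_wpM2l (normr_ge0 A) h0; have := ler_wpM2l (normr_ge0 B) h1.
    have := mulr_ge0 (normr_ge0 A') (normr_ge0 r); have := mulr_ge0 (normr_ge0 B') (normr_ge0 r).
    lra.
  rewrite dfE; apply: row2_norm_le; rewrite ?row_of0 ?row_of1 //=.
  by rewrite [`|A1| + `|B1| + _]addrC.
have lo : (G \o shift x : 'rV[R]_2 -> 'rV[R]_2) =
    (cst (G x) : 'rV[R]_2 -> 'rV[R]_2) + (df : 'rV[R]_2 -> 'rV[R]_2)
    +o_ (0 : 'rV[R]_2) (id : 'rV[R]_2 -> 'rV[R]_2).
  apply/eqaddoP => e e0; have h1 := strict_at S1 e0; have h2 := strict_at S2 e0.
  have cs : pair_of (v + x) @[v --> (0 : 'rV[R]_2)] --> p.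
    have E : (fun v : 'rV[R]_2 => pair_of (v + x)) = (fun v => (v 0 0 + p.1, v 0 1 + p.2)).
      by apply/funext => v; rewrite /pair_of !mxE.
    have c k : (v : 'rV[R]_2) 0 k @[v --> (0 : 'rV[R]_2)] --> (0 : R).
      have := @coord_continuous R 1 2 0 k 0; rewrite /continuous_at /= mxE; exact.
    rewrite E [p in X in _ --> X]surjective_pairing -[p.1 in X in _ --> X]add0r
      -[p.2 in X in _ --> X]add0r.
    apply: (@cvg_pair _ _ _ (nbhs (0 : 'rV[R]_2)) (nbhs (0 + p.1)) (nbhs (0 + p.2))).
      by apply: cvgD; [exact: c|exact: cvg_cst].
    by apply: cvgD; [exact: c|exact: cvg_cst].
  apply: (@filterS2 _ (nbhs (0 : 'rV[R]_2)) _ _ _ _ _ (cs _ h1) (cs _ h2)) => v /= H1 H2.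
  have px0 : p.1 = x 0 0 by rewrite row_of0.
  have px1 : p.2 = x 0 1 by rewrite row_of1.
  have nv : `|pair_of (v + x) - p| <= `|v|.
    rewrite prod_normE /= px0 px1 !mxE !addrK /= ge_max; apply/andP; split; exact: mx_entry_le.
  have Gx : G x = row_of (g1 p, g2 p) by rewrite /G row_of_pair.
  rewrite /= !fctE Gx dfE /G.
  apply: row2_norm_le; rewrite !mxE /=.
    apply: le_trans (le_trans H1 _); last by rewrite ler_wpM2l// ltW.
    by rewrite px0 px1 !mxE !addrK opprD addrA.
  apply: le_trans (le_trans H2 _); last by rewrite ler_wpM2l// ltW.
  by rewrite px0 px1 !mxE !addrK opprD addrA.
have dE := diff_unique dfc lo.
split.
  by apply/diff_locallyP; rewrite dE.
rewrite /jacobian; apply/matrixP => i j; rewrite mxE dE /df /=.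
by rewrite -rowE mxE.
Qed.

End Frechet.

(** * Eigenvalues of real matrices of size two *)

Section Eigen.
Context (R : realType).
Implicit Types (J : 'M[R]_2) (z : R[i]).

Lemma complex_eigenvalueE J z :
  complex_eigenvalue J z = (z ^+ 2 - (\tr J)%:C%C * z + (\det J)%:C%C == 0).
Proof.
rewrite /complex_eigenvalue eigenvalue_root_char rootE.
set A := map_mx _ J; have sz := size_char_poly A.
rewrite horner_coef sz !big_ord_recl big_ord0 /= addr0 /bump /=.
have c0 : (char_poly A)`_0 = (\det J)%:C%C.
  by rewrite char_poly_det sqrrN expr1n mul1r det_map_mx.
have c1 : (char_poly A)`_1 = - (\tr J)%:C%C.
  by rewrite (char_poly_trace A isT); congr (- _); rewrite /mxtrace rmorph_sum; apply: eq_bigr => i _; rewrite mxE.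
have c2 : (char_poly A)`_2 = 1.
  by have := monicP (char_poly_monic A); rewrite lead_coefE sz.
by rewrite c0 c1 c2; congr (_ == _); ring.
Qed.

Lemma real_eigenvalue J (x : R) : x ^+ 2 - \tr J * x + \det J = 0 ->
  complex_eigenvalue J x%:C%C.
Proof.
move=> h; rewrite complex_eigenvalueE.
have -> : (x%:C ^+ 2 - (\tr J)%:C * x%:C + (\det J)%:C = (x ^+ 2 - \tr J * x + \det J)%:C)%C.
  by rewrite rmorphD rmorphB rmorphXn rmorphM.
by rewrite h.
Qed.

Lemma norm_real_complex (x : R) : `|x%:C%C| = `|x|%:C%C.
Proof. by rewrite normc_def /= expr0n /= addr0 sqrtr_sqr. Qed.

(** The polynomial is negative at 1 and positive at 0. *)
Lemma real_roots_split (t d : R) : 0 < d -> 1 + d < t -> exists x1 x2 : R,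
  [/\ x1 ^+ 2 - t * x1 + d = 0, x2 ^+ 2 - t * x2 + d = 0, 0 < x1 < 1 & 1 < x2].
Proof.
move=> d0 td; pose D := t ^+ 2 - 4 * d; pose s := Num.sqrt D.
have lt_sqr (u v : R) : 0 <= v -> u ^+ 2 < v ^+ 2 -> u < v.
  move=> v0; apply: contraTT; rewrite -!leNgt => uv.
  by apply: lerXn2r; rewrite ?nnegrE//; apply: le_trans uv.
have DE : D = (t - 2) ^+ 2 + 4 * (t - 1 - d) by rewrite /D; ring.
have D0 : 0 <= D by rewrite DE addr_ge0 ?sqr_ge0// mulr_ge0//; lra.
have ss : s ^+ 2 = D by exact: sqr_sqrtr.
have s0 : 0 <= s by exact: sqrtr_ge0.
have s1 : t - 2 < s by apply: lt_sqr => //; rewrite ss DE ltrDl; lra.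
have s2 : 2 - t < s.
  apply: lt_sqr => //; rewrite ss DE; have -> : (2 - t) ^+ 2 = (t - 2) ^+ 2 by ring.
  by rewrite ltrDl; lra.
have s3 : s < t by apply: lt_sqr; [lra|rewrite ss /D; lra].
have rt (e : R) : e ^+ 2 = 1 -> ((t + e * s) / 2) ^+ 2 - t * ((t + e * s) / 2) + d = 0.
  move=> e1; have -> : ((t + e * s) / 2) ^+ 2 - t * ((t + e * s) / 2) + d =
    (e ^+ 2 * s ^+ 2 - t ^+ 2 + 4 * d) / 4 by field.
  by rewrite e1 mul1r ss /D; field.
exists ((t + (-1) * s) / 2), ((t + 1 * s) / 2); split.
- by apply: rt; rewrite sqrrN expr1n.
- by apply: rt; rewrite expr1n.
- by apply/andP; split; lra.
- by lra.
Qed.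

Lemma saddle_eigenvalues J : 0 < \det J -> 1 + \det J < \tr J ->
  exists z1 z2, [/\ complex_eigenvalue J z1, complex_eigenvalue J z2, `|z1| < 1 & 1 < `|z2|].
Proof.
move=> d0 td; have [x1 [x2 [r1 r2 /andP[x10 x11] x21]]] := real_roots_split d0 td.
exists x1%:C%C, x2%:C%C; split; try exact: real_eigenvalue.
  by rewrite norm_real_complex gtr0_norm// -[ltRHS](rmorph1 (real_complex R)) ltcR.
rewrite norm_real_complex gtr0_norm; last exact: lt_trans x21.
by rewrite -[ltLHS](rmorph1 (real_complex R)) ltcR.
Qed.

(** A nonreal eigenvalue has squared modulus the determinant.  A real one outside (-1, 1) is excluded by the sign
    of the characteristic polynomial there. *)
Lemma sink_eigenvalues J : \det J < 1 -> `|\tr J| < 1 + \det J ->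
  forall z, complex_eigenvalue J z -> `|z| < 1.
Proof.
set t := \tr J; set d := \det J => d1; rewrite ltr_norml => /andP[t1 t2] [x y].
rewrite complex_eigenvalueE -/t -/d eq_complex /= => /andP[/eqP hr /eqP hi].
rewrite normc_def /= -[ltRHS](rmorph1 (real_complex R)) ltcR -sqrtr1 ltr_sqrt//.
have {}hr : x ^+ 2 - y ^+ 2 - t * x + d = 0 by rewrite -[RHS]hr; ring.
have {}hi : y * (2 * x - t) = 0 by rewrite -[RHS]hi; ring.
move/eqP: hi; rewrite mulf_eq0 => /orP[/eqP y0|/eqP xt]; last first.
  have -> : x ^+ 2 + y ^+ 2 = d - (x ^+ 2 - y ^+ 2 - t * x + d) + x * (2 * x - t) by ring.
  by rewrite hr xt mulr0 subr0 addr0.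
rewrite y0 expr0n addr0 in hr *; rewrite subr0 in hr.
suff : `|x| < 1 by rewrite -(real_normK (num_real x)) => h; rewrite expr_lt1.
rewrite ltr_norml; apply/andP; split; rewrite ltNge; apply/negP => h.
- have : 0 <= (- x - 1) * (- x - d) by apply: mulr_ge0; lra.
  have : 0 < (t + 1 + d) * (- x) by apply: mulr_gt0; lra.
  rewrite expr2 in hr; lra.
- have : 0 <= (x - 1) * (x - d) by apply: mulr_ge0; lra.
  have : 0 < (1 + d - t) * x by apply: mulr_gt0; lra.
  rewrite expr2 in hr; lra.
Qed.

Lemma det_row2 (J : 'M[R]_2) : \det J = J 0 0 * J 1 1 - J 0 1 * J 1 0.
Proof.
rewrite (expand_det_row _ 0) !big_ord_recl big_ord0 addr0 /cofactor !det_mx11 !mxE /=.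
rewrite expr0 mul1r expr1 mulN1r mulrN.
by congr (J _ _ * J _ _ - J _ _ * J _ _); apply: val_inj.
Qed.

Lemma trace_row2 (J : 'M[R]_2) : \tr J = J 0 0 + J 1 1.
Proof.
by rewrite /mxtrace !big_ord_recl big_ord0 addr0; congr (_ + J _ _); apply: val_inj.
Qed.

End Eigen.

(** * Hyperbolicity of the two-periodic orbits *)

Section Hyperbolic.
Context (R : realType) (a b : R) (X Y : circle R -> R) (pt : R -> circle R)
    (lam : circle R * R -> R) (f : circle R * R -> circle R * R).
Hypothesis M : ellipse_model a b X Y pt lam f.
Variables (S Th dS : R -> R).
Hypotheses (ThK : cancel Th S) (SK : cancel S Th) (ptE : forall t, pt t = cproj (S t)).
Hypotheses (strictS : forall t, strict1 S t (dS t)) (strictTh : forall t, strict1 Th (S t) (dS t)^-1).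
Hypothesis dSpi : forall t, dS (t + pi + pi) = dS t.

Let b0 := model_b0 M.
Let ba := model_ba M.
Let a0 : 0 < a. Proof. exact: lt_trans ba. Qed.
Let XY1 := model_unit M.
Local Notation A := (annulus (R := R)).
Local Notation axis_points := (axis_points X Y).
Let c2 : R := a ^+ 2 - b ^+ 2.

Variable t0 : R.
Hypothesis t0axis : cos t0 * sin t0 = 0.
Hypothesis dS0 : dS t0 != 0.

Let w := sqspeed a b (cos t0) (sin t0).
Let sg := cos t0 ^+ 2 - sin t0 ^+ 2.
Let P := 1 + 2 * c2 * sg / w.
Let B := - (2 * (a * b) / w).
Let C := - (2 * c2 * sg * (a * b) / w ^+ 2).
Let l1 := lam (pt (t0 + pi), 0).
Let l2 := lam (pt (t0 + pi + pi), 0).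

Let L2 (p : R * R) : R := lam (pt (angle_lift a b p), sin_lift a b p) * sin_lift a b p.

Let strict_L2 t : cos t * sin t = 0 ->
  strict L2 (t, 0)
   (lam (pt (t + pi), 0) * - (2 * c2 * (cos t ^+ 2 - sin t ^+ 2) * (a * b) /
      sqspeed a b (cos t) (sin t) ^+ 2))
   (lam (pt (t + pi), 0) * (1 + 2 * c2 * (cos t ^+ 2 - sin t ^+ 2) / sqspeed a b (cos t) (sin t))).
Proof.
move=> tx; have Ss := strict_sin b0 ba tx.
have La := strict_lip (strict_angle b0 ba tx); have Ls := strict_lip Ss.
have s0 := sin_lift0 a b tx; have an0 := angle_lift0 a b tx.
have L : lipnear (fun p => lam (pt (angle_lift a b p), sin_lift a b p)) (t, 0).
  apply: (lip_comp2 (g := fun p => lam (pt p.1, p.2)) La Ls).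
  by rewrite s0; exact: (model_lam_lip M).
by have := strict0M L Ss s0; rewrite s0 an0.
Qed.

Let csp (t : R) : cos (t + pi) = - cos t /\ sin (t + pi) = - sin t.
Proof. by rewrite cosD sinD cospi sinpi; split; ring. Qed.

Let t1axis : cos (t0 + pi) * sin (t0 + pi) = 0.
Proof. by have [-> ->] := csp t0; rewrite mulrNN. Qed.

Let sqs1 : sqspeed a b (cos (t0 + pi)) (sin (t0 + pi)) = w.
Proof. by have [-> ->] := csp t0; rewrite /w /sqspeed !sqrrN. Qed.

Let sg1 : cos (t0 + pi) ^+ 2 - sin (t0 + pi) ^+ 2 = sg.
Proof. by have [-> ->] := csp t0; rewrite !sqrrN. Qed.

Let S1 := strict_angle b0 ba t0axis.
Let S2 := strict_L2 t0axis.

Let A0 : angle_lift a b (t0, 0) = t0 + pi. Proof. exact: angle_lift0. Qed.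
Let B0 : L2 (t0, 0) = 0. Proof. by rewrite /L2 sin_lift0// mulr0. Qed.
Let A1 : angle_lift a b (t0 + pi, 0) = t0 + pi + pi. Proof. exact: angle_lift0. Qed.

Let p0 : R * R := (S t0, 0).
Let K1 (p : R * R) : R := angle_lift a b (Th p.1, p.2).
Let K2 (p : R * R) : R := L2 (Th p.1, p.2).
Let N1 (p : R * R) : R := angle_lift a b (K1 p, K2 p).
Let N2 (p : R * R) : R := L2 (K1 p, K2 p).

Let th := (dS t0)^-1.

Let SF : strict (fun p => Th p.1) p0 th 0.
Proof.
have := strict_comp1 (strict_fst p0) (strictTh t0).
by apply: strict_eq => //; rewrite ?mulr1 ?mulr0.
Qed.

Let SK1 : strict K1 p0 (P * th) B.
Proof.
have := strict_comp2 (g := angle_lift a b) SF (strict_snd p0) (A := P) (B := B).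
rewrite /= SK => /(_ S1); apply: strict_eq => //; ring.
Qed.

Let SK2 : strict K2 p0 (l1 * C * th) (l1 * P).
Proof.
have := strict_comp2 (g := L2) SF (strict_snd p0) (A := l1 * C) (B := l1 * P).
rewrite /= SK => /(_ S2); apply: strict_eq => //; ring.
Qed.

Let K10 : K1 p0 = t0 + pi. Proof. by rewrite /K1 /= SK A0. Qed.
Let K20 : K2 p0 = 0. Proof. by rewrite /K2 /= SK B0. Qed.

Let SN1 : strict N1 p0 (P * (P * th) + B * (l1 * C * th)) (P * B + B * (l1 * P)).
Proof.
apply: (strict_comp2 (g := angle_lift a b) SK1 SK2); rewrite K10 K20.
by have := strict_angle b0 ba t1axis; rewrite sqs1 sg1.
Qed.

Let SN2 : strict N2 p0 (l2 * C * (P * th) + l2 * P * (l1 * C * th))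
  (l2 * C * B + l2 * P * (l1 * P)).
Proof.
apply: (strict_comp2 (g := L2) SK1 SK2); rewrite K10 K20.
by have := strict_L2 t1axis; rewrite sqs1 sg1.
Qed.

Let SM1 : strict (fun p => S (N1 p)) p0 (dS t0 * (P * (P * th) + B * (l1 * C * th)))
  (dS t0 * (P * B + B * (l1 * P))).
Proof.
apply: (strict_comp1 SN1); rewrite /N1 K10 K20 A1 -dSpi; exact: strictS.
Qed.

Let w0 : 0 < w. Proof. by apply: sqspeed_gt0 => //; exact: cos2Dsin2. Qed.
Let wE : w = b ^+ 2 + c2 * sin t0 ^+ 2.
Proof. by apply: sqspeedE; exact: cos2Dsin2. Qed.

Let t0cases : (cos t0 = 0 /\ w = a ^+ 2 /\ sg = -1) \/ (sin t0 = 0 /\ w = b ^+ 2 /\ sg = 1).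
Proof.
have cs1 := cos2Dsin2 t0.
move/eqP: t0axis; rewrite mulf_eq0 => /orP[/eqP h|/eqP h]; [left|right]; split => //.
  by rewrite h expr0n add0r in cs1; rewrite /sg wE h cs1 expr0n sub0r mulr1 /c2; split; ring.
by rewrite h expr0n addr0 in cs1; rewrite /sg wE h cs1 expr0n subr0 mulr0 addr0.
Qed.

Let PBC : P ^+ 2 - B * C = 1.
Proof.
case: t0cases => -[_ [we sge]]; rewrite /P /B /C we sge /c2; field; rewrite gt_eqF//.
Qed.

(** In the coordinates (t, r) each step has linear part (P, B; l C, l P) with P^2 - B C = 1.  The change from the
    angle t to arclength conjugates the product of the two matrices by a diagonal one. *)
Lemma second_iterate_derivative : exists J : 'M[R]_2,
  [/\ cyl_derivative (f \o f) (pt t0, 0) J, \det J = l1 * l2 &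
    \tr J = P ^+ 2 * (1 + l1 * l2) + (l1 + l2) * (P ^+ 2 - 1)].
Proof.
have [dG jG] := jacobian_strict SM1 SN2.
have dth : dS t0 * th = 1 by rewrite divff.
have BC : B * C = P ^+ 2 - 1 by rewrite -PBC; ring.
have thd : th * dS t0 = 1 by rewrite mulrC.
exists (jacobian (fun v : 'rV[R]_2 => row_of (S (N1 (pair_of v)), N2 (pair_of v))) (row_of p0)).
split.
- exists (row_of p0), (fun v => row_of (S (N1 (pair_of v)), N2 (pair_of v))); split => //.
    by rewrite /cyl_proj row_of0 row_of1 /= ptE.
  have : \forall y \near row_of p0, `|(y : 'rV[R]_2) 0 1| < 1.
    have := @coord_continuous R 1 2 0 1 (row_of p0); rewrite /continuous_at /= row_of1.
    by move=> /cvgr0_norm_lt; apply.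
  apply: filterS => y y1.
  have Ay : A (pt (Th (y 0 0)), y 0 1) by exact: ltW.
  have e1 : cyl_proj y = (pt (Th (y 0 0)), y 0 1) by rewrite /cyl_proj ptE ThK.
  have e2 := f_lift M (Th (y 0 0)) y1.
  have h2 : `|(lift_step a b pt lam (Th (y 0 0), y 0 1)).2| < 1.
    by have := f_int M Ay; rewrite e2.
  by rewrite /cyl_proj row_of0 row_of1 /= -/(cyl_proj y) e1 e2 (f_lift M _ h2) ptE.
- rewrite jG det_row2 !mxE /=.
  transitivity (l2 * ((dS t0 * th) * (P ^+ 2 + l1 * (B * C)) * (B * C + l1 * P ^+ 2) -
    (dS t0 * th) * (1 + l1) ^+ 2 * (B * C) * P ^+ 2)); first by ring.
  by rewrite dth BC; ring.
- rewrite jG trace_row2 !mxE /=.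
  transitivity ((dS t0 * th) * (P ^+ 2 + l1 * (B * C)) + l2 * (B * C) + l1 * l2 * P ^+ 2).
    by ring.
  by rewrite dth BC; ring.
Qed.

Let l101 : 0 < l1 < 1. Proof. by apply: (model_lam01 M); rewrite /annulus /= normr0. Qed.
Let l201 : 0 < l2 < 1. Proof. by apply: (model_lam01 M); rewrite /annulus /= normr0. Qed.

Lemma axis_two_periodic p : axis_points p -> two_periodic f p.
Proof.
move=> ap; split; [exact: axisA ap|exact: (axis_ff M ap)|].
have [h1 h2 _] := axis_f M ap => e; rewrite e in h1 h2.
have := XY1 p.1; have -> : X p.1 = 0 by lra.
have -> : Y p.1 = 0 by lra.
by rewrite expr0n addr0 => /esym/eqP; rewrite oner_eq0.
Qed.

Let ap : axis_points (pt t0, 0).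
Proof. by split => //=; rewrite (model_ptX M) (model_ptY M). Qed.

Let c20 : 0 < c2. Proof. by rewrite subr_gt0 ltr_sqr ?nnegrE// ltW. Qed.

Lemma saddle_at : sin t0 = 0 -> saddle f (pt t0, 0).
Proof.
move=> st; split; first exact: axis_two_periodic.
have [J [dJ detJ trJ]] := second_iterate_derivative; exists J => //.
have /andP[l10 l11] := l101; have /andP[l20 l21] := l201.
have l12 : 0 < l1 * l2 by exact: mulr_gt0.
have P1 : 1 < P ^+ 2.
  have : 1 < P.
    case: t0cases => -[h [we sge]].
      by have := cos2Dsin2 t0; rewrite h st expr0n addr0 => /esym/eqP; rewrite oner_eq0.
    by rewrite /P we sge mulr1 ltrDl divr_gt0 ?exprn_gt0// mulr_gt0.
  by move=> h; rewrite expr_gt1// ltW// (lt_trans _ h).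
apply: saddle_eigenvalues; rewrite detJ ?trJ//.
have h1 : 0 < (P ^+ 2 - 1) * (1 + l1 * l2 + l1 + l2) by apply: mulr_gt0; lra.
move: h1; move: (P ^+ 2) (l1 * l2) => p2 D; lra.
Qed.

Lemma sink_at : cos t0 = 0 -> sink f (pt t0, 0).
Proof.
move=> ct; split; first exact: axis_two_periodic.
have [J [dJ detJ trJ]] := second_iterate_derivative; exists J => //.
have /andP[l10 l11] := l101; have /andP[l20 l21] := l201.
have l12 : 0 < l1 * l2 by exact: mulr_gt0.
have P1 : P ^+ 2 < 1.
  case: t0cases => -[h [we sge]]; last first.
    by have := cos2Dsin2 t0; rewrite h ct expr0n addr0 => /esym/eqP; rewrite oner_eq0.
  have PE : P = 1 - 2 * (c2 / a ^+ 2) by rewrite /P we sge; ring.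
  have a20 : 0 < a ^+ 2 by exact: exprn_gt0.
  have u0 : 0 < c2 / a ^+ 2 by exact: divr_gt0.
  have u1 : c2 / a ^+ 2 < 1 by rewrite ltr_pdivrMr// mul1r gtrBl exprn_gt0.
  have : 0 < (c2 / a ^+ 2) * (1 - c2 / a ^+ 2) by apply: mulr_gt0; lra.
  rewrite PE; move: (c2 / a ^+ 2) => u h1; rewrite expr2; lra.
have P0 := sqr_ge0 P.
have h3 : 0 < (1 - l1) * (1 - l2) by apply: mulr_gt0; lra.
have h4 : 0 < (1 - P ^+ 2) * ((1 - l1) * (1 - l2)) by apply: mulr_gt0; lra.
have h5 : 0 <= P ^+ 2 * (l1 * l2) by apply: mulr_ge0; [|exact: ltW].
have h6 : 0 < (1 - P ^+ 2) * (1 + l1 * l2 + l1 + l2) by apply: mulr_gt0; lra.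
have l1l : l1 * l2 < 1 by apply: (@lt_trans _ _ l1) => //; rewrite gtr_pMr.
apply: sink_eigenvalues; rewrite detJ ?trJ//.
rewrite ltr_norml; move: h3 h4 h5 h6 P0 P1; move: (P ^+ 2) => p2 h3 h4 h5 h6 P0 P1.
by apply/andP; split; lra.
Qed.

End Hyperbolic.

(** * From the ellipse to the model *)

Section Instance.
Context (R : realType) (F1 F2 : R * R) (a e : R) (Ups : circle R -> R * R) (k : nat)
  (lam : circle R * R -> R).
Hypotheses (a0 : 0 < a) (ecc : eccentricity F1 F2 a = e) (e01 : 0 < e < 1)
  (hUps : arclength_param (ellipse F1 F2 a) Ups) (hk : (2 <= k)%N) (hlam : dissipation k.-1 lam).

Let b := semiminor F1 F2 a.
Let X := cX F1 F2 a Ups.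
Let Y := cY F1 F2 a Ups.
Let f := dissipative_billiard (ellipse_domain F1 F2 a) Ups lam.
Let b0 : 0 < b. Proof. exact: semiminor_gt0 a0 ecc e01. Qed.
Let ba : b < a. Proof. exact: semiminor_lt a0 ecc e01. Qed.

Lemma major_axis_cY s : major_axis_line F1 F2 (Ups s) -> Y s = 0.
Proof.
rewrite /major_axis_line /= /cross /Y /cY /coord2 /frame2 => h.
have -> : (Ups s - F1).2 * (F2.1 - F1.1) - (Ups s - F1).1 * (F2.2 - F1.2) = 0.
  by rewrite -[RHS]oppr0 -h /=; ring.
by rewrite !mul0r.
Qed.

Lemma minor_axis_cX s : minor_axis_line F1 F2 (Ups s) -> X s = 0.
Proof.
rewrite /minor_axis_line /= => h; have c0 := focal_gt0 a0 ecc e01.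
have := enorm_focus1 a0 ecc e01 (Ups s); rewrite h (enorm_focus2 a0 ecc e01) -/X.
rewrite -[coord1 F1 F2 a (Ups s)]/(X s); set u := X s; set c := focal F1 F2 in c0 * => E.
have : (4 * (a * c)) * u = 0 by move: E; rewrite !expr2; lra.
have k0 : 0 < 4 * (a * c) by apply: mulr_gt0 => //; exact: mulr_gt0 a0 c0.
by move/eqP; rewrite mulf_eq0 (gt_eqF k0) => /eqP.
Qed.

(** The dissipation factor is Lipschitz near r = 0 because the lift to the plane computes it there. *)
Lemma billiard_model : exists S Th dS : R -> R,
  [/\ ellipse_model a b X Y (fun t => cproj (S t)) lam f, cancel Th S, cancel S Th,
    forall t, strict1 S t (dS t) /\ strict1 Th (S t) (dS t)^-1 &
    forall t, dS t != 0 /\ dS (t + pi + pi) = dS t].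
Proof.
have [sg [S [Th [sg2 SK ThK cs dSTh]]]] := lift_exists a0 ecc e01 hUps.
pose dS t := sg * speed a b (cos t) (sin t).
have dS0 t : dS t != 0.
  rewrite mulf_neq0//; last by rewrite gt_eqF// speed_gt0//; exact: cos2Dsin2.
  by rewrite -sqrf_eq0 sg2 oner_eq0.
have dSc : continuous dS.
  move=> t; apply: cvgM; first exact: cvg_cst.
  by apply: cvg_speed; [exact: continuous_cos|exact: continuous_sin].
have dS_ t : is_derive (t : R) 1 S (dS t) by have [] := dSTh t.
have dTh x : is_derive (x : R) 1 Th (dS (Th x))^-1.
  by have [_] := dSTh (Th x); rewrite ThK.
have cS : continuous S.
  by move=> t; apply/differentiable_continuous/derivable1_diffP; have [] := dS_ t.
have cTh : continuous Th.
  by move=> t; apply/differentiable_continuous/derivable1_diffP; have [] := dTh t.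
have strictS t : strict1 S t (dS t).
  by apply: C1_strict1; [apply: filterE => u; exact: dS_|exact: dSc].
have strictTh t : strict1 Th (S t) (dS t)^-1.
  rewrite -{2}(SK t); apply: (@C1_strict1 _ Th (fun x => (dS (Th x))^-1)).
    by apply: filterE => u; exact: dTh.
  apply: cvgV; first exact: dS0.
  exact: (cvg_comp _ _ (cTh (S t)) (dSc (Th (S t)))).
exists S, Th, dS; split => //; last first.
  by move=> t; split => //; rewrite /dS !cosDpi !sinDpi !opprK.
have BM (x : circle R * R) : annulus x -> _ := fun Ax => billiard_mapE a0 ecc e01 hUps x.1 Ax.
split => //.
- exact: cX_continuous hUps.
- exact: cY_continuous hUps.
- exact: cXY1 a0 ecc e01 hUps.
- exact: cXY_inj a0 ecc e01 hUps.
- by move=> t; apply: (cvg_comp _ _ (cS t)); exact: cproj_continuous.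
- by move=> t; have [h _] := cs (S t); rewrite SK in h.
- by move=> t; have [_ h] := cs (S t); rewrite SK in h.
- exact: dissipation_continuous hk hlam.
- exact: dissipation_bound hlam.
- exact: dissipation_increasing hk hlam.
- move=> t; have [g gl gE] := dissipation_lift hk hlam.
  have [C C0 HC] := lip_comp2 (lip_comp1 (strict_lip (strict_fst (t, 0))) (strictS t))
    (strict_lip (strict_snd (t, 0))) (gl (S t, 0)).
  exists C => //.
  have n1 : \forall p \near ((t, 0) : R * R), `|p.2| <= 1.
    have : (p : R * R).2 @[p --> ((t, 0) : R * R)] --> (0 : R) by exact: cvg_snd.
    by move=> /cvgr0_norm_le; apply.
  apply: filterS3 HC (near_fst (t, 0) n1) (near_snd (t, 0) n1) => z hz h1 h2.
  by rewrite /= !gE.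
- by move=> x /BM; rewrite -surjective_pairing => -[].
- by move=> x /BM; rewrite -surjective_pairing => -[].
- move=> x /BM; rewrite -surjective_pairing => -[_ _ h].
  by rewrite /f /dissipative_billiard /= -h -surjective_pairing.
Qed.

End Instance.

Theorem theoremB (R : realType) (F1 F2 : R * R) (a e : R)
    (Ups : circle R -> R * R) (k : nat) (lam : circle R * R -> R)
    (sH sE : circle R)
    (ha : 0 < a)
    (he : eccentricity F1 F2 a = e) (he01 : 0 < e < 1)
    (hUps : arclength_param (ellipse F1 F2 a) Ups)
    (hk : (2 <= k)%N) (hlam : dissipation k.-1 lam)
    (hH : major_axis_line F1 F2 (Ups sH))
    (hE : minor_axis_line F1 F2 (Ups sE)) :
  let f := dissipative_billiard (ellipse_domain F1 F2 a) Ups lam in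
  let H : circle R * R := (sH, 0) in
  let E : circle R * R := (sE, 0) in
  [/\ saddle f H /\ saddle f (f H),
      sink f E /\ sink f (f E),
      [/\ attractor f = birkhoff_attractor f,
          birkhoff_attractor f = unstable_set_orbit f H `|` [set E; f E]
        & unstable_set_orbit f H `|` [set E; f E] =
          closure (unstable_set_orbit f H)]
    & forall i : nat, (i < 2)%N ->
        exists C1 C2 : set (circle R * R),
          [/\ unstable_branches f (iter i f H) C1 C2,
              unstable_set2 f (iter i f H) `\ iter i f H = C1 `|` C2,
              C1 `&` C2 = set0,
              C1 `<=` stable_set2 f (iter 1 f E)
            & C2 `<=` stable_set2 f (iter 2 f E)]].
Proof.
move=> f H E.
have [S [Th [dS [M ThK SK strictSTh dSP]]]] := billiard_model ha he he01 hUps hk hlam.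
have YH : cY F1 F2 a Ups H.1 = 0 by exact: major_axis_cY hH.
have XE : cX F1 F2 a Ups E.1 = 0 by exact: (minor_axis_cX ha he he01 hE).
have aH : axis_points (cX F1 F2 a Ups) (cY F1 F2 a Ups) H by split; rewrite //= YH mulr0.
have aE : axis_points (cX F1 F2 a Ups) (cY F1 F2 a Ups) E by split; rewrite //= XE mul0r.
have [_ YH' _] := axis_f M aH; rewrite YH oppr0 in YH'.
have [XE' _ _] := axis_f M aE; rewrite XE oppr0 in XE'.
have aH' := axis_faxis M aH; have aE' := axis_faxis M aE.
have ptP (p : circle R * R) : p.2 = 0 -> exists t, p = (cproj (S t), 0).
  move=> p2; have [x xp] := cproj_surj p.1.
  by exists (Th x); rewrite ThK xp -p2 -surjective_pairing.
have sad p : axis_points (cX F1 F2 a Ups) (cY F1 F2 a Ups) p -> cY F1 F2 a Ups p.1 = 0 ->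
    saddle f p.
  move=> [p2 _]; have [t ->] := ptP p p2; rewrite (model_ptY M) => st.
  apply: (saddle_at M (S := S) (Th := Th) (dS := dS)) => //; rewrite ?st ?mulr0//.
  - by move=> u; have [] := strictSTh u.
  - by move=> u; have [] := strictSTh u.
  - by move=> u; have [] := dSP u.
  - by have [] := dSP t.
have snk p : axis_points (cX F1 F2 a Ups) (cY F1 F2 a Ups) p -> cX F1 F2 a Ups p.1 = 0 ->
    sink f p.
  move=> [p2 _]; have [t ->] := ptP p p2; rewrite (model_ptX M) => ct.
  apply: (sink_at M (S := S) (Th := Th) (dS := dS)) => //; rewrite ?ct ?mul0r//.
  - by move=> u; have [] := strictSTh u.
  - by move=> u; have [] := strictSTh u.
  - by move=> u; have [] := dSP u.
  - by have [] := dSP t.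
split.
- by split; exact: sad.
- by split; exact: snk.
- rewrite -(birkhoffE M aH YH aE XE) -(attractorE M aH YH aE XE); split => //.
  exact: (attractor_closure M aH YH aE XE).
- move=> [|[|//]] _; exact: (saddle_branches M aE XE).
Qed.
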